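(* Let $(M,g)$ be a connected, oriented, $4$-dimensional Riemannian manifold admitting a non-parallel $*$-Killing $2$-form $\psi$. Let $(g_+=f_+^{-2}g,J_+,\omega_+)$, $(g_-=f_-^{-2}g,J_-,\omega_-)$ be the induced ambik\''ahler structure on $M_0$. Then, on the open set $M_1=M_0\cap M_S$, the Ricci endomorphism $\mathrm{Ric}$ of $g$ is $J_+$- and $J_-$-invariant, hence of the form $$\mathrm{Ric}=a\,\mathrm{I}+b\,\tau$$ for some functions $a,b$, where $\mathrm I$ denotes the identity of $TM_1$ and $\tau=-J_+J_-$. Moreover, the vector field $$K_1:=J_+\,\mathrm{grad}_g f_+=J_-\,\mathrm{grad}_g f_-=-\tfrac12\alpha^\sharp$$ is Killing with respect to $g$ and preserves the whole ambik\''ahler structure (i.e. its flow preserves $g_\pm$, $J_\pm$ and $\omega_\pm$) on $M_1$.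
   Context: On an oriented Riemannian $4$-manifold $(M,g)$ with Levi-Civita connection $\nabla$, a $2$-form $\psi$ is $*$-Killing if there is a real $1$-form $\alpha$ with $\nabla_X\psi=\alpha\wedge X^\flat$ for every vector field $X$; it is non-parallel if $\nabla\psi$ is not identically zero. Let $\psi_\pm=\frac12(\psi\pm*\psi)$, and let $\Psi_\pm$ be the skew-symmetric endomorphism of $TM$ with $g(\Psi_\pm X,Y)=\psi_\pm(X,Y)$. Set $f_\pm=|\Psi_\pm|/\sqrt2$ where $|A|^2=-\frac12\mathrm{tr}(A^2)$. Let $M_0=\{f_+>0,\ f_->0\}$ (open and dense in $M$), $M_S=\{f_+\neq f_-\}$ and $M_1=M_0\cap M_S$. On $M_0$ set $J_\pm=\Psi_\pm/f_\pm$, $g_\pm=f_\pm^{-2}g$, $\omega_\pm=g_\pm(J_\pm\cdot,\cdot)$: these form an ambik\''ahler structure, i.e. $(g_\pm,J_\pm,\omega_\pm)$ are K\''ahler, the metrics are conformal and $J_+,J_-$ induce opposite orientations (hence commute). $\alpha^\sharp$ is the vector field dual to $\alpha$ with respect to $g$. *)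

(* Defs.v *)
From HB Require Import structures.
From mathcomp Require Import all_boot all_order all_fingroup all_algebra.
From mathcomp Require Import all_classical all_reals all_analysis.

Set Implicit Arguments.
Unset Strict Implicit.
Unset Printing Implicit Defensive.

Import Order.TTheory GRing.Theory Num.Theory numFieldNormedType.Exports.

Local Open Scope classical_set_scope.
Local Open Scope ring_scope.

(* On a finite-dimensional V and an open U, existence and continuity of all
   iterated directional derivatives is the usual C^k property. *)
Fixpoint Ck (R : realType) (V W : normedModType R) (k : nat) (U : set V)
    (f : V -> W) : Prop :=
  (forall x, U x -> {for x, continuous f}) /\
  (if k is k'.+1
   then forall v, (forall x, U x -> derivable f x v) /\ Ck k' U ('D_v f)
   else True).

Definition smooth_on (R : realType) (V W : normedModType R) (U : set V)
    (f : V -> W) : Prop := forall k, Ck k U f.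

(* Column j holds the partial derivatives with respect to the j-th variable. *)
Definition jac (R : realType) (F : 'cV[R]_4 -> 'cV[R]_4) (x : 'cV[R]_4) :
    'M[R]_4 :=
  \matrix_(i, j) 'D_(delta_mx j 0) (fun y => F y i 0) x.

(* A smooth 4-manifold with a (not necessarily maximal) oriented atlas. The maps
   coord c and coordV c are total, but only their restrictions to chart_dom c
   and to coord c @` chart_dom c are meaningful. *)
Record oriented_manifold4 (R : realType) := OrientedManifold4 {
  carrier :> topologicalType;
  chart : Type;
  chart_dom : chart -> set carrier;
  coord : chart -> carrier -> 'cV[R]_4;
  coordV : chart -> 'cV[R]_4 -> carrier;
  chart_at : carrier -> chart;
  manifold_hausdorff : hausdorff_space carrier;
  manifold_second_countable : @second_countable carrier;
  chart_at_dom : forall p, chart_dom (chart_at p) p;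
  chart_dom_open : forall c, open (chart_dom c);
  coord_img_open : forall c, open (coord c @` chart_dom c);
  coordK : forall c p, chart_dom c p -> coordV c (coord c p) = p;
  coord_cont : forall c p, chart_dom c p -> {for p, continuous (coord c)};
  coordV_cont : forall c x, (coord c @` chart_dom c) x ->
    {for x, continuous (coordV c)};
  transition_smooth : forall c d,
    smooth_on (coord c @` (chart_dom c `&` chart_dom d))
              (coord d \o coordV c);
  transition_oriented : forall c d p, chart_dom c p -> chart_dom d p ->
    0 < \det (jac (coord d \o coordV c) (coord c p)) }.

Arguments chart {R} o.
Arguments chart_dom {R o} c.
Arguments coord {R o} c.
Arguments coordV {R o} c.
Arguments chart_at {R o}.

(* Tensor fields are given by their components: T c p is the array of components
   of T at p in the coordinate frame of the chart c, relevant when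
   chart_dom c p. Vectors are columns, covectors are rows, an endomorphism acts
   on columns from the left, and a covariant 2-tensor B is the matrix with
   B(X, Y) = X^T *m B *m Y. *)
Section Fields.
Variables (R : realType) (M : oriented_manifold4 R).

Definition vfield := chart M -> M -> 'cV[R]_4.
Definition covfield := chart M -> M -> 'rV[R]_4.
Definition matfield := chart M -> M -> 'M[R]_4.

Definition transition_jac (c d : chart M) (p : M) : 'M[R]_4 :=
  jac (coord d \o coordV c) (coord c p).

Definition smooth_comp (V : normedModType R) (S : set M)
    (F : chart M -> M -> V) : Prop :=
  forall c, smooth_on (coord c @` (chart_dom c `&` S)) (F c \o coordV c).

Definition smooth_fun (S : set M) (f : M -> R) : Prop :=
  smooth_comp S (fun _ => f).

Definition vector_field_on (S : set M) (X : vfield) : Prop :=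
  smooth_comp S X /\
  forall c d p, S p -> chart_dom c p -> chart_dom d p ->
    X d p = transition_jac c d p *m X c p.

Definition tensor02_law (T : matfield) : Prop :=
  forall c d p, chart_dom c p -> chart_dom d p ->
    T c p = (transition_jac c d p)^T *m T d p *m transition_jac c d p.

Record one_form := OneForm {
  one_form_comp :> chart M -> M -> 'rV[R]_4;
  one_form_smooth : smooth_comp setT one_form_comp;
  one_form_law : forall c d p, chart_dom c p -> chart_dom d p ->
    one_form_comp c p = one_form_comp d p *m transition_jac c d p }.

Record two_form := TwoForm {
  two_form_comp :> chart M -> M -> 'M[R]_4;
  two_form_smooth : smooth_comp setT two_form_comp;
  two_form_tensor : tensor02_law two_form_comp;
  two_form_skew : forall c p, chart_dom c p ->
    (two_form_comp c p)^T = - two_form_comp c p }.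

Record metric := Metric {
  metric_comp :> chart M -> M -> 'M[R]_4;
  metric_smooth : smooth_comp setT metric_comp;
  metric_tensor : tensor02_law metric_comp;
  metric_sym : forall c p, chart_dom c p -> (metric_comp c p)^T = metric_comp c p;
  metric_pos : forall c p (v : 'cV[R]_4), chart_dom c p -> v != 0 ->
    0 < (v^T *m metric_comp c p *m v) 0 0 }.

Definition pd (c : chart M) (k : 'I_4) (F : M -> R) (p : M) : R :=
  'D_(delta_mx k 0) (F \o coordV c) (coord c p).

Section Riemannian.
Variable g : matfield.

(* christoffel c p k i j is the component of index k of nabla_(e_i) e_j, for
   nabla the Levi-Civita connection and (e_i) the coordinate frame of c
   (Koszul formula). *)
Definition christoffel (c : chart M) (p : M) (k i j : 'I_4) : R :=
  2^-1 * \sum_(l < 4) invmx (g c p) k l *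
    (pd c i (fun q => g c q j l) p + pd c j (fun q => g c q i l) p
     - pd c l (fun q => g c q i j) p).

(* (nabla_X T)(e_i, e_j) for a covariant 2-tensor T. *)
Definition nabla02 (T : matfield) (c : chart M) (p : M) (X : 'cV[R]_4) :
    'M[R]_4 :=
  \matrix_(i, j) \sum_(k < 4) X k 0 *
    (pd c k (fun q => T c q i j) p
     - \sum_(l < 4) (christoffel c p l k i * T c p l j
                     + christoffel c p l k j * T c p i l)).

(* R(e_i, e_j) e_k = \sum_l curvature c p l k i j * e_l, with
   R(X, Y) = [nabla_X, nabla_Y] - nabla_[X, Y]. *)
Definition curvature (c : chart M) (p : M) (l k i j : 'I_4) : R :=
  pd c i (fun q => christoffel c q l j k) p
  - pd c j (fun q => christoffel c q l i k) p
  + \sum_(m < 4) (christoffel c p l i m * christoffel c p m j k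
                  - christoffel c p l j m * christoffel c p m i k).

(* ric(Y, Z) is the trace of X |-> R(X, Y) Z. *)
Definition ricci_tensor : matfield := fun c p =>
  \matrix_(j, k) \sum_(i < 4) curvature c p i k i j.

(* The endomorphism A with g(A X, Y) = B(X, Y), i.e. A^T *m g = B. *)
Definition endo_of (B : matfield) : matfield := fun c p =>
  invmx (g c p) *m (B c p)^T.

Definition ricci_endo : matfield := endo_of ricci_tensor.

Definition flat (c : chart M) (p : M) (X : 'cV[R]_4) : 'rV[R]_4 :=
  X^T *m g c p.

Definition sharp (a : covfield) : vfield := fun c p =>
  invmx (g c p) *m (a c p)^T.

Definition grad (f : M -> R) : vfield :=
  sharp (fun c p => \row_(j < 4) pd c j f p).

(* ( *psi)_ij = 1/2 \sum_(k, l) sqrt(det g) eps_ijkl psi^kl; the pairs (k, l)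
   with eps_ijkl <> 0 are encoded by the permutations s = (i, j, k, l). *)
Definition hodge (psi : matfield) : matfield := fun c p =>
  \matrix_(i, j) (2^-1 * Num.sqrt (\det (g c p)) *
    \sum_(s : 'S_4 | (s 0 == i) && (s 1 == j))
      (-1) ^+ s * (invmx (g c p) *m psi c p *m (invmx (g c p))^T)
                    (s (inord 2)) (s (inord 3))).

(* (L_X g)_ij = X^k d_k g_ij + g_kj d_i X^k + g_ik d_j X^k *)
Definition lie_metric (X : vfield) : matfield := fun c p =>
  \matrix_(i, j) \sum_(k < 4)
    (X c p k 0 * pd c k (fun q => g c q i j) p
     + g c p k j * pd c i (fun q => X c q k 0) p
     + g c p i k * pd c j (fun q => X c q k 0) p).

Definition killing_on (S : set M) (X : vfield) : Prop :=
  vector_field_on S X /\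
  forall c p, S p -> chart_dom c p -> lie_metric X c p = 0.

End Riemannian.

(* (a /\ b)(Y, Z) = a(Y) b(Z) - a(Z) b(Y) *)
Definition wedge (a b : 'rV[R]_4) : 'M[R]_4 := a^T *m b - b^T *m a.

(* nabla_X psi = alpha /\ X^flat *)
Definition star_killing_with (g : metric) (psi : two_form) (alpha : one_form) :
    Prop :=
  forall c p (X : 'cV[R]_4), chart_dom c p ->
    nabla02 g psi c p X = wedge (alpha c p) (flat g c p X).

Definition parallel (g : metric) (psi : two_form) : Prop :=
  forall c p (X : 'cV[R]_4), chart_dom c p -> nabla02 g psi c p X = 0.

(* In the next section e = 1 gives psi_+, Psi_+, f_+, ... and e = -1 gives
   psi_-, Psi_-, f_-, ... *)
Section Ambikahler.
Variables (g : metric) (psi : two_form) (e : R).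

Definition psi_pm : matfield := fun c p =>
  2^-1 *: (psi c p + e *: hodge g psi c p).

Definition Psi_pm : matfield := endo_of g psi_pm.

Definition endo_norm (A : 'M[R]_4) : R := Num.sqrt (- 2^-1 * \tr (A *m A)).

(* |Psi_+-| does not depend on the chart in which it is computed. *)
Definition f_pm (p : M) : R :=
  endo_norm (Psi_pm (chart_at p) p) / Num.sqrt 2.

(* The following fields are meaningful where f_pm > 0. *)
Definition J_pm : matfield := fun c p => (f_pm p)^-1 *: Psi_pm c p.

Definition g_pm : matfield := fun c p => (f_pm p) ^- 2 *: g c p.

(* omega(X, Y) = g(J X, Y) *)
Definition omega_pm : matfield := fun c p => (J_pm c p)^T *m g_pm c p.

End Ambikahler.

Definition M_0 (g : metric) (psi : two_form) : set M :=
  [set p | 0 < f_pm g psi 1 p /\ 0 < f_pm g psi (-1) p].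

Definition M_S (g : metric) (psi : two_form) : set M :=
  [set p | f_pm g psi 1 p != f_pm g psi (-1) p].

Definition M_1 (g : metric) (psi : two_form) : set M :=
  M_0 g psi `&` M_S g psi.

(* Phi is a flow of X, inside S, on the time interval ]a, b[ and for initial
   points in U. *)
Record local_flow (S : set M) (X : vfield) (U : set M) (a b : R)
    (Phi : R -> M -> M) : Prop := LocalFlow {
  flow_times : a < 0 /\ 0 < b;
  flow_open : open U;
  flow_dom : U `<=` S;
  flow_in : forall t p, a < t < b -> U p -> S (Phi t p);
  flow0 : forall p, U p -> Phi 0 p = p;
  flow_cont : forall t p, a < t < b -> U p ->
    {for (t, p), continuous (fun z : R * M => Phi z.1 z.2)};
  flow_smooth : forall c d, smooth_on
    [set z : R^o * 'cV[R]_4 | [/\ a < (z.1 : R) < b,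
       (coord c @` (chart_dom c `&` U)) z.2
       & chart_dom d (Phi z.1 (coordV c z.2))]]
    (fun z => coord d (Phi z.1 (coordV c z.2)));
  flow_integral : forall d t p, a < t < b -> U p -> chart_dom d (Phi t p) ->
    is_derive (t : R^o) (1 : R^o) (fun s : R^o => coord d (Phi s p))
      (X d (Phi t p)) }.

(* Matrix of the differential of F at p, in the charts c at p and d at F p. *)
Definition diff_mx (F : M -> M) (c d : chart M) (p : M) : 'M[R]_4 :=
  jac (coord d \o F \o coordV c) (coord c p).

Definition flow_preserves02 (S : set M) (X : vfield) (T : matfield) : Prop :=
  forall U a b Phi, local_flow S X U a b Phi ->
  forall t p c d, a < t < b -> U p -> chart_dom c p -> chart_dom d (Phi t p) ->
    (diff_mx (Phi t) c d p)^T *m T d (Phi t p) *m diff_mx (Phi t) c d p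
    = T c p.

Definition flow_preserves11 (S : set M) (X : vfield) (A : matfield) : Prop :=
  forall U a b Phi, local_flow S X U a b Phi ->
  forall t p c d, a < t < b -> U p -> chart_dom c p -> chart_dom d (Phi t p) ->
    A d (Phi t p) *m diff_mx (Phi t) c d p
    = diff_mx (Phi t) c d p *m A c p.

End Fields.

Arguments M_0 {R M}.
Arguments M_S {R M}.
Arguments M_1 {R M}.

(* Main.v *)
Require Import Defs.
From HB Require Import structures.
From mathcomp Require Import all_boot all_order all_fingroup all_algebra.
From mathcomp Require Import all_classical all_reals all_analysis.
From mathcomp Require Import ring lra.

Set Implicit Arguments.
Unset Strict Implicit.
Unset Printing Implicit Defensive.

Import Order.TTheory GRing.Theory Num.Theory numFieldNormedType.Exports.
Import Defs.

Local Open Scope classical_set_scope.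
Local Open Scope ring_scope.

(** Write Psi and Phi for the endomorphisms of psi and of its Hodge dual,
    psi_r = (psi + r *psi) / 2 for r = 1, -1, and K for -1/2 times the vector
    dual to alpha. In dimension 4 the endomorphisms of self-dual and of
    anti-self-dual forms commute, and each of the two families satisfies Clifford
    relations (sd_asd_comm, anticomm); so Psi_r^2 = - f_r^2, and
    Psi Phi = f_-^2 - f_+^2 is a multiple of the identity that does not vanish
    on M_1 (endo_form_star).

    Gradients. As nabla_X psi = alpha /\ X, the derivative of f_r^2 along X
    is 2 psi_r(X, K), the self-dual or anti-self-dual part of alpha /\ X being
    the only one that pairs with psi_r (isd_fsq). Hence f_r grad f_r = - Psi_r K,
    and J_r grad f_r = K for both signs (J_grad).

    Ricci tensor. Differentiating the equation once more, the curvature acts on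
    psi by R_ij^T psi + psi R_ij = - (B_i /\ g_j - B_j /\ g_i) with
    B = nabla alpha (curv_wedge), and on *psi by the Hodge dual of that form, since the Hodge
    star is parallel. Contracting over one index gives g Ric Psi up to a skew
    form (contract_derivation): for psi the contraction is
    - (tr B) g - 2 B (contract_wedge), while for *psi it is skew
    (contract_star_wedge). A skew g Ric Phi means that Ric commutes with Phi, and
    as Psi is on M_1 a multiple of the inverse of Phi, Ric commutes with Psi
    too. Then g Ric Psi is skew as well, which forces B + B^T to be a multiple of
    g, and a trace gives B + B^T = 0: K is a Killing field (ricci_commutes).

    Splitting. A symmetric endomorphism commuting with J_+ and J_- is a
    combination of 1 and J_+ J_- (commuting_sym), whose coefficients are read off
    as traces. They are smooth functions on M_1 because the Ricci
    endomorphism is the same in all charts (ric_tensor).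

    Flows. K preserves g. It also preserves psi: nabla_K psi = alpha /\ K
    vanishes, and the remaining term of L_K psi is the skew part of the
    derivative of the 1-form psi(K, .), which is half the differential of
    f_+^2 + f_-^2 (form_cov_killing). It then preserves *psi, hence psi_+ and
    psi_-. A tensor with zero Lie derivative is preserved by the flow: its
    pull-back along an integral curve has zero derivative, by the variational
    equation of the flow (isd_pullback). All of g_r, J_r and omega_r are built
    algebraically from g and psi_r (flow_ambikahler).

    Everything but the last step is done in one chart, on matrix valued functions
    on an open set of R^4; the symbols of the Levi-Civita connection are grouped
    into matrices gam_k with (gam_k)_lj the symbol of upper index l, so that
    nabla_k T = d_k T - gam_k^T T - T gam_k for a covariant 2-tensor T. *)

(** * Skew matrices of size 4 *)

Notation i0 := (@Ordinal 4 0 isT).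
Notation i1 := (@Ordinal 4 1 isT).
Notation i2 := (@Ordinal 4 2 isT).
Notation i3 := (@Ordinal 4 3 isT).

Lemma ord4_ind (P : 'I_4 -> Prop) : P i0 -> P i1 -> P i2 -> P i3 -> forall i, P i.
Proof.
move=> P0 P1 P2 P3 [[|[|[|[|n]]]] lt_n] //.
- by rewrite (_ : Ordinal _ = i0) //; apply: val_inj.
- by rewrite (_ : Ordinal _ = i1) //; apply: val_inj.
- by rewrite (_ : Ordinal _ = i2) //; apply: val_inj.
- by rewrite (_ : Ordinal _ = i3) //; apply: val_inj.
Qed.

Lemma sum4 (V : nmodType) (F : 'I_4 -> V) :
  \sum_(i < 4) F i = F i0 + F i1 + F i2 + F i3.
Proof.
rewrite !big_ord_recl big_ord0 addr0 !addrA.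
by congr (F _ + F _ + F _ + F _); apply: val_inj.
Qed.

Section Dual.
Variable R : realFieldType.
Implicit Types (A N P X Y : 'M[R]_4).

(** Locked, so that entries are computed only by skew4E. *)
Definition skew4 (a b c d e f : R) : 'M[R]_4 := locked (\matrix_(i, j)
  nth 0 (nth [::] [:: [:: 0; a; b; c]; [:: - a; 0; d; e];
                      [:: - b; - d; 0; f]; [:: - c; - e; - f; 0]] i) j).

Lemma skew4E a b c d e f (s := skew4 a b c d e f) :
  (((s i0 i0 = 0) * (s i0 i1 = a) * (s i0 i2 = b) * (s i0 i3 = c)) *
   ((s i1 i0 = - a) * (s i1 i1 = 0) * (s i1 i2 = d) * (s i1 i3 = e)) *
   ((s i2 i0 = - b) * (s i2 i1 = - d) * (s i2 i2 = 0) * (s i2 i3 = f)) *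
   ((s i3 i0 = - c) * (s i3 i1 = - e) * (s i3 i2 = - f) * (s i3 i3 = 0)))%type.
Proof. by rewrite /s /skew4 -lock !mxE. Qed.

(** The metric-free part of the Hodge star on 2-forms: it exchanges
    complementary pairs of indices. *)
Definition dual P := skew4 (P i2 i3) (P i3 i1) (P i1 i2) (P i0 i3) (P i2 i0) (P i0 i1).

(** The Pfaffian of a skew matrix. *)
Definition pf P : R := P i0 i1 * P i2 i3 - P i0 i2 * P i1 i3 + P i0 i3 * P i1 i2.

Lemma det4 A : \det A =
  A i0 i0 * (A i1 i1 * (A i2 i2 * A i3 i3 - A i2 i3 * A i3 i2)
           - A i1 i2 * (A i2 i1 * A i3 i3 - A i2 i3 * A i3 i1)
           + A i1 i3 * (A i2 i1 * A i3 i2 - A i2 i2 * A i3 i1))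
 - A i0 i1 * (A i1 i0 * (A i2 i2 * A i3 i3 - A i2 i3 * A i3 i2)
           - A i1 i2 * (A i2 i0 * A i3 i3 - A i2 i3 * A i3 i0)
           + A i1 i3 * (A i2 i0 * A i3 i2 - A i2 i2 * A i3 i0))
 + A i0 i2 * (A i1 i0 * (A i2 i1 * A i3 i3 - A i2 i3 * A i3 i1)
           - A i1 i1 * (A i2 i0 * A i3 i3 - A i2 i3 * A i3 i0)
           + A i1 i3 * (A i2 i0 * A i3 i1 - A i2 i1 * A i3 i0))
 - A i0 i3 * (A i1 i0 * (A i2 i1 * A i3 i2 - A i2 i2 * A i3 i1)
           - A i1 i1 * (A i2 i0 * A i3 i2 - A i2 i2 * A i3 i0)
           + A i1 i2 * (A i2 i0 * A i3 i1 - A i2 i1 * A i3 i0)).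
Proof.
pose f (i j : nat) := A (inord i) (inord j).
have fE i j : A i j = f i j by rewrite /f !inord_val.
rewrite !fE.
rewrite (expand_det_row _ ord0) !big_ord_recl big_ord0 /cofactor.
rewrite !(expand_det_row _ ord0) !big_ord_recl !big_ord0 /cofactor.
rewrite !(expand_det_row _ ord0) !big_ord_recl !big_ord0 /cofactor.
rewrite !det_mx11 !mxE /= !fE /= /bump /=.
rewrite ?(expr0, expr1, exprS) /=.
ring.
Qed.

Ltac mx4 := let i := fresh "i" in let j := fresh "j" in
  apply/matrixP => i j; elim/ord4_ind: i; elim/ord4_ind: j.

Lemma skewE P : P^T = - P ->
  P = skew4 (P i0 i1) (P i0 i2) (P i0 i3) (P i1 i2) (P i1 i3) (P i2 i3).
Proof.
move=> skP; have h i j : P j i = - P i j by move/matrixP: skP => /(_ i j); rewrite !mxE.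
have h0 i : P i i = 0 by move: (h i i) => hi; lra.
by mx4; rewrite !skew4E ?h0 // h.
Qed.

Lemma dualE a b c d e f : dual (skew4 a b c d e f) = skew4 f (- e) d c (- b) a.
Proof. by rewrite /dual !skew4E. Qed.

Lemma skew4_tr a b c d e f : (skew4 a b c d e f)^T = - skew4 a b c d e f.
Proof. by mx4; rewrite !mxE !skew4E ?oppr0 ?opprK. Qed.

Lemma dual_skew P : (dual P)^T = - dual P.
Proof. exact: skew4_tr. Qed.

Lemma dualD X Y : dual (X + Y) = dual X + dual Y.
Proof. by mx4; rewrite !mxE !skew4E ?mxE; ring. Qed.

Lemma dualZ k X : dual (k *: X) = k *: dual X.
Proof. by mx4; rewrite !mxE !skew4E ?mxE; ring. Qed.

Lemma dualK P : P^T = - P -> dual (dual P) = P.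
Proof. by move=> /skewE ->; rewrite !dualE !opprK. Qed.

(** For skew P, - dual P is the Pfaffian adjugate. *)
Lemma mul_dual P : P^T = - P -> P *m dual P = (- pf P)%:M.
Proof.
move=> /skewE ->; rewrite dualE /pf !skew4E.
by mx4; rewrite !mxE sum4 !skew4E /=; ring.
Qed.

Lemma dual_mul P : P^T = - P -> dual P *m P = (- pf P)%:M.
Proof.
move=> /skewE ->; rewrite dualE /pf !skew4E.
by mx4; rewrite !mxE sum4 !skew4E /=; ring.
Qed.

Lemma tr_dual X Y : X^T = - X -> Y^T = - Y -> \tr (X *m dual Y) = \tr (dual X *m Y).
Proof.
by move=> /skewE -> /skewE ->; rewrite !dualE /mxtrace !sum4 !mxE !sum4 !skew4E; ring.
Qed.

(** Expanding a congruence in 2 x 2 minors keeps the polynomial identity of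
    dual_congr within reach of ring. *)
Lemma congr_skew4 N a b c d e f i j :
  (N *m skew4 a b c d e f *m N^T) i j =
  a * (N i i0 * N j i1 - N i i1 * N j i0) + b * (N i i0 * N j i2 - N i i2 * N j i0)
  + c * (N i i0 * N j i3 - N i i3 * N j i0) + d * (N i i1 * N j i2 - N i i2 * N j i1)
  + e * (N i i1 * N j i3 - N i i3 * N j i1) + f * (N i i2 * N j i3 - N i i3 * N j i2).
Proof. by rewrite !mxE sum4 !mxE !sum4 !skew4E; ring. Qed.

(** The derivative of dual_congr at the identity. *)
Lemma dual_deriv A P : P^T = - P ->
  dual (A^T *m P + P *m A) = \tr A *: dual P - A *m dual P - dual P *m A^T.
Proof.
move=> /skewE ->; rewrite dualE /mxtrace sum4.
mx4; rewrite !mxE !skew4E ?mxE !sum4 !mxE !skew4E.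
all: ring.
Qed.

(** The identity that makes the Hodge star natural: as an adjugate, dual
    behaves contragrediently, up to the determinant. *)
Lemma dual_congr N P : P^T = - P ->
  N^T *m dual (N *m P *m N^T) *m N = \det N *: dual P.
Proof.
move=> /skewE ->; rewrite dualE det4.
move: (P i0 i1) (P i0 i2) (P i0 i3) (P i1 i2) (P i1 i3) (P i2 i3) => a b c d e f.
have E : dual (N *m skew4 a b c d e f *m N^T) = dual (N *m skew4 a b c d e f *m N^T) by [].
rewrite {2}/dual !congr_skew4 in E; rewrite E.
have tE a' b' : N^T a' b' = N b' a' by rewrite mxE.
have cE u v w p q r i j : (N^T *m skew4 u v w p q r *m N) i j =
    u * (N i0 i * N i1 j - N i1 i * N i0 j) + v * (N i0 i * N i2 j - N i2 i * N i0 j)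
    + w * (N i0 i * N i3 j - N i3 i * N i0 j) + p * (N i1 i * N i2 j - N i2 i * N i1 j)
    + q * (N i1 i * N i3 j - N i3 i * N i1 j) + r * (N i2 i * N i3 j - N i3 i * N i2 j).
  by rewrite -{2}[N]trmxK congr_skew4 !tE.
apply/matrixP => i j; rewrite cE [RHS]mxE.
elim/ord4_ind: i; elim/ord4_ind: j; rewrite !skew4E.
all: ring.
Qed.

End Dual.

(** Proves identities that are linear in matrix products, which are abstracted
    before the comparison of entries. *)
(** * The Hodge star of a metric at a point *)

Ltac mxlin :=
  rewrite ?mulmxA;
  repeat (let x := fresh "x" in set x := (_ *m _); move: x => x);
  repeat (let x := fresh "x" in set x := (_ ^T); move: x => x);
  let i := fresh "i" in let j := fresh "j" in
  apply/matrixP => i j; rewrite !mxE; ring.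

Section Star.
Variable R : rcfType.
Implicit Types (A J N P g : 'M[R]_4).

(** The Levi-Civita symbol of (i, j, k, l) as the determinant of the matrix
    whose rows are the corresponding basis vectors: the sum over permutations with
    two prescribed values becomes an unrestricted sum over k and l. *)
Lemma sum_sign_perm (X : 'M[R]_4) i j :
  \sum_(s : 'S_4 | (s 0 == i) && (s 1 == j))
      (-1) ^+ s * X (s (inord 2)) (s (inord 3)) =
  \sum_(k < 4) \sum_(l < 4) X k l *
   \det (\matrix_(r < 4, c < 4) (nth i [:: i; j; k; l] r == c)%:R).
Proof.
under [RHS]eq_bigr do under eq_bigr do rewrite mulr_sumr.
under [RHS]eq_bigr do rewrite exchange_big.
rewrite [RHS]exchange_big /= big_mkcond; apply: eq_bigr => s _.
have -> : inord 2 = i2 :> 'I_4 by apply: val_inj; rewrite val_insubd.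
have -> : inord 3 = i3 :> 'I_4 by apply: val_inj; rewrite val_insubd.
have -> : 0 = i0 :> 'I_4 by apply: val_inj.
have -> : 1 = i1 :> 'I_4 by apply: val_inj.
rewrite (bigD1 (s i2)) //= (bigD1 (s i3)) //=.
have dE k l : \prod_(r < 4) (\matrix_(r < 4, c < 4) (nth i [:: i; j; k; l] r == c)%:R :
  'M[R]_4) r (s r)
  = (i == s i0)%:R * (j == s i1)%:R * (k == s i2)%:R * (l == s i3)%:R.
  rewrite !big_ord_recl big_ord0 mulr1 !mxE /= !mulrA.
  by congr (_ * _ * _ * _); congr (_ == _)%:R; congr (s _); apply: val_inj.
rewrite dE big1 => [|l ne_l]; last by rewrite dE (negbTE ne_l) !mulr0.
rewrite big1 => [|k ne_k]; last first.
  by rewrite big1 // => l _; rewrite dE (negbTE ne_k) !(mulr0, mul0r).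
rewrite !addr0 !eqxx !mulr1 ![_ == s _]eq_sym.
by case: (s i0 == i); case: (s i1 == j); rewrite ?(mulr0, mul0r, mulr1) //= mulrC.
Qed.

Lemma dual_perm (X : 'M[R]_4) i j : X^T = - X ->
  2^-1 * (\sum_(s : 'S_4 | (s 0 == i) && (s 1 == j))
      (-1) ^+ s * X (s (inord 2)) (s (inord 3))) = dual X i j.
Proof.
move=> /skewE ->; rewrite sum_sign_perm dualE.
have skew_sum a b c d e f (D : 'I_4 -> 'I_4 -> R) :
    \sum_(k < 4) \sum_(l < 4) skew4 a b c d e f k l * D k l =
    a * (D i0 i1 - D i1 i0) + b * (D i0 i2 - D i2 i0) + c * (D i0 i3 - D i3 i0)
    + d * (D i1 i2 - D i2 i1) + e * (D i1 i3 - D i3 i1) + f * (D i2 i3 - D i3 i2).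
  by rewrite !sum4 !skew4E; ring.
pose b (p q : 'I_4) : R := (p == q)%:R.
have detE k l : \det (\matrix_(r < 4, c < 4) (nth i [:: i; j; k; l] r == c)%:R) =
    b i i0 * (b j i1 * (b k i2 * b l i3 - b k i3 * b l i2)
    - b j i2 * (b k i1 * b l i3 - b k i3 * b l i1)
    + b j i3 * (b k i1 * b l i2 - b k i2 * b l i1))
    - b i i1 * (b j i0 * (b k i2 * b l i3 - b k i3 * b l i2)
    - b j i2 * (b k i0 * b l i3 - b k i3 * b l i0)
    + b j i3 * (b k i0 * b l i2 - b k i2 * b l i0))
    + b i i2 * (b j i0 * (b k i1 * b l i3 - b k i3 * b l i1)
    - b j i1 * (b k i0 * b l i3 - b k i3 * b l i0)
    + b j i3 * (b k i0 * b l i1 - b k i1 * b l i0))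
    - b i i3 * (b j i0 * (b k i1 * b l i2 - b k i2 * b l i1)
    - b j i1 * (b k i0 * b l i2 - b k i2 * b l i0)
    + b j i2 * (b k i0 * b l i1 - b k i1 * b l i0)).
  by rewrite det4 !mxE.
rewrite skew_sum !detE {detE} /b.
elim/ord4_ind: i; elim/ord4_ind: j; rewrite /eq_op /= ?skew4E.
all: by field.
Qed.

(** The Hodge star of the metric g on 2-forms; hodge_star compares it with the
    sum over permutations. Locked to protect it from unification. *)
Definition hstar g P := locked ((Num.sqrt (\det g))^-1 *: (g *m dual P *m g)).

(** The endomorphism A with g(A X, Y) = P(X, Y). *)
Definition gendo g P := locked (invmx g *m P^T).

Lemma hstarE g P : hstar g P = (Num.sqrt (\det g))^-1 *: (g *m dual P *m g).
Proof. by rewrite /hstar -lock. Qed.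

Lemma gendoE g P : gendo g P = invmx g *m P^T.
Proof. by rewrite /gendo -lock. Qed.

Lemma star_congr g J P : 0 < \det J -> P^T = - P ->
  hstar (J^T *m g *m J) (J^T *m P *m J) = J^T *m hstar g P *m J.
Proof.
move=> J_gt0 skP; rewrite !hstarE !det_mulmx det_tr.
have -> : \det J * \det g * \det J = (\det J) ^+ 2 * \det g by ring.
rewrite sqrtrM ?sqr_ge0 // sqrtr_sqr gtr0_norm // -scalemxAr -scalemxAl.
have := @dual_congr _ J^T P skP; rewrite det_tr trmxK => E.
have -> : J^T *m g *m J *m dual (J^T *m P *m J) *m (J^T *m g *m J)
   = J^T *m g *m (J *m dual (J^T *m P *m J) *m J^T) *m (g *m J) by rewrite !mulmxA.
rewrite E -scalemxAr -scalemxAl scalerA !mulmxA; congr (_ *: _).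
by rewrite invfM mulrC mulrA divff ?mul1r // gt_eqF.
Qed.

Lemma half_scalar (A : 'M[R]_4) c : A + A = c%:M -> A = (c / 2)%:M.
Proof.
move/matrixP => h; apply/matrixP => i j; move: (h i j); rewrite !mxE.
by case: (i == j); rewrite /= => hh; lra.
Qed.

Section Fixed.
Variable g : 'M[R]_4.
Hypotheses (g_sym : g^T = g) (g_gt0 : 0 < \det g).
Local Notation s := (Num.sqrt (\det g))^-1.
Local Notation star := (hstar g).
Local Notation endo := (gendo g).

Lemma metric_unit : g \in unitmx.
Proof. by rewrite unitmxE unitfE gt_eqF. Qed.

Lemma metric_inv_sym : (invmx g)^T = invmx g.
Proof. by rewrite trmx_inv g_sym. Qed.

Lemma star_scale : s * s * \det g = 1.
Proof.
rewrite -invfM -expr2 sqr_sqrtr ?ltW // mulVf // gt_eqF //.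
Qed.

Lemma star_skew P : (star P)^T = - star P.
Proof. by rewrite hstarE linearZ /= !trmx_mul g_sym dual_skew mulNmx mulmxN mulmxA scalerN. Qed.

Lemma starD X Y : star (X + Y) = star X + star Y.
Proof. by rewrite !hstarE dualD mulmxDr mulmxDl scalerDr. Qed.

Lemma starZ k X : star (k *: X) = k *: star X.
Proof. by rewrite !hstarE dualZ -scalemxAr -scalemxAl !scalerA mulrC. Qed.

Lemma starN X : star (- X) = - star X.
Proof. by rewrite -scaleN1r starZ scaleN1r. Qed.

Lemma starK P : P^T = - P -> star (star P) = P.
Proof.
move=> skP; rewrite !hstarE dualZ.
have := @dual_congr _ g (dual P) (dual_skew P); rewrite dualK // g_sym => E.
by rewrite -scalemxAr -scalemxAl E !scalerA star_scale scale1r.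
Qed.

Lemma endoE P : P^T = - P -> endo P = - (invmx g *m P).
Proof. by move=> skP; rewrite gendoE skP mulmxN. Qed.

Lemma endoD X Y : endo (X + Y) = endo X + endo Y.
Proof. by rewrite !gendoE linearD /= mulmxDr. Qed.

Lemma endoZ k X : endo (k *: X) = k *: endo X.
Proof. by rewrite !gendoE linearZ /= -scalemxAr. Qed.

Lemma endoN X : endo (- X) = - endo X.
Proof. by rewrite !gendoE linearN /= mulmxN. Qed.

Lemma endoK P : (endo P)^T *m g = P.
Proof. by rewrite gendoE trmx_mul trmxK metric_inv_sym mulmxKV // metric_unit. Qed.

Lemma endoT P : g *m endo P = P^T.
Proof. by rewrite gendoE mulKVmx // metric_unit. Qed.

Lemma form_endo A : (g *m A)^T = - (g *m A) ->
  endo ((g *m A)^T) = A /\ ((g *m A)^T)^T = - (g *m A)^T.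
Proof.
move=> sk; split; last by rewrite trmxK sk opprK.
by rewrite gendoE trmxK mulKmx // metric_unit.
Qed.

(** Raising one index of P and of its Hodge dual leaves the product of P with
    its Pfaffian adjugate. *)
Lemma endo_star P : P^T = - P ->
  endo P *m endo (star P) = (- s * pf P)%:M /\ endo (star P) *m endo P = (- s * pf P)%:M.
Proof.
move=> skP; rewrite !endoE ?star_skew // !mulNmx !mulmxN !opprK !hstarE; split.
- rewrite -!scalemxAr -[g *m _ *m g]mulmxA mulKmx ?metric_unit //.
  rewrite -[_ *m (dual P *m g)]mulmxA [P *m _]mulmxA mul_dual //.
  by rewrite mul_scalar_mx -scalemxAr mulVmx ?metric_unit // scalerA scalemx1 mulrN mulNr.
- rewrite -!scalemxAr -[g *m _ *m g]mulmxA mulKmx ?metric_unit //.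
  rewrite -scalemxAl -mulmxA [g *m (_ *m _)]mulmxA mulmxV ?metric_unit // mul1mx dual_mul //.
  by rewrite scale_scalar_mx mulrN mulNr.
Qed.

(** The polarisation of endo_star; that both orders give the same scalar is
    what relates self-dual to anti-self-dual forms. *)
Lemma endo_star_polar X Y : X^T = - X -> Y^T = - Y -> exists c,
  endo X *m endo (star Y) + endo Y *m endo (star X) = c%:M /\
  endo (star X) *m endo Y + endo (star Y) *m endo X = c%:M.
Proof.
move=> skX skY; have skXY : (X + Y)^T = - (X + Y) by rewrite linearD /= skX skY opprD.
have [E1 E2] := endo_star skXY; have [X1 X2] := endo_star skX; have [Y1 Y2] := endo_star skY.
exists (- s * pf (X + Y) - (- s * pf X) - (- s * pf Y)).
rewrite !rmorphB /=; split.
- rewrite -E1 -X1 -Y1 starD !endoD !(mulmxDl, mulmxDr).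
  by mxlin.
- rewrite -E2 -X2 -Y2 starD !endoD !(mulmxDl, mulmxDr).
  by mxlin.
Qed.

(** The Clifford relation of the forms of one duality type. *)
Lemma anticomm e X Y : e * e = 1 -> X^T = - X -> Y^T = - Y ->
  star X = e *: X -> star Y = e *: Y ->
  exists c, endo X *m endo Y + endo Y *m endo X = c%:M.
Proof.
move=> e2 skX skY sX sY; have [c [E _]] := endo_star_polar skX skY.
exists (e * c); rewrite -scale_scalar_mx -E sX sY !endoZ -!scalemxAr -scalerDr scalerA e2.
by rewrite scale1r.
Qed.

(** For one self-dual and one anti-self-dual form the two polarised products
    differ by a sign, so that their common scalar value vanishes. *)
Lemma sd_asd_comm X Y : X^T = - X -> Y^T = - Y ->
  star X = X -> star Y = - Y -> endo X *m endo Y = endo Y *m endo X.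
Proof.
move=> skX skY sX sY; have [c []] := endo_star_polar skX skY.
rewrite sX sY !endoN mulmxN mulNmx => E1 E2.
have c0 : c%:M = 0 :> 'M[R]_4.
  have : c%:M + c%:M = 0 :> 'M[R]_4 by rewrite -{1}E1 -E2; mxlin.
  by move/matrixP => h; apply/matrixP => i j; move: (h i j); rewrite !mxE => hh; lra.
by move: E2; rewrite c0 => /eqP; rewrite subr_eq0 => /eqP.
Qed.

Lemma mxtrace_endo_star P Q : P^T = - P -> Q^T = - Q ->
  \tr (endo P *m endo (star Q)) = \tr (endo (star P) *m endo Q).
Proof.
move=> skP skQ; rewrite !endoE ?star_skew // !mulNmx !mulmxN !opprK !hstarE.
rewrite -!scalemxAr -[g *m _ *m g]mulmxA mulKmx ?metric_unit //.
rewrite -[g *m _ *m g]mulmxA mulKmx ?metric_unit // -scalemxAl !linearZ /=; congr (_ * _).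
rewrite mulmxA mxtrace_mulC !mulmxA mulmxV ?metric_unit // mul1mx tr_dual //.
by rewrite -[_ *m g *m _ *m _]mulmxA -[_ *m g *m _]mulmxA mulKVmx ?metric_unit.
Qed.

Lemma sd_asd_trace X Y : X^T = - X -> Y^T = - Y ->
  star X = X -> star Y = - Y -> \tr (endo X *m endo Y) = 0.
Proof.
move=> skX skY sX sY; have := mxtrace_endo_star skX skY.
by rewrite sX sY endoN mulmxN linearN /= => h; lra.
Qed.

(** The endomorphism C = A P is skew for g and commutes with P and Q, hence
    so do its two components of given duality type. The self-dual one commutes with
    P and also anticommutes with it up to a scalar, so it is a multiple of P;
    likewise the other one is a multiple of Q. The coefficients follow by taking
    traces, as P Q is traceless and has square 1. *)
Lemma commuting_sym P Q A : P^T = - P -> Q^T = - Q ->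
  star P = P -> star Q = - Q ->
  endo P *m endo P = - 1%:M -> endo Q *m endo Q = - 1%:M ->
  (g *m A)^T = g *m A -> A *m endo P = endo P *m A -> A *m endo Q = endo Q *m A ->
  A = (4^-1 * \tr A) *: 1%:M + (4^-1 * \tr (A *m - (endo P *m endo Q))) *: - (endo P *m endo Q).
Proof.
move=> skP skQ sP sQ P2 Q2 symA AP AQ.
pose C := A *m endo P; pose X := (g *m C)^T.
have skC : (g *m C)^T = - (g *m C).
  rewrite /C mulmxA trmx_mul symA mulmxA.
  have -> : (endo P)^T *m g = - (g *m endo P) by rewrite endoK endoT skP opprK.
  by rewrite mulNmx -!mulmxA AP.
have [eX skX] := form_endo skC; rewrite -/X in eX skX.
have PQ := sd_asd_comm skP skQ sP sQ.
have CP : C *m endo P = endo P *m C by rewrite /C [RHS]mulmxA -AP.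
have CQ : C *m endo Q = endo Q *m C by rewrite /C -mulmxA PQ !mulmxA AQ.
pose Xp := 2^-1 *: (X + star X); pose Xm := 2^-1 *: (X - star X).
have skXp : Xp^T = - Xp by rewrite linearZ linearD /= skX star_skew -scalerN opprD.
have skXm : Xm^T = - Xm by rewrite linearZ linearB /= skX star_skew -scalerN opprB opprK addrC.
have sXp : star Xp = Xp by rewrite starZ starD starK // addrC.
have sXm : star Xm = - Xm by rewrite starZ starD starN starK // -scalerN opprB addrC.
have XD : X = Xp + Xm.
  by apply/matrixP => i j; rewrite !mxE; field.
have CD : C = endo Xp + endo Xm by rewrite -endoD -XD.
have XmP : endo Xm *m endo P = endo P *m endo Xm by rewrite (sd_asd_comm skP skXm).
have XpQ : endo Xp *m endo Q = endo Q *m endo Xp by rewrite (sd_asd_comm skXp skQ).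
have XpP : endo Xp *m endo P = endo P *m endo Xp.
  by move: CP; rewrite CD mulmxDl mulmxDr XmP => /addIr.
have XmQ : endo Xm *m endo Q = endo Q *m endo Xm.
  by move: CQ; rewrite CD mulmxDl mulmxDr XpQ => /addrI.
have [c1 E1] : exists c, endo Xp *m endo P = c%:M.
  have [|||c] := @anticomm 1 _ _ _ skXp skP; rewrite ?mulr1 ?scale1r //.
  by rewrite XpP => /half_scalar E; exists (c / 2).
have [c2 E2] : exists c, endo Xm *m endo Q = c%:M.
  have [|||c] := @anticomm (-1) _ _ _ skXm skQ; rewrite ?mulrNN ?mulr1 ?scaleN1r //.
  by rewrite XmQ => /half_scalar E; exists (c / 2).
pose tau := - (endo P *m endo Q).
have AE : A = - c1 *: 1%:M + - c2 *: tau.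
  have -> : A = - (C *m endo P) by rewrite /C -mulmxA P2 mulmxN mulmx1 opprK.
  rewrite CD mulmxDl E1 opprD; congr (_ + _); first by rewrite scaleNr scalemx1.
  have -> : endo Xm = - (c2 *: endo Q).
    by rewrite -mul_scalar_mx -E2 -mulmxA Q2 mulmxN mulmx1 opprK.
  by rewrite /tau PQ mulNmx -scalemxAl scalerN scaleNr opprK.
have tr_tau : \tr tau = 0 by rewrite /tau linearN /= sd_asd_trace ?oppr0.
have tau2 : tau *m tau = 1%:M.
  rewrite /tau mulNmx mulmxN opprK {2}PQ -mulmxA [endo Q *m (_ *m _)]mulmxA Q2.
  by rewrite mulNmx mul1mx mulmxN P2 opprK.
have trA : \tr A = 4 * - c1.
  by rewrite AE linearD !linearZ /= tr_tau mxtrace1; ring.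
have trAt : \tr (A *m tau) = 4 * - c2.
  by rewrite AE mulmxDl -!scalemxAl mul1mx tau2 linearD !linearZ /= tr_tau mxtrace1; ring.
by rewrite -/tau trA trAt !mulKf ?pnatr_eq0.
Qed.

(** The product rule for the Hodge star when g has derivative A^T g + g A and P
    has derivative A^T P + P A + N, and the volume factor the derivative - tr A
    times itself. *)
Lemma star_deriv A P N : P^T = - P -> N^T = - N ->
  (- s * \tr A) *: (g *m dual P *m g)
  + s *: ((A^T *m g + g *m A) *m dual P *m g
          + g *m dual (A^T *m P + P *m A + N) *m g
          + g *m dual P *m (A^T *m g + g *m A))
  = A^T *m star P + star P *m A + star N.
Proof.
move=> skP skN; rewrite dualD dual_deriv // !hstarE; move: s => r.
rewrite !(mulmxDl, mulmxDr, mulmxN, mulNmx) -?scalemxAr -?scalemxAl.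
mxlin.
Qed.

(** Infinitesimal isometries commute with the Hodge star. *)
Lemma star_rot A P : P^T = - P -> A^T *m g + g *m A = 0 ->
  A^T *m star P + star P *m A = star (A^T *m P + P *m A).
Proof.
move=> skP gA; have trA : \tr A = 0.
  have E : A^T *m g = - (g *m A) by apply/eqP; rewrite -addr_eq0 gA.
  have : \tr (A^T *m g *m invmx g) = \tr A by rewrite mulmxK ?metric_unit // mxtrace_tr.
  rewrite E mulNmx linearN /= mxtrace_mulC mulmxA mulVmx ?metric_unit // mul1mx => h; lra.
have star0 : star 0 = 0 by have := starZ 0 0; rewrite !scale0r.
have sk0 : (0 : 'M[R]_4)^T = - 0 by rewrite trmx0 oppr0.
have := star_deriv A skP sk0.
by rewrite gA star0 !(mul0mx, mulmx0, addr0, add0r) trA mulr0 scale0r add0r => <-; rewrite hstarE.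
Qed.

Lemma hodge_star P : P^T = - P ->
  \matrix_(i, j) (2^-1 * Num.sqrt (\det g) *
    \sum_(t : 'S_4 | (t 0 == i) && (t 1 == j))
      (-1) ^+ t * (invmx g *m P *m (invmx g)^T) (t (inord 2)) (t (inord 3))) = star P.
Proof.
move=> skP; set X := invmx g *m P *m _.
have skX : X^T = - X by rewrite /X !trmx_mul trmxK skP mulNmx mulmxN mulmxA.
have PE : P = g *m X *m g^T.
  by rewrite /X metric_inv_sym g_sym mulmxA mulKVmx ?mulmxKV ?metric_unit.
have := @dual_congr _ g X skX; rewrite -PE g_sym => E.
apply/matrixP => i j; rewrite mxE hstarE mulrAC dual_perm // E scalerA [RHS]mxE mulrC.
congr (_ * _); rewrite -[X in _ * X]sqr_sqrtr ?ltW // expr2 mulKf //.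
by rewrite gt_eqF // sqrtr_gt0.
Qed.

End Fixed.
End Star.

(** * Functions of class C^k *)

Section Smooth.
Variables (R : realType) (V : normedModType R) (U : set V).
Hypothesis oU : open U.

Lemma near_open (P : V -> Prop) x : U x -> (forall y, U y -> P y) -> \forall y \near x, P y.
Proof. by move=> Ux UP; apply: filterS (open_nbhs_nbhs (conj oU Ux)). Qed.

Lemma CkS (W : normedModType R) k (f : V -> W) : Ck k.+1 U f -> Ck k U f.
Proof.
elim: k f => [|k IH] f [cf df]; split => // v.
by have [dfv /IH cfv] := df v; split.
Qed.

(** Being C^k is local, so it only depends on the values on the open set U. *)
Lemma Ck_ext (W : normedModType R) k (f g : V -> W) :
  (forall x, U x -> f x = g x) -> Ck k U f -> Ck k U g.
Proof.
elim: k f g => [|k IH] f g fg [cf df].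
  split=> // x Ux; change (g @ x --> g x); rewrite -(fg x Ux).
  apply: (cvg_trans _ (cf x Ux)); apply: near_eq_cvg.
  exact: (near_open Ux (fun y Uy => fg y Uy)).
split=> [x Ux|v].
  change (g @ x --> g x); rewrite -(fg x Ux).
  apply: (cvg_trans _ (cf x Ux)); apply: near_eq_cvg.
  exact: (near_open Ux (fun y Uy => fg y Uy)).
have [dfv Cfv] := df v; split=> [x Ux|].
  by apply: (near_eq_derivable _ (dfv x Ux)); exact: (near_open Ux).
by apply: IH Cfv => x Ux; apply: near_eq_derive; exact: (near_open Ux).
Qed.

Lemma Ck_cst (W : normedModType R) k (a : W) : Ck k U (fun _ => a).
Proof.
elim: k a => [|k IH] a; split=> //; try by move=> x _; exact: cst_continuous.
move=> v; split=> [x _|]; first exact: derivable_cst.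
by apply: Ck_ext (IH 0) => x _; rewrite derive_cst.
Qed.

Lemma CkD (W : normedModType R) k (f g : V -> W) :
  Ck k U f -> Ck k U g -> Ck k U (fun x => f x + g x).
Proof.
elim: k f g => [|k IH] f g [cf df] [cg dg]; split => //;
  try by move=> x Ux; apply: continuousD; [exact: cf | exact: cg].
move=> v; have [dfv Cf] := df v; have [dgv Cg] := dg v; split=> [x Ux|].
  by apply: derivableD; [exact: dfv | exact: dgv].
by apply: Ck_ext (IH _ _ Cf Cg) => x Ux; rewrite -deriveD //; [exact: dfv | exact: dgv].
Qed.

Lemma CkM k (f g : V -> R) :
  Ck k U f -> Ck k U g -> Ck k U (fun x => f x * g x).
Proof.
elim: k f g => [|k IH] f g Cf Cg; have [cf df] := Cf; have [cg dg] := Cg; split => //;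
  try by move=> x Ux; apply: continuousM; [exact: cf | exact: cg].
move=> v; have [dfv Cfv] := df v; have [dgv Cgv] := dg v; split=> [x Ux|].
  by apply: derivableM; [exact: dfv | exact: dgv].
apply: Ck_ext (CkD (IH _ _ (CkS Cf) Cgv) (IH _ _ (CkS Cg) Cfv)) => x Ux.
by rewrite -[RHS]/('D_v (f * g) x) deriveM //; [exact: dfv | exact: dgv].
Qed.

Lemma CkV k (f : V -> R) : (forall x, U x -> f x != 0) ->
  Ck k U f -> Ck k U (fun x => (f x)^-1).
Proof.
move=> f0; elim: k f f0 => [|k IH] f f0 Cf; have [cf df] := Cf; split => //;
  try by move=> x Ux; apply: continuousV; [exact: f0 | exact: cf].
move=> v; have [dfv Cfv] := df v; split=> [x Ux|].
  by apply: derivableV; [exact: f0 | exact: dfv].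
have CV := IH _ f0 (CkS Cf).
apply: Ck_ext (CkM (CkM (CkM (@Ck_cst R^o k (-1)) CV) CV) Cfv) => x Ux.
rewrite deriveV; [|exact: f0|exact: dfv].
by rewrite mulN1r mulNr -invfM -expr2 [RHS]/(_ * _).
Qed.

Lemma continuous_sqrt_at (f : V -> R) x :
  {for x, continuous f} -> {for x, continuous (fun x => Num.sqrt (f x))}.
Proof.
move=> cf; apply: (@continuous_comp _ _ _ f (@Num.sqrt R) x cf).
exact: sqrt_continuous.
Qed.

Lemma is_derive_slice (W : normedModType R) (f : V -> W) x v df :
  is_derive x v f df <-> is_derive (0 : R) (1 : R) (fun h : R => f (h *: v + x)) df.
Proof.
have E : 'D_v f x = 'D_1 (fun h : R => f (h *: v + x)) (0 : R).
  rewrite /derive; set g1 := fun h => h^-1 *: _; set g2 := fun h => h^-1 *: _.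
  suff -> : g1 = g2 by [].
  by rewrite funeqE /g1 /g2 => h /=; rewrite addr0 scale0r add0r [_%:A]mulr1.
split=> -[d dE].
  exact: (DeriveDef ((derivable1P f x v).1 d) (etrans (esym E) dE)).
exact: (DeriveDef ((derivable1P f x v).2 d) (etrans E dE)).
Qed.

Lemma is_derive_sqrt (f : V -> R) x v : 0 < f x -> derivable f x v ->
  is_derive x v (fun x => Num.sqrt (f x)) ((2 * Num.sqrt (f x))^-1 * 'D_v f x).
Proof.
move=> fx df; have dfx : is_derive x v f ('D_v f x) by exact: DeriveDef.
have fE : f (0 *: v + x) = f x by rewrite scale0r add0r.
have ds : is_derive (f (0 *: v + x)) (1 : R) (@Num.sqrt R) (2 * Num.sqrt (f x))^-1.
  by rewrite fE; exact: is_derive1_sqrt.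
apply: (is_derive_slice (fun y => Num.sqrt (f y)) x v _).2.
exact: (is_derive1_comp ds ((is_derive_slice f x v _).1 dfx)).
Qed.

Lemma Ck_sqrt k (f : V -> R) : (forall x, U x -> 0 < f x) ->
  Ck k U f -> Ck k U (fun x => Num.sqrt (f x)).
Proof.
move=> f0; elim: k f f0 => [|k IH] f f0 Cf; have [cf df] := Cf; split => //;
  try by move=> x Ux; apply: continuous_sqrt_at; exact: cf.
move=> v; have [dfv Cfv] := df v; split=> [x Ux|].
  by have [] := is_derive_sqrt (f0 x Ux) (dfv x Ux).
have CV := IH _ f0 (CkS Cf).
have s0 x : U x -> 2 * Num.sqrt (f x) != 0.
  by move=> Ux; rewrite mulf_neq0 // gt_eqF // sqrtr_gt0 f0.
apply: Ck_ext (CkM (CkV s0 (CkM (@Ck_cst R^o k 2) CV)) Cfv) => x Ux.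
by have [_ ->] := is_derive_sqrt (f0 x Ux) (dfv x Ux).
Qed.

Lemma continuous_mxP m n (F : V -> 'M[R]_(m, n)) x :
  {for x, continuous F} <-> forall i j, {for x, continuous (fun y => F y i j)}.
Proof.
split=> [cF i j|cF].
  by apply: (@continuous_comp _ _ _ F (fun A : 'M[R]_(m, n) => A i j) x cF); exact:
    coord_continuous.
apply/cvgrPdist_le => /= e e0; near=> y.
rewrite /Num.Def.normr/= mx_normrE (bigmax_le _ (ltW e0))//= => i _.
rewrite !mxE/=.
move: i; near: y; apply: filter_forall => /= i.
exact: ((cvgrPdist_le _ _).1 (cF i.1 i.2)).
Unshelve. all: by end_near. Qed.

Lemma Ck_mxP m n k (F : V -> 'M[R]_(m, n)) :
  Ck k U F <-> forall i j, Ck k U (fun y => F y i j).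
Proof.
elim: k F => [|k IH] F.
  split=> [[cF _] i j|cF]; split=> // x Ux.
    by have /continuous_mxP := cF _ Ux; apply.
  by apply/continuous_mxP => i j; have [cFi _] := cF i j; exact: cFi.
split=> [[cF dF] i j|cF].
  split=> [x Ux|v]; first by have /continuous_mxP := cF _ Ux; apply.
  have [dFv CFv] := dF v; split=> [x Ux|]; first by have /derivable_mxP := dFv _ Ux; apply.
  move/IH: CFv => /(_ i j); apply: Ck_ext => x Ux.
  by rewrite derive_mx ?mxE //; exact: dFv.
have dFv v x : U x -> derivable F x v.
  by move=> Ux; apply/derivable_mxP => i j; have [_ /(_ v) [h _]] := cF i j; exact: h.
split=> [x Ux|v]; first by apply/continuous_mxP => i j; have [cFi _] := cF i j; exact: cFi.
split=> [x Ux|]; first exact: dFv.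
apply/IH => i j; have [_ /(_ v) [_ h]] := cF i j.
by apply: Ck_ext h => x Ux; rewrite derive_mx ?mxE //; exact: dFv.
Qed.

End Smooth.

(** * Mean values and symmetry of second derivatives *)

Section Line.
Variables (R : realType) (V : normedModType R).

Lemma is_derive_line (W : normedModType R) (f : V -> W) y v (t : R) : derivable f (y + t *: v) v ->
  is_derive t 1 (fun t : R => f (y + t *: v)) ('D_v f (y + t *: v)).
Proof.
move=> df.
have E : (fun h : R => h^-1 *: (((fun t : R => f (y + t *: v)) \o shift t) (h *:
  1) - f (y + t *: v)))
   = (fun h => h^-1 *: ((f \o shift (y + t *: v)) (h *: v) - f (y + t *: v))).
  apply/funext => h /=; congr (_ *: (f _ - _)).
  by rewrite [h *: 1]mulr1 scalerDl addrCA.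
by apply: DeriveDef; rewrite /derivable /derive E.
Qed.

Lemma mvt_line_pos (f : V -> R) y v (s : R) : 0 < s ->
  (forall t, 0 <= t <= s -> derivable f (y + t *: v) v) ->
  exists2 c, 0 < c < s & f (y + s *: v) - f y = s * 'D_v f (y + c *: v).
Proof.
move=> s0 df.
have [||c] := @MVT R (fun t : R => f (y + t *: v)) (fun t => 'D_v f (y + t *: v)) 0 s s0.
- move=> t; rewrite in_itv /= => /andP[t0 ts]; apply: is_derive_line; apply: df.
  by rewrite !ltW.
- apply: derivable_within_continuous => t; rewrite in_itv /= => ht.
  by have [] := is_derive_line (df t ht).
rewrite in_itv /= scale0r addr0 subr0 => hc ->.
by exists c => //; rewrite mulrC.
Qed.

Lemma mvt_line (f : V -> R) y v (s : R) :
  (forall t, `|t| <= `|s| -> derivable f (y + t *: v) v) ->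
  exists2 c, `|c| <= `|s| & f (y + s *: v) - f y = s * 'D_v f (y + c *: v).
Proof.
move=> df; have [s0|s0|->] := ltrgtP s 0; last first.
- by exists 0; rewrite ?normr0 // scale0r addr0 subrr mul0r.
- have [|c /andP[c0 cs] E] := @mvt_line_pos f y v s s0.
    move=> t /andP[t0 ts]; apply: df.
    by rewrite (ger0_norm t0) gtr0_norm.
  by exists c => //; rewrite !gtr0_norm // ltW.
have s0' : 0 < - s by rewrite oppr_gt0.
have [|c /andP[c0 cs]] := @mvt_line_pos f (y + s *: v) v (- s) s0'.
  move=> t /andP[t0 ts]; rewrite -addrA -scalerDl; apply: df.
  have st : s + t <= 0 by lra.
  by rewrite (ler0_norm st) (ltr0_norm s0); lra.
rewrite -!addrA -!scalerDl subrr scale0r addr0 => E.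
have sc : s + c <= 0 by lra.
exists (s + c); first by rewrite (ler0_norm sc) (ltr0_norm s0); lra.
by lra.
Qed.

(** Symmetry of second derivatives needs parallelograms inside a neighbourhood. *)
Lemma near_box (P : V -> Prop) x v w : (\forall y \near x, P y) ->
  exists2 r : R, 0 < r & forall a b, `|a| <= r -> `|b| <= r -> P (x + a *: v + b *: w).
Proof.
move=> /nbhs_ballP[e /= e0 Pe]; have d0 : 0 < `|v| + `|w| + 1.
  by rewrite ltr_wpDl // addr_ge0.
exists (e / (`|v| + `|w| + 1) / 2); first by rewrite !divr_gt0.
move=> a b ha hb; apply: Pe; rewrite -ball_normE /= opprD opprD addrA addrA subrr add0r -opprD
  normrN.
apply: le_lt_trans (ler_normD _ _) _; rewrite !normrZ.
have e2 : 0 < e / (`|v| + `|w| + 1) / 2 by rewrite !divr_gt0.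
apply: (@le_lt_trans _ _ (e / (`|v| + `|w| + 1) / 2 * (`|v| + `|w|))).
  by rewrite mulrDr lerD // ler_wpM2r.
have -> : e / (`|v| + `|w| + 1) / 2 * (`|v| + `|w|) = e / 2 * ((`|v| + `|w|) / (`|v| + `|w| + 1)).
  by field; rewrite gt_eqF.
have : (`|v| + `|w|) / (`|v| + `|w| + 1) <= 1.
  by rewrite ler_pdivrMr // mul1r lerDl.
move=> h; apply: (@le_lt_trans _ _ (e / 2 * 1)); last by lra.
by rewrite ler_wpM2l // divr_ge0 // ltW.
Qed.

(** The mean value theorem applied in the direction v to the increment in the
    direction w, then in the direction w to the derivative along v. *)
Lemma second_diff (U : set V) (f : V -> R) x v w s : 0 < s ->
  Ck 2 U f -> (forall a b, `|a| <= s -> `|b| <= s -> U (x + a *: v + b *: w)) ->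
  exists a b, [/\ `|a| <= s, `|b| <= s &
    f (x + s *: v + s *: w) - f (x + s *: v) - f (x + s *: w) + f x =
    s * s * 'D_w ('D_v f) (x + a *: v + b *: w)].
Proof.
move=> s0 [_ Cf] box; have [dv [_ /(_ w)[dwv _]]] := Cf v.
have n0 : `|0 : R| <= s by rewrite normr0 ltW.
have ns : `|s| <= s by rewrite gtr0_norm.
pose g y := f (y + s *: w) - f y.
have dg t : 0 <= t <= s -> is_derive (x + t *: v) v g ('D_v f (x + t *: v + s *:
  w) - 'D_v f (x + t *: v)).
  move=> /andP[t0 ts]; have nt : `|t| <= s by rewrite ger0_norm.
  have d1 : derivable f (x + t *: v + s *: w) v by apply: dv; apply: box.
  have d2 : derivable f (x + t *: v) v.
    by apply: dv; have := box t 0 nt n0; rewrite scale0r addr0.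
  apply: is_deriveB; last exact: derivableP.
  have E : (fun h : R => h^-1 *: (((fun y => f (y + s *: w)) \o shift (x + t *: v)) (h *:
    v) - f (x + t *: v + s *: w)))
     = (fun h => h^-1 *: ((f \o shift (x + t *: v + s *: w)) (h *: v) - f (x + t *: v + s *: w))).
    by apply/funext => h /=; rewrite !addrA.
  by apply: DeriveDef; rewrite /derivable /derive E.
have [t ht|a /andP[a0 as_]] := @mvt_line_pos g x v s s0.
  by have [] := dg t ht.
have na : `|a| <= s by rewrite gtr0_norm // ltW.
have [|_ ->] := dg a; first by rewrite !ltW.
have [t /andP[t0 ts]|b /andP[b0 bs] ->] := @mvt_line_pos ('D_v f) (x + a *: v) w s s0.
  by apply: dwv; apply: box => //; rewrite ger0_norm.
rewrite /g => E; exists a, b; split => //; first by rewrite gtr0_norm // ltW.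
by rewrite -mulrA -E; ring.
Qed.

Lemma near_dist (e p q z : R) : `|p - z| <= e / 2 -> `|q - z| <= e / 2 -> `|p - q| <= e.
Proof.
move=> hp hq; have -> : p - q = (p - z) - (q - z) by ring.
by apply: (le_trans (ler_normB _ _)); lra.
Qed.

(** The second difference over a small parallelogram is a value of both mixed
    derivatives, at two points that tend to x. *)
Lemma schwarz (U : set V) (f : V -> R) x v w : open U -> Ck 2 U f -> U x ->
  'D_v ('D_w f) x = 'D_w ('D_v f) x.
Proof.
move=> oU Cf Ux; apply/eqP; rewrite -subr_eq0 -normr_le0; apply/ler_addgt0Pr => e e0.
rewrite add0r.
have [_ Df] := Cf.
have cvw : {for x, continuous ('D_v ('D_w f))}.
  by have [_ [_ /(_ v)[_ [h _]]]] := Df w; exact: h.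
have cwv : {for x, continuous ('D_w ('D_v f))}.
  by have [_ [_ /(_ w)[_ [h _]]]] := Df v; exact: h.
have e2 : 0 < e / 2 by rewrite divr_gt0.
have N1 : \forall y \near x, U y /\ `|'D_v ('D_w f) x - 'D_v ('D_w f) y| <= e / 2.
  by apply: filterI; [exact: open_nbhs_nbhs | exact: ((cvgrPdist_le _ _).1 cvw)].
have N2 : \forall y \near x, U y /\ `|'D_w ('D_v f) x - 'D_w ('D_v f) y| <= e / 2.
  by apply: filterI; [exact: open_nbhs_nbhs | exact: ((cvgrPdist_le _ _).1 cwv)].
have [r1 r10 B1] := near_box w v N1; have [r2 r20 B2] := near_box v w N2.
(* The side of a parallelogram good for both orders of differentiation. *)
pose s := Num.min r1 r2.
have s0 : 0 < s by rewrite lt_min r10.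
have s1 (a : R) : `|a| <= s -> `|a| <= r1 by rewrite le_min => /andP[].
have s2 (a : R) : `|a| <= s -> `|a| <= r2 by rewrite le_min => /andP[].
have [a [b [ha hb E]]] := second_diff s0 Cf (fun a b ha hb => (B2 a b (s2 _ ha) (s2 _ hb)).1).
have [c [d [hc hd E']]] := second_diff s0 Cf (fun a b ha hb => (B1 a b (s1 _ ha) (s1 _ hb)).1).
have [_ h2] := B2 a b (s2 _ ha) (s2 _ hb); have [_ h1] := B1 c d (s1 _ hc) (s1 _ hd).
have EE : 'D_w ('D_v f) (x + a *: v + b *: w) = 'D_v ('D_w f) (x + c *: w + d *: v).
  apply: (@mulfI _ (s * s)); first by rewrite mulf_neq0 // gt_eqF.
  have cm : f (x + s *: w + s *: v) = f (x + s *: v + s *: w) by congr f; rewrite addrAC.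
  have sw (A A' B C D : R) : A' = A -> A - B - C + D = A' - C - B + D by move=> ->; ring.
  exact: etrans (esym E) (etrans (sw _ _ _ _ _ cm) E').
by apply: near_dist h1 _; rewrite -EE; exact: h2.
Qed.

End Line.

Lemma const_of_deriv0 (R : realType) (f : R -> R) (a b s t : R) :
  (forall u, a < u < b -> is_derive u 1 f 0) -> a < s < b -> a < t < b -> f s = f t.
Proof.
move=> df; wlog st : s t / s <= t.
  by move=> H hs ht; have [st|/ltW st] := leP s t; [exact: H | symmetry; exact: H].
move=> /andP[s1 s2] /andP[t1 t2].
have [||c _ E] := @MVT_segment R f (fun _ => 0) s t st.
- by move=> u; rewrite in_itv /= => /andP[us ut]; apply: df;
  rewrite (lt_trans s1 us) (lt_trans ut t2).
- apply: derivable_within_continuous => u; rewrite in_itv /= => /andP[us ut].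
  by have [] // := df u _; rewrite (lt_le_trans s1 us) (le_lt_trans ut t2).
by move: E; rewrite mul0r => /eqP; rewrite subr_eq0 => /eqP.
Qed.

(** * Chain rule for functions with continuous partial derivatives *)

Section Frechet.
Variables (R : realType) (n : nat).
Implicit Types (f : 'cV[R]_n -> R) (x u : 'cV[R]_n).

Lemma mx_entry_le m p (A : 'M[R]_(m, p)) i j : `|A i j| <= `|A|.
Proof.
rewrite [leRHS]/Num.Def.normr /= mx_normrE.
exact: (le_bigmax _ (fun i => `|A i.1 i.2|) (i, j)).
Qed.

(** A path from 0 to u along the coordinate axes, the k-th stop being trunc k u. *)
Definition trunc k u : 'cV[R]_n := \col_m (if (m < k)%N then u m 0 else 0).

Lemma truncS k u (lt_kn : (k < n)%N) :
  trunc k.+1 u = trunc k u + u (Ordinal lt_kn) 0 *: delta_mx (Ordinal lt_kn) 0.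
Proof.
apply/matrixP => i j; rewrite !mxE ord1 eqxx andbT ltnS leq_eqVlt.
have [E|ne] := eqVneq i (Ordinal lt_kn).
  by rewrite E /= eqxx ltnn mulr1 add0r.
have -> : (i == k :> nat) = false by apply/negbTE; apply: contra ne => /eqP E; apply/eqP/val_inj.
by rewrite /= mulr0 addr0.
Qed.

Lemma trunc_ball k u (lt_kn : (k < n)%N) (t : R) : `|t| <= `|u (Ordinal lt_kn) 0| ->
  `|trunc k u + t *: delta_mx (Ordinal lt_kn) 0| <= `|u|.
Proof.
move=> ht; have hu m : `|u m 0| <= `|u| by exact: mx_entry_le.
have := normr_ge0 u; move: (`|u|) hu => r hu r0.
rewrite [leLHS]/Num.Def.normr /= mx_normrE bigmax_le // => -[i j] _ /=.
rewrite !mxE ord1 eqxx andbT; have [->|ne] := eqVneq i (Ordinal lt_kn).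
  by rewrite /= ltnn add0r mulr1; exact: le_trans ht (hu _).
by rewrite /= mulr0 addr0; case: ifP => _; rewrite ?normr0 //.
Qed.

Definition lin_part f x u : R := \sum_(m < n) u m 0 * 'D_(delta_mx m 0) f x.

Lemma scale_dist (e a c d : R) : `|c - d| <= e -> `|a * c - a * d| <= e * `|a|.
Proof. by move=> h; rewrite -mulrBr normrM mulrC ler_wpM2r. Qed.

Lemma step_dist (a b c l s e k u : R) : `|b - a - l| <= k * (e * u) ->
  `|(c - b) - s| <= e * u -> `|c - a - (l + s)| <= (k + 1) * (e * u).
Proof.
move=> h1 h2; have -> : c - a - (l + s) = (b - a - l) + (c - b - s) by ring.
by apply: (le_trans (ler_normD _ _)); rewrite mulrDl mul1r lerD.
Qed.

(** Going from x to x + u along the axes, each step is estimated by the mean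
    value theorem. *)
Lemma increment_bound f x u e : 0 <= e ->
  (forall y m, `|y - x| <= `|u| -> derivable f y (delta_mx m 0) /\
     `|'D_(delta_mx m 0) f y - 'D_(delta_mx m 0) f x| <= e) ->
  `|f (x + u) - f x - lin_part f x u| <= n%:R * (e * `|u|).
Proof.
move=> e0 H.
have main k : (k <= n)%N -> `|f (x + trunc k u) - f x -
   \sum_(m < n | (m < k)%N) u m 0 * 'D_(delta_mx m 0) f x| <= k%:R * (e * `|u|).
  elim: k => [_|k IH lt_kn].
    rewrite big_pred0 // (_ : trunc 0 u = 0) ?addr0 ?subrr ?subr0 ?normr0 ?mul0r //.
    by apply/matrixP => i j; rewrite !mxE.
  pose ik := Ordinal lt_kn.
  rewrite (bigD1 ik) //= (eq_bigl (fun m : 'I_n => (m < k)%N)); last first.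
    by move=> m; rewrite ltnS ltn_neqAle andbC -val_eqE.
  rewrite addrC truncS addrA [X in _ - X]addrC -natr1.
  have D t : `|t| <= `|u ik 0| -> derivable f (x + trunc k u + t *:
    delta_mx ik 0) (delta_mx ik 0) /\
     `|'D_(delta_mx ik 0) f (x + trunc k u + t *: delta_mx ik 0) - 'D_(delta_mx ik 0) f x| <= e.
    by move=> ht; apply: H; rewrite addrC !addrA addNr add0r trunc_ball.
  rewrite [_ *: _ + _]addrC.
  apply: (step_dist (IH (ltnW lt_kn))).
  have [t ht|c hc ->] := @mvt_line R _ f (x + trunc k u) (delta_mx ik 0) (u ik 0).
    by have [] := D t ht.
  apply: (le_trans (scale_dist _ (D c hc).2)).
  by rewrite ler_wpM2l // mx_entry_le.
have := main n (leqnn n); rewrite (_ : trunc n u = u); last first.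
  by apply/matrixP => i j; rewrite !mxE ltn_ord ord1.
by rewrite (eq_bigl xpredT) // => m; rewrite ltn_ord.
Qed.

Lemma lin_part_linear f x : linear (lin_part f x : 'cV[R]_n -> R^o).
Proof.
move=> a u v; rewrite /lin_part scaler_sumr -big_split; apply: eq_bigr => m _ /=.
by rewrite !mxE mulrDl [a *: _]mulrA.
Qed.

(** Continuous partial derivatives give Frechet differentiability, which the
    chain rule needs and which directional derivatives alone do not provide. *)
Lemma C1_differentiable (U : set 'cV[R]_n) f x : open U -> Ck 1 U f -> U x ->
  differentiable f x /\ forall u, 'd f x u = lin_part f x u.
Proof.
move=> oU [_ Cf] Ux.
pose lM := GRing.isLinear.Build _ _ _ _ _ (@lin_part_linear f x).
pose L : {linear 'cV[R]_n -> R^o} := HB.pack (lin_part f x) lM.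
have cL : continuous L.
  have E : (L : 'cV[R]_n -> R^o) = \sum_(m < n) (fun u : 'cV[R]_n => u m 0 * 'D_(delta_mx m 0) f x).
    by apply/funext => u; rewrite fct_sumE.
  rewrite E => u; elim/big_ind: _ => [|a b ca cb|m _]; first exact: cst_continuous.
    exact: continuousD.
  have h := @coord_continuous R n 1 m 0 u.
  exact: (cvgMr_tmp h).
have ex : (f : 'cV[R]_n -> R^o) \o shift x = cst (f x : R^o) + (L : 'cV[R]_n -> R^o) +o_ (0 :
  'cV[R]_n) id.
  apply/eqaddoP => _/posnumP[e]; pose e' := e%:num / (n%:R + 1).
  have n1 : 0 < n%:R + 1 :> R by rewrite ltr_wpDl.
  have e0 : 0 < e' by rewrite divr_gt0.
  have N : \forall y \near x, forall m, derivable f y (delta_mx m 0) /\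
     `|'D_(delta_mx m 0) f y - 'D_(delta_mx m 0) f x| <= e'.
    apply: (@filter_forall _ 'I_n (fun m (y : 'cV[R]_n) => derivable f y (delta_mx m 0) /\
       `|'D_(delta_mx m 0) f y - 'D_(delta_mx m 0) f x| <= e') (nbhs x)) => m.
    have [dm [cm _]] := Cf (delta_mx m 0).
    have N1 : \forall y \near x, `|'D_(delta_mx m 0) f x - 'D_(delta_mx m 0) f y| <= e'.
      exact: ((cvgrPdist_le _ _).1 (cm x Ux)).
    have N2 : \forall y \near x, U y by apply: open_nbhs_nbhs.
    by apply: filterS2 N1 N2 => y h Uy; split; [exact: dm|rewrite distrC].
  have /nbhs_ballP[d /= d0 Hd] := N.
  apply/nbhs_ballP; exists d => //= u; rewrite -ball_normE /= sub0r normrN => hu.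
  have H : `|f (x + u) - f x - lin_part f x u| <= n%:R * (e' * `|u|).
    apply: increment_bound; first exact: ltW.
    move=> y m hy; apply: Hd; rewrite -ball_normE /= distrC.
    exact: le_lt_trans hy hu.
  rewrite /= -![(_ + _ : _ -> _) _]/(_ + _) -![(- _ : _ -> _) _]/(- _) /= [u + x]addrC.
  have ne : n%:R * e' <= e%:num.
    by rewrite /e' mulrA ler_pdivrMr // mulrC ler_wpM2l // lerDl.
  rewrite opprD addrA; apply: (le_trans H).
  by rewrite mulrA; apply: ler_wpM2r.
have dfE := diff_unique cL ex.
split; last by move=> u; rewrite dfE.
by apply/diff_locallyP; rewrite dfE.
Qed.

Lemma chain_rule (V : normedModType R) (U : set 'cV[R]_n) f (phi : V -> 'cV[R]_n) (x v : V) :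
  open U -> Ck 1 U f -> U (phi x) -> derivable phi x v ->
  is_derive x v (fun y => f (phi y))
    (\sum_(m < n) ('D_v phi x) m 0 * 'D_(delta_mx m 0) f (phi x)).
Proof.
move=> oU Cf Up dphi; have [df dfE] := C1_differentiable oU Cf Up.
pose g (t : R) := phi (t *: v + x).
have g0 : g 0 = phi x by rewrite /g scale0r add0r.
have dg : differentiable g 0 by apply/derivable1_diffP; exact: (derivable1P phi x v).1.
have dfg : differentiable f (g 0) by rewrite g0.
have dc := differentiable_comp dg dfg.
have [_ dphiE] := (is_derive_slice phi x v _).1 (derivableP dphi).
have dgE : 'd g 0 1 = 'D_v phi x by rewrite -deriveE.
apply: (is_derive_slice (fun y => f (phi y)) x v _).2; apply: DeriveDef;
  first exact/derivable1_diffP.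
rewrite deriveE // (diff_comp dg dfg) /= g0 dfE /lin_part.
by rewrite dgE.
Qed.

End Frechet.

(** * Smooth functions (prefix sm) and derivatives (prefix isd) of matrices *)

Section SmoothOn.
Variables (R : realType) (V : normedModType R) (U : set V).
Hypothesis oU : open U.

Lemma sm_ext (W : normedModType R) (f g : V -> W) :
  (forall x, U x -> f x = g x) -> smooth_on U f -> smooth_on U g.
Proof. by move=> fg sf k; apply: Ck_ext fg (sf k). Qed.

Lemma sm_cst (W : normedModType R) (a : W) : smooth_on U (fun _ => a).
Proof. by move=> k; exact: Ck_cst. Qed.

Lemma smD (W : normedModType R) (f g : V -> W) :
  smooth_on U f -> smooth_on U g -> smooth_on U (fun x => f x + g x).
Proof. by move=> sf sg k; apply: CkD. Qed.

Lemma smM (f g : V -> R) :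
  smooth_on U f -> smooth_on U g -> smooth_on U (fun x => f x * g x).
Proof. by move=> sf sg k; apply: CkM. Qed.

Lemma smV (f : V -> R) : (forall x, U x -> f x != 0) ->
  smooth_on U f -> smooth_on U (fun x => (f x)^-1).
Proof. by move=> f0 sf k; apply: CkV. Qed.

Lemma sm_sqrt (f : V -> R) : (forall x, U x -> 0 < f x) ->
  smooth_on U f -> smooth_on U (fun x => Num.sqrt (f x)).
Proof. by move=> f0 sf k; apply: Ck_sqrt. Qed.

Lemma sm_mxP m n (F : V -> 'M[R]_(m, n)) :
  smooth_on U F <-> forall i j, smooth_on U (fun y => F y i j).
Proof.
split=> [sF i j k|sF k]; first by have /(Ck_mxP oU) := sF k; apply.
by apply/(Ck_mxP oU) => i j; exact: sF.
Qed.

Lemma sm_entry m n (F : V -> 'M[R]_(m, n)) i j :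
  smooth_on U F -> smooth_on U (fun y => F y i j).
Proof. by move/sm_mxP; apply. Qed.

Lemma sm_derive (W : normedModType R) (f : V -> W) v : smooth_on U f -> smooth_on U ('D_v f).
Proof. by move=> sf k; have [_ /(_ v)[]] := sf k.+1. Qed.

Lemma sm_derivable (W : normedModType R) (f : V -> W) x v : smooth_on U f -> U x -> derivable f x v.
Proof. by move=> sf; have [_ /(_ v)[h _]] := sf 1; exact: h. Qed.

Lemma sm_isd (W : normedModType R) (f : V -> W) x v : smooth_on U f -> U x ->
  is_derive x v f ('D_v f x).
Proof. by move=> sf Ux; apply/derivableP/sm_derivable. Qed.

Lemma sm_cont (W : normedModType R) (f : V -> W) x : smooth_on U f -> U x -> {for x, continuous f}.
Proof. by move=> sf; have [h _] := sf 0; exact: h. Qed.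

Lemma sm_sum (W : normedModType R) I (r : seq I) (P : pred I) (F : I -> V -> W) :
  (forall i, smooth_on U (F i)) -> smooth_on U (fun x => \sum_(i <- r | P i) F i x).
Proof.
move=> sF; elim: r => [|i r IH].
  by apply: sm_ext (@sm_cst W 0) => x _; rewrite big_nil.
case Pi: (P i).
  by apply: sm_ext (smD (sF i) IH) => x _; rewrite big_cons Pi.
by apply: sm_ext IH => x _; rewrite big_cons Pi.
Qed.

Lemma sm_prod I (r : seq I) (P : pred I) (F : I -> V -> R) :
  (forall i, smooth_on U (F i)) -> smooth_on U (fun x => \prod_(i <- r | P i) F i x).
Proof.
move=> sF; elim: r => [|i r IH].
  by apply: sm_ext (@sm_cst R^o 1) => x _; rewrite big_nil.
case Pi: (P i).
  by apply: sm_ext (smM (sF i) IH) => x _; rewrite big_cons Pi.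
by apply: sm_ext IH => x _; rewrite big_cons Pi.
Qed.

Lemma sm_tr m n (F : V -> 'M[R]_(m, n)) : smooth_on U F -> smooth_on U (fun x => (F x)^T).
Proof.
move=> sF; apply/sm_mxP => i j; apply: sm_ext (sm_entry j i sF) => x _; by rewrite mxE.
Qed.

Lemma smZ m n (f : V -> R) (F : V -> 'M[R]_(m, n)) :
  smooth_on U f -> smooth_on U F -> smooth_on U (fun x => f x *: F x).
Proof.
move=> sf sF; apply/sm_mxP => i j; apply: sm_ext (smM sf (sm_entry i j sF)) => x _.
by rewrite mxE.
Qed.

Lemma sm_mulmx m n p (F : V -> 'M[R]_(m, n)) (G : V -> 'M[R]_(n, p)) :
  smooth_on U F -> smooth_on U G -> smooth_on U (fun x => F x *m G x).
Proof.
move=> sF sG; apply/sm_mxP => i j.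
apply: sm_ext (sm_sum (index_enum 'I_n) xpredT (fun k => smM (sm_entry i k sF) (sm_entry k j
  sG))) => x _.
by rewrite mxE.
Qed.

Lemma sm_mxtrace n (F : V -> 'M[R]_n) : smooth_on U F -> smooth_on U (fun x => \tr (F x)).
Proof. by move=> sF; apply: sm_sum => i; exact: sm_entry. Qed.

Lemma sm_det n (F : V -> 'M[R]_n) : smooth_on U F -> smooth_on U (fun x => \det (F x)).
Proof.
move=> sF; apply: sm_sum => s; apply: smM; first exact: (@sm_cst R^o).
by apply: sm_prod => i; exact: sm_entry.
Qed.

Lemma sm_invmx n (F : V -> 'M[R]_n) : (forall x, U x -> F x \in unitmx) ->
  smooth_on U F -> smooth_on U (fun x => invmx (F x)).
Proof.
move=> uF sF; have d0 x : U x -> \det (F x) != 0 by move=> /uF; rewrite unitmxE unitfE.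
have sadj : smooth_on U (fun x => \adj (F x)).
  apply/sm_mxP => i j; rewrite /adjugate /cofactor.
  have h : smooth_on U (fun x => (-1) ^+ (j + i) * \det (row' j (col' i (F x)))).
    apply: smM; first exact: (@sm_cst R^o).
    apply: sm_det; apply/sm_mxP => k l.
    by apply: sm_ext (sm_entry (lift j k) (lift i l) sF) => x _; rewrite !mxE.
  by apply: sm_ext h => x _; rewrite mxE.
apply: sm_ext (smZ (smV d0 (sm_det sF)) sadj) => x Ux.
by rewrite /invmx uF.
Qed.

Lemma sm_dual (F : V -> 'M[R]_4) : smooth_on U F -> smooth_on U (fun x => dual (F x)).
Proof.
move=> sF; have sN i j : smooth_on U (fun x => - F x i j).
  apply: sm_ext (smM (@sm_cst R^o (-1)) (sm_entry i j sF)) => x _; exact: mulN1r.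
have s0 : smooth_on U (fun _ : V => 0 : R) by exact: (@sm_cst R^o).
apply/sm_mxP => i j; elim/ord4_ind: i; elim/ord4_ind: j; rewrite /dual.
all: apply: sm_ext; first by move=> x _; rewrite skew4E.
all: first [exact: s0 | exact: sm_entry | exact: sN].
Qed.

End SmoothOn.

Section MatrixDeriv.
Variables (R : realType) (V : normedModType R).
Implicit Types (x v : V).

Lemma isd_mxP m n (F : V -> 'M[R]_(m, n)) x v dF :
  is_derive x v F dF <-> forall i j, is_derive x v (fun y => F y i j) (dF i j).
Proof.
split=> [[dr <-] i j|h].
  have dij : derivable (fun y => F y i j) x v by move/derivable_mxP: dr; apply.
  by apply: DeriveDef => //; rewrite derive_mx // mxE.
have dr : derivable F x v by apply/derivable_mxP => i j; have [] := h i j.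
apply: DeriveDef => //; rewrite derive_mx //; apply/matrixP => i j; rewrite mxE.
by have [] := h i j.
Qed.

Lemma isd_near (W : normedModType R) (U : set V) (f g : V -> W) x v df : open U -> U x ->
  (forall y, U y -> f y = g y) -> is_derive x v f df -> is_derive x v g df.
Proof.
move=> oU Ux fg; apply: near_eq_is_derive.
by apply: filterS (open_nbhs_nbhs (conj oU Ux)).
Qed.

Lemma isd_cst (W : normedModType R) (a : W) x v : is_derive x v (fun _ => a) 0.
Proof. exact: is_derive_cst. Qed.

Lemma isdD (W : normedModType R) (f g : V -> W) x v df dg :
  is_derive x v f df -> is_derive x v g dg -> is_derive x v (fun y => f y + g y) (df + dg).
Proof. exact: is_deriveD. Qed.

Lemma isdN (W : normedModType R) (f : V -> W) x v df :
  is_derive x v f df -> is_derive x v (fun y => - f y) (- df).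
Proof. exact: is_deriveN. Qed.

Lemma isdM (f g : V -> R) x v df dg :
  is_derive x v f df -> is_derive x v g dg ->
  is_derive x v (fun y => f y * g y) (df * g x + f x * dg).
Proof.
move=> hf hg; have := is_deriveM hf hg.
by rewrite -[f x *: dg]/(f x * dg) -[g x *: df]/(g x * df) addrC [g x * df]mulrC.
Qed.

Lemma isd_sum (W : normedModType R) n (f : 'I_n -> V -> W) x v (df : 'I_n -> W) :
  (forall i, is_derive x v (f i) (df i)) ->
  is_derive x v (fun y => \sum_(i < n) f i y) (\sum_(i < n) df i).
Proof.
move=> h; have := is_derive_sum h.
rewrite (_ : \sum_(i < n) f i = (fun y => \sum_(i < n) f i y)) //.
by apply/funext => y; rewrite fct_sumE.
Qed.

Lemma isdZ m n (f : V -> R) (F : V -> 'M[R]_(m, n)) x v df dF :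
  is_derive x v f df -> is_derive x v F dF ->
  is_derive x v (fun y => f y *: F y) (df *: F x + f x *: dF).
Proof.
move=> hf /isd_mxP hF; apply/isd_mxP => i j; rewrite !mxE.
rewrite (_ : (fun y => _) = (fun y => f y * F y i j)); first exact: isdM.
by apply/funext => y; rewrite mxE.
Qed.

Lemma isd_tr m n (F : V -> 'M[R]_(m, n)) x v dF :
  is_derive x v F dF -> is_derive x v (fun y => (F y)^T) dF^T.
Proof.
move=> /isd_mxP hF; apply/isd_mxP => i j; rewrite mxE.
rewrite (_ : (fun y => _) = (fun y => F y j i)) //.
by apply/funext => y; rewrite mxE.
Qed.

Lemma isd_mulmx m n p (F : V -> 'M[R]_(m, n)) (G : V -> 'M[R]_(n, p)) x v dF dG :
  is_derive x v F dF -> is_derive x v G dG ->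
  is_derive x v (fun y => F y *m G y) (dF *m G x + F x *m dG).
Proof.
move=> /isd_mxP hF /isd_mxP hG; apply/isd_mxP => i j; rewrite !mxE -big_split /=.
rewrite (_ : (fun y => _) = (fun y => \sum_k F y i k * G y k j)).
  by apply: isd_sum => k; exact: isdM.
by apply/funext => y; rewrite mxE.
Qed.

Lemma isd_mxtrace n (F : V -> 'M[R]_n) x v dF :
  is_derive x v F dF -> is_derive x v (fun y => \tr (F y)) (\tr dF).
Proof. by move=> /isd_mxP hF; apply: isd_sum => i; exact: hF. Qed.

Lemma isd_invmx n (U : set V) (F : V -> 'M[R]_n) x v dF : open U -> U x ->
  (forall y, U y -> F y \in unitmx) -> smooth_on U F -> is_derive x v F dF ->
  is_derive x v (fun y => invmx (F y)) (- (invmx (F x) *m dF *m invmx (F x))).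
Proof.
move=> oU Ux uF sF hF.
have dI := sm_isd v (sm_invmx oU uF sF) Ux.
have h1 := isd_mulmx hF dI.
have h2 : is_derive x v (fun y => F y *m invmx (F y)) 0.
  by apply: isd_near oU Ux _ (isd_cst 1%:M x v) => y Uy; rewrite mulmxV // uF.
have E : dF *m invmx (F x) + F x *m 'D_v (fun y => invmx (F y)) x = 0.
  by case: h1 => _ <-; case: h2 => _ <-.
suff <- : 'D_v (fun y => invmx (F y)) x = - (invmx (F x) *m dF *m invmx (F x)) by [].
rewrite -[LHS](mulKmx (uF x Ux)) -mulmxA -mulmxN; congr (_ *m _).
by apply/eqP; rewrite -addr_eq0 addrC E.
Qed.

Lemma isd_dual (F : V -> 'M[R]_4) x v dF :
  is_derive x v F dF -> is_derive x v (fun y => dual (F y)) (dual dF).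
Proof.
move=> /isd_mxP hF; apply/isd_mxP => i j; elim/ord4_ind: i; elim/ord4_ind: j; rewrite /dual skew4E.
all: under eq_fun do rewrite skew4E.
all: first [exact: isd_cst | exact: hF | apply: isdN; exact: hF].
Qed.

End MatrixDeriv.

(** * Derivative of the Hodge star *)

Lemma star_scale_arith (R : realFieldType) (s t d : R) : s != 0 -> s ^+ 2 = d ->
  - s ^- 2 * ((2 * s)^-1 * (2 * t * d)) = - s^-1 * t.
Proof. by move=> s0 <-; field. Qed.

Section MetricDeriv.
Variables (R : realType) (V : normedModType R) (U : set V) (G P : V -> 'M[R]_4).
Hypotheses (oU : open U) (sG : smooth_on U G) (sP : smooth_on U P).
Hypotheses (G_sym : forall x, U x -> (G x)^T = G x) (G_gt0 : forall x, U x -> 0 < \det (G x)).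
Hypothesis P_skew : forall x, U x -> (P x)^T = - P x.

(** Jacobi's formula for a derivative of G of the form A^T G + G A. It is
    read off dual_congr with N = G: there the determinant is the factor of a
    constant matrix, and dual_deriv differentiates the left-hand side. *)
Lemma isd_metric_det x v A : U x ->
  is_derive x v G (A^T *m G x + G x *m A) ->
  is_derive x v (fun y => \det (G y)) (2 * \tr A * \det (G x)).
Proof.
move=> Ux dG; (* Any constant skew matrix with a nonzero dual would do. *)
 pose P0 : 'M[R]_4 := skew4 0 0 0 0 0 1.
have skP0 : P0^T = - P0 by exact: skew4_tr.
pose Q := G x *m P0 *m G x.
have skQ : Q^T = - Q by rewrite /Q !trmx_mul G_sym // skP0 mulNmx mulmxN mulmxA.
have d0 : (dual P0) i0 i1 = 1 by rewrite dualE skew4E.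
have h : is_derive x v (fun y => (G y)^T *m dual (G y *m P0 *m (G y)^T) *m G y)
   ((2 * \tr A * \det (G x)) *: dual P0).
  have := isd_mulmx (isd_mulmx (isd_tr dG) (isd_dual (isd_mulmx (isd_mulmx dG (isd_cst P0 x v))
    (isd_tr dG)))) dG.
  congr (is_derive _ _ _ _); rewrite mulmx0 addr0 linearD /= !trmx_mul trmxK G_sym //.
  pose N := A *m P0 + P0 *m A^T.
  have -> : (A^T *m G x + G x *m A) *m P0 *m G x + G x *m P0 *m (G x *m A + A^T *m G x)
    = (A^T *m Q + Q *m A) + G x *m N *m G x.
    by rewrite /Q /N !(mulmxDl, mulmxDr) !mulmxA; mxlin.
  have skN : N^T = - N.
    by rewrite linearD /= !trmx_mul trmxK skP0 mulNmx mulmxN opprD addrC.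
  have dN : dual N = \tr A *: dual P0 - A^T *m dual P0 - dual P0 *m A.
    by have := @dual_deriv _ A^T _ skP0; rewrite trmxK mxtrace_tr.
  have E1 : G x *m dual (G x *m N *m G x) *m G x =
    \det (G x) *: (\tr A *: dual P0 - A^T *m dual P0 - dual P0 *m A).
    by have := @dual_congr _ (G x) _ skN; rewrite G_sym // dN.
  have E0 : G x *m dual Q *m G x = \det (G x) *: dual P0.
    by have := @dual_congr _ (G x) _ skP0; rewrite G_sym.
  rewrite -/Q mulmxDl.
  have -> : G x *m dual (A^T *m Q + Q *m A + G x *m N *m G x) *m G x =
     G x *m (\tr A *: dual Q - A *m dual Q - dual Q *m A^T) *m G x
     + \det (G x) *: (\tr A *: dual P0 - A^T *m dual P0 - dual P0 *m A).
    by rewrite dualD dual_deriv // mulmxDr mulmxDl E1.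
  have -> : G x *m (\tr A *: dual Q - A *m dual Q - dual Q *m A^T) *m G x
     = \tr A *: (G x *m dual Q *m G x) - G x *m A *m dual Q *m G x - G x *m dual Q *m A^T *m G x.
    by rewrite !(mulmxDl, mulmxDr, mulmxN, mulNmx) -scalemxAr -scalemxAl !mulmxA.
  have -> : (G x *m A + A^T *m G x) *m dual Q *m G x =
     G x *m A *m dual Q *m G x + \det (G x) *: (A^T *m dual P0).
    by rewrite !mulmxDl scalemxAr -E0 !mulmxA.
  have -> : G x *m dual Q *m (A^T *m G x + G x *m A) =
     G x *m dual Q *m A^T *m G x + \det (G x) *: (dual P0 *m A).
    by rewrite mulmxDr scalemxAl -E0 !mulmxA.
  rewrite E0; mxlin.
have E y : \det (G y) = ((G y)^T *m dual (G y *m P0 *m (G y)^T) *m G y) i0 i1.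
  by rewrite dual_congr // mxE d0 mulr1.
rewrite (_ : (fun y => \det (G y)) = (fun y => ((G y)^T *m dual (G y *m P0 *m (G y)^T) *m
  G y) i0 i1)).
  by move/isd_mxP: h => /(_ i0 i1); rewrite mxE d0 mulr1.
by apply/funext => y; exact: E.
Qed.

Lemma isd_star_scale x v A : U x ->
  is_derive x v G (A^T *m G x + G x *m A) ->
  is_derive x v (fun y => (Num.sqrt (\det (G y)))^-1)
    (- (Num.sqrt (\det (G x)))^-1 * \tr A).
Proof.
move=> Ux dG; have [dd dE] := isd_metric_det Ux dG.
have d0 := G_gt0 Ux.
have s0 : Num.sqrt (\det (G x)) != 0 by rewrite gt_eqF // sqrtr_gt0.
have [ds sE] := @is_derive_sqrt R V (fun y => \det (G y)) x v d0 dd.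
apply: DeriveDef; first exact: derivableV.
rewrite deriveV // sE dE; exact: (star_scale_arith _ s0 (sqr_sqrtr (ltW d0))).
Qed.

(** The Hodge star is parallel: if A is a connection matrix for which G is
    parallel, and N the covariant derivative of P, then the covariant derivative of
    the dual of P is the dual of N. With A the opposite of a Jacobian matrix it
    serves for Lie derivatives. *)
Lemma isd_hstar x v A N : U x -> N^T = - N ->
  is_derive x v G (A^T *m G x + G x *m A) ->
  is_derive x v P (A^T *m P x + P x *m A + N) ->
  is_derive x v (fun y => hstar (G y) (P y))
    (A^T *m hstar (G x) (P x) + hstar (G x) (P x) *m A + hstar (G x) N).
Proof.
move=> Ux skN dG dP.
have h := isdZ (isd_star_scale Ux dG) (isd_mulmx (isd_mulmx dG (isd_dual dP)) dG).
rewrite (_ : (fun y => hstar (G y) (P y)) = (fun y => (Num.sqrt (\det (G y)))^-1 *: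
  (G y *m dual (P y) *m G y))).
  rewrite -(@star_deriv R (G x) A (P x) N (P_skew Ux) skN).
  move: h; rewrite mulmxDl; exact.
by apply/funext => y; rewrite hstarE.
Qed.

Lemma sm_hstar : smooth_on U (fun y => hstar (G y) (P y)).
Proof.
have d0 x : U x -> Num.sqrt (\det (G x)) != 0.
  by move=> /G_gt0 h; rewrite gt_eqF // sqrtr_gt0.
apply: (@sm_ext _ _ _ oU _ (fun y => (Num.sqrt (\det (G y)))^-1 *: (G y *m dual (P y) *m G y))).
  by move=> x _; rewrite hstarE.
apply: smZ => //; last by apply: sm_mulmx => //; apply: sm_mulmx => //; exact: sm_dual.
by apply: smV => //; apply: sm_sqrt => //; exact: sm_det.
Qed.

Lemma sm_gendo : smooth_on U (fun y => gendo (G y) (P y)).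
Proof.
apply: (@sm_ext _ _ _ oU _ (fun y => invmx (G y) *m (P y)^T)).
  by move=> x _; rewrite gendoE.
apply: sm_mulmx => //; last exact: sm_tr.
by apply: sm_invmx => // x Ux; apply: metric_unit; exact: G_gt0.
Qed.

(** Raising an index commutes with covariant derivatives. *)
Lemma isd_gendo x v A N : U x ->
  is_derive x v G (A^T *m G x + G x *m A) ->
  is_derive x v P (A^T *m P x + P x *m A + N) ->
  is_derive x v (fun y => gendo (G y) (P y))
    (gendo (G x) (P x) *m A - A *m gendo (G x) (P x) + gendo (G x) N).
Proof.
move=> Ux dG dP.
have uG y : U y -> G y \in unitmx by move=> Uy; apply: metric_unit; exact: G_gt0.
have h := isd_mulmx (isd_invmx oU Ux uG sG dG) (isd_tr dP).
rewrite (_ : (fun y => gendo (G y) (P y)) = (fun y => invmx (G y) *m (P y)^T)); last first.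
  by apply/funext => y; rewrite gendoE.
move: h; congr (is_derive _ _ _ _); rewrite !gendoE.
have -> : invmx (G x) *m (A^T *m G x + G x *m A) *m invmx (G x) = invmx (G x) *m A^T + A *m
  invmx (G x).
  by rewrite mulmxDr mulmxDl mulKmx ?uG // !mulmxA mulmxK ?uG.
rewrite !linearD /= !trmx_mul trmxK !(mulNmx, mulmxN, mulmxDl, mulmxDr) !mulmxA P_skew //.
rewrite !(mulNmx, mulmxN).
mxlin.
Qed.

End MetricDeriv.

(** * Levi-Civita connection and curvature in a chart *)

Lemma dir_deriv (R : realType) m n (U : set 'cV[R]_4) (F : 'cV[R]_4 -> 'M[R]_(m, n)) x u :
  open U -> smooth_on U F -> U x ->
  is_derive x u F (\sum_(k < 4) u k 0 *: 'D_(delta_mx k 0) F x).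
Proof.
move=> oU sF Ux; apply/isd_mxP => i j; rewrite summxE.
have := @chain_rule R 4 _ U (fun y => F y i j) id x u oU (sm_entry oU i j sF 1) Ux
  (@derivable_id _ _ _ _).
congr (is_derive _ _ _ _); apply: eq_bigr => k _.
by rewrite derive_id !mxE derive_mx ?mxE //; exact: sm_derivable sF Ux.
Qed.

Lemma schwarz_mx (R : realType) m n (V : normedModType R) (U : set V) (F : V ->
  'M[R]_(m, n)) x u v :
  open U -> smooth_on U F -> U x -> 'D_u ('D_v F) x = 'D_v ('D_u F) x.
Proof.
move=> oU sF Ux; apply/matrixP => i j.
have E w y : U y -> 'D_w F y i j = 'D_w (fun z => F z i j) y.
  by move=> Uy; rewrite derive_mx ?mxE //; exact: sm_derivable sF Uy.
have EE w w' : 'D_w ('D_w' F) x i j = 'D_w ('D_w' (fun z => F z i j)) x.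
  rewrite derive_mx ?mxE; last exact: sm_derivable (sm_derive w' sF) Ux.
  apply: near_eq_derive; apply: (near_open oU Ux) => y Uy; exact: E.
apply: etrans (EE u v) _; apply: etrans _ (esym (EE v u)).
have S := (@schwarz R V U (fun z => F z i j) x u v oU (sm_entry oU i j sF 2) Ux).
exact: S.
Qed.

Section Koszul.
Variables (R : realType) (d : 'I_4 -> 'M[R]_4).

(** For d_k the partial derivatives of a metric: the Christoffel symbols with
    lowered index. *)
Definition koszul k : 'M[R]_4 := \matrix_(m, j) (2^-1 * (d k j m + d j k m - d m k j)).

Hypothesis d_sym : forall k i j, d k i j = d k j i.

Lemma koszul_compat k : d k = (koszul k)^T + koszul k.
Proof.
apply/matrixP => i j; rewrite !mxE [d k j i]d_sym [d j k i]d_sym [d i k j]d_sym.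
by rewrite [d j i k]d_sym [d i j k]d_sym; field.
Qed.

Lemma koszul_torsion k j m : koszul k m j = koszul j m k.
Proof. by rewrite !mxE [d m j k]d_sym [_ + d j _ _]addrC. Qed.

(** A metric and torsion-free connection is determined by the metric; this is
    how the transformation law of the Christoffel symbols is obtained. *)
Lemma koszul_unique (S : 'I_4 -> 'M[R]_4) :
  (forall k, d k = (S k)^T + S k) -> (forall k j m, S k m j = S j m k) ->
  forall k, S k = koszul k.
Proof.
move=> dE tor k; apply/matrixP => m j; rewrite mxE !dE !mxE.
by rewrite [S j m k]tor [S m j k]tor [S k j m]tor [S j k m]tor; field.
Qed.

End Koszul.

(** Algebraic content of the Ricci identity: the two second derivatives of F
    are equated, after substitution of the first ones. *)
Lemma ricci_commute_alg (R : rcfType) (F Gi Gj Fi Fj Ni Nj dij dji nij nji : 'M[R]_4) :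
  Fi = Gi^T *m F + F *m Gi + Ni -> Fj = Gj^T *m F + F *m Gj + Nj ->
  dij^T *m F + Gj^T *m Fi + (Fi *m Gj + F *m dij) + nij =
    dji^T *m F + Gi^T *m Fj + (Fj *m Gi + F *m dji) + nji ->
  (dij - dji + Gi *m Gj - Gj *m Gi)^T *m F + F *m (dij - dji + Gi *m Gj - Gj *m Gi) =
  - ((nij - Gi^T *m Nj - Nj *m Gi) - (nji - Gj^T *m Ni - Ni *m Gj)).
Proof.
move=> -> -> E; apply/eqP; rewrite -subr_eq0; apply/eqP.
move/eqP: E; rewrite -subr_eq0 => /eqP <-.
have -> : (dij - dji + Gi *m Gj - Gj *m Gi)^T = dij^T - dji^T + Gj^T *m Gi^T - Gi^T *m Gj^T.
  by rewrite -!trmx_mul; apply/matrixP => i j; rewrite !mxE.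
rewrite !(mulmxDl, mulmxDr, mulNmx, mulmxN) !mulmxA.
mxlin.
Qed.

Lemma bianchi_alg (R : rcfType) (d : 'I_4 -> 'I_4 -> 'M[R]_4) (G : 'I_4 -> 'M[R]_4) i j k m :
  (forall a b c, d a b m c = d a c m b) -> (forall k j l, G k l j = G j l k) ->
  (d i j - d j i + G i *m G j - G j *m G i) m k + (d j k - d k j + G j *m G k - G k *m G j) m i
  + (d k i - d i k + G k *m G i - G i *m G k) m j = 0.
Proof.
move=> D tor; have M a b c : (G a *m G b) m c = (G a *m G c) m b.
  by rewrite !mxE; apply: eq_bigr => l _; rewrite [G b l c]tor.
have E (A B C E : 'M[R]_4) p q : (A - B + C - E) p q = A p q - B p q +
  C p q - E p q by rewrite !mxE.
rewrite !E [d i j m k]D [d j k m i]D [d k i m j]D [(G i *m G j) m k]M [(G j *m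
  G k) m i]M [(G k *m G i) m j]M.
by move: (d _ _ m _) (d _ _ m _) (d _ _ m _) ((_ *m _) m _) ((_ *m _) m _) ((_ *m _) m _) => *;
  ring.
Qed.

Section Local.
Variables (R : realType).
Local Notation vec := 'cV[R]_4.
Local Notation e k := (delta_mx k 0 : vec).

(** Locked, as its unfolding contains derivatives of the metric. *)
Definition local_gam G k x : 'M[R]_4 := locked (invmx (G x) *m koszul (fun k => 'D_(e k) G x) k).

Lemma local_gamE G k x : local_gam G k x = invmx (G x) *m koszul (fun k => 'D_(e k) G x) k.
Proof. by rewrite /local_gam -lock. Qed.

Definition local_curv G i j x : 'M[R]_4 :=
  'D_(e i) (local_gam G j) x - 'D_(e j) (local_gam G i) x + local_gam G i x *m
    local_gam G j x - local_gam G j x *m local_gam G i x.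

Definition local_ric G x : 'M[R]_4 := \matrix_(j, k) \sum_i (local_curv G i j x) i k.

Section Metric.
Variables (O : set vec) (G : vec -> 'M[R]_4).
Hypotheses (oO : open O) (sG : smooth_on O G).
Hypotheses (G_sym : forall x, O x -> (G x)^T = G x) (G_gt0 : forall x, O x -> 0 < \det (G x)).

Local Notation gam := (local_gam G).
Local Notation curv := (local_curv G).
Local Notation ric := (local_ric G).

Lemma G_unit x : O x -> G x \in unitmx.
Proof. by move=> Ox; apply: metric_unit; exact: G_gt0. Qed.

Lemma dG_sym x v i j : O x -> 'D_v G x i j = 'D_v G x j i.
Proof.
move=> Ox; have [_ E] := isd_near oO Ox G_sym (isd_tr (sm_isd v sG Ox)).
by rewrite {1}E mxE.
Qed.

Let d x k := 'D_(e k) G x.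

Lemma gam_lowE x k : O x -> G x *m gam k x = koszul (d x) k.
Proof. by move=> Ox; rewrite local_gamE mulKVmx // G_unit. Qed.

Lemma gam_compat x k : O x -> 'D_(e k) G x = (gam k x)^T *m G x + G x *m gam k x.
Proof.
move=> Ox; rewrite -{1}(G_sym Ox) -trmx_mul gam_lowE //.
by apply: (@koszul_compat _ (d x)) => i j l; exact: dG_sym.
Qed.

Lemma isd_metric x k : O x -> is_derive x (e k) G ((gam k x)^T *m G x + G x *m gam k x).
Proof. by move=> Ox; rewrite -gam_compat //; exact: sm_isd. Qed.

Lemma gam_torsion k j l x : O x -> gam k x l j = gam j x l k.
Proof.
move=> Ox; rewrite !local_gamE mxE [RHS]mxE; apply: eq_bigr => m _; congr (_ * _).
by apply: koszul_torsion => i p q; exact: dG_sym.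
Qed.

Lemma gam_unique x (C : 'I_4 -> 'M[R]_4) : O x ->
  (forall k, 'D_(e k) G x = (C k)^T *m G x + G x *m C k) ->
  (forall k j l, C k l j = C j l k) -> forall k, C k = gam k x.
Proof.
move=> Ox compat torsion k.
rewrite -[LHS](mulKmx (G_unit Ox)) local_gamE.
suff -> : G x *m C k = koszul (d x) k by [].
apply: (@koszul_unique _ (d x) (fun k => G x *m C k)) => [i|i j m].
- by rewrite /d compat trmx_mul G_sym.
- by rewrite !mxE; apply: eq_bigr => l _; rewrite torsion.
Qed.

Lemma sm_gam k : smooth_on O (gam k).
Proof.
apply: (@sm_ext _ _ _ oO _ (fun x => invmx (G x) *m koszul (fun k => 'D_(e k) G x) k)).
  by move=> x _; rewrite local_gamE.
apply: sm_mulmx => //; first by apply: sm_invmx => //; exact: G_unit.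
apply/sm_mxP => // m j.
have sd i p q : smooth_on O (fun x => 'D_(e i) G x p q).
  by apply: sm_entry => //; exact: sm_derive.
have sN i p q : smooth_on O (fun x => - 'D_(e i) G x p q).
  apply: (@sm_ext _ _ _ oO _ (fun x => -1 * 'D_(e i) G x p q)); first by move=> x _; rewrite mulN1r.
  by apply: smM => //; exact: (@sm_cst _ _ _ oO R^o).
apply: (@sm_ext _ _ _ oO _ (fun x => 2^-1 * ('D_(e k) G x j m + 'D_(e j) G x k m +
  - 'D_(e m) G x k j))).
  by move=> x _; rewrite /koszul mxE.
apply: smM => //; first exact: (@sm_cst _ _ _ oO R^o).
by apply: smD => //; apply: smD.
Qed.

Lemma sm_curv i j : smooth_on O (curv i j).
Proof.
have sN (F : vec -> 'M[R]_4) : smooth_on O F -> smooth_on O (fun x => - F x).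
  move=> sF; apply: (@sm_ext _ _ _ oO _ (fun x => (-1) *: F x)).
    by move=> x _; rewrite scaleN1r.
  by apply: smZ => //; exact: (@sm_cst _ _ _ oO R^o).
have sg k l : smooth_on O (fun x => gam k x *m gam l x) by apply: sm_mulmx => //; exact: sm_gam.
have sdg k l : smooth_on O (fun x => 'D_(e k) (gam l) x) by apply: sm_derive; exact: sm_gam.
apply: smD => //; last exact: sN.
apply: smD => //; apply: smD => //; exact: sN.
Qed.

Lemma sm_ric : smooth_on O ric.
Proof.
apply/sm_mxP => // j k.
apply: (@sm_ext _ _ _ oO _ (fun x => \sum_i (curv i j x) i k)); first by move=> x _; rewrite mxE.
by apply: sm_sum => // i; apply: sm_entry => //; exact: sm_curv.
Qed.

(** The Ricci identity for a covariant 2-tensor F with covariant derivatives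
    N k: the curvature acts on F by the antisymmetrised second covariant
    derivative. *)
Lemma ricci_commute (F : vec -> 'M[R]_4) (N : 'I_4 -> vec -> 'M[R]_4) (dN : 'I_4 -> 'I_4 ->
  'M[R]_4) x i j :
  O x -> smooth_on O F ->
  (forall k y, O y -> 'D_(e k) F y = (gam k y)^T *m F y + F y *m gam k y + N k y) ->
  (forall k l, is_derive x (e k) (N l) (dN k l)) ->
  (curv i j x)^T *m F x + F x *m curv i j x =
  - ((dN i j - (gam i x)^T *m N j x - N j x *m gam i x)
   - (dN j i - (gam j x)^T *m N i x - N i x *m gam j x)).
Proof.
move=> Ox sF dF hN.
have key k l : 'D_(e k) ('D_(e l) F) x =
   ('D_(e k) (gam l) x)^T *m F x + (gam l x)^T *m 'D_(e k) F x
   + ('D_(e k) F x *m gam l x + F x *m 'D_(e k) (gam l) x) + dN k l.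
  have dg := sm_isd (e k) (sm_gam l) Ox.
  have dFx := sm_isd (e k) sF Ox.
  have h := isdD (isdD (isd_mulmx (isd_tr dg) dFx) (isd_mulmx dFx dg)) (hN k l).
  have [_ <-] := h.
  by apply: near_eq_derive; apply: (near_open oO Ox) => y Oy; rewrite dF.
have S := schwarz_mx (e i) (e j) oO sF Ox; rewrite key key in S.
exact: (ricci_commute_alg (dF i x Ox) (dF j x Ox) S).
Qed.

(** The Ricci identity for the parallel tensor G. *)
Lemma curv_skew x i j : O x -> (curv i j x)^T *m G x + G x *m curv i j x = 0.
Proof.
move=> Ox.
have h (k l : 'I_4) : is_derive x (e k) (fun _ : vec => 0 : 'M[R]_4) 0 by exact: isd_cst.
have c0 k y : O y -> 'D_(e k) G y = (gam k y)^T *m G y + G y *m gam k y + 0.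
  by move=> Oy; rewrite addr0 gam_compat.
have := @ricci_commute G (fun _ _ => 0) (fun _ _ => 0) x i j Ox sG c0 h.
by rewrite !mulmx0 !mul0mx !subr0 oppr0.
Qed.

Lemma bianchi x i j k m : O x -> curv i j x m k + curv j k x m i + curv k i x m j = 0.
Proof.
move=> Ox.
have D a b c : 'D_(e a) (gam b) x m c = 'D_(e a) (gam c) x m b.
  have gE y : O y -> gam b y m c = gam c y m b by exact: gam_torsion.
  have /isd_mxP /(_ m c) [_ h1] := sm_isd (e a) (sm_gam b) Ox.
  have /isd_mxP /(_ m b) [_ h2] := sm_isd (e a) (sm_gam c) Ox.
  apply: etrans (esym h1) _; apply: etrans _ h2.
  by apply: near_eq_derive; apply: (near_open oO Ox) => y Oy; exact: gE.
apply: (@bianchi_alg _ (fun a b => 'D_(e a) (gam b) x) (fun a => gam a x)) => // a b c.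
exact: gam_torsion.
Qed.

End Metric.
End Local.

(** * Contractions of the curvature *)

Lemma pair_symmetry (R : realFieldType) (I : Type) (r : I -> I -> I -> I -> R) :
  (forall i j m k, r i j k m = - r i j m k) -> (forall i j m k, r j i m k = - r i j m k) ->
  (forall i j k m, r i j m k + r j k m i + r k i m j = 0) ->
  forall i j m k, r i j m k = r m k i j.
Proof.
move=> A1 A2 B i j m k; move: (B i j k m) (B j k m i) (B k m i j) (B m i j k).
rewrite [r j k i m]A1 [r k m j i]A1 [r i k j m]A2 [r k i j m]A1 [r m i k j]A1 [r i j k m]A1.
rewrite [r j m k i]A2 [r m j k i]A1 [r m k i j]A2.
by move: (r i j m k) (r j k m i) (r k i m j) (r k m i j) (r m j i k) (r m i j k) => *; lra.
Qed.

Section Contract.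
Variables (R : realType) (g : 'M[R]_4) (K : 'I_4 -> 'I_4 -> 'M[R]_4).
Hypotheses (g_sym : g^T = g) (g_gt0 : 0 < \det g).
Hypotheses (K_skew : forall i j, (K i j)^T *m g + g *m K i j = 0)
  (K_anti : forall i j, K j i = - K i j)
  (K_bianchi : forall i j k m, K i j m k + K j k m i + K k i m j = 0).

Let ginv := invmx g.
Let r i j m k := (g *m K i j) m k.

Definition ric_trace (W : 'I_4 -> 'I_4 -> 'M[R]_4) : 'M[R]_4 :=
  \matrix_(j, k) \sum_i (W i j) i k.

Local Notation ricm := (ric_trace K).

Let gu : g \in unitmx. Proof. exact: metric_unit. Qed.
Let ginv_sym i j : ginv i j = ginv j i.
Proof. by have /matrixP /(_ j i) := metric_inv_sym g_sym; rewrite mxE. Qed.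

Lemma r_pair i j m k : r i j m k = r m k i j.
Proof.
apply: pair_symmetry => {i j m k} [i j m k|i j m k|i j k m].
- have E : (g *m K i j)^T = - (g *m K i j).
    by rewrite trmx_mul g_sym; apply/eqP; rewrite -addr_eq0 K_skew.
  by move/matrixP: E => /(_ m k); rewrite mxE [RHS]mxE.
- by rewrite /r K_anti mulmxN mxE.
- rewrite /r !mxE -!big_split /=; apply: big1 => l _.
  by rewrite -!mulrDr K_bianchi mulr0.
Qed.

Lemma K_raise i j l k : K i j l k = \sum_m ginv l m * r i j m k.
Proof. by rewrite -{1}[K i j](mulKmx gu) mxE. Qed.

(** By pair symmetry of the curvature. *)
Lemma ric_sym : ricm^T = ricm.
Proof.
apply/matrixP => k j; rewrite !mxE.
under eq_bigr do rewrite K_raise.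
under [RHS]eq_bigr do rewrite K_raise.
rewrite exchange_big /=; apply: eq_bigr => i _; apply: eq_bigr => m _.
by rewrite r_pair ginv_sym.
Qed.

(** Exchanging the curvature with the endomorphism of P costs the term in W. With
    the curvature on the left, the contraction is the Ricci tensor composed with P;
    with P on the left, it is skew by pair symmetry. *)
Lemma contract_derivation P W : P^T = - P ->
  (forall i j, (K i j)^T *m P + P *m K i j = - W i j) ->
  exists2 Q : 'M[R]_4, Q^T = - Q &
    ricm *m gendo g P = Q - ric_trace (fun i j => ginv *m W i j).
Proof.
move=> skP HW; pose Psi := gendo g P.
have PsiE : Psi = - (ginv *m P) by exact: endoE.
have step i j : K i j *m Psi = Psi *m K i j - ginv *m W i j.
  have E : W i j = - ((K i j)^T *m P + P *m K i j) by rewrite HW opprK.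
  have KT : (K i j)^T = - (g *m K i j *m ginv).
    rewrite -[LHS](mulmxK gu) -mulNmx; congr (_ *m _); apply/eqP.
    by rewrite -addr_eq0 K_skew.
  rewrite E KT PsiE mulmxN mulNmx mulmxN mulmxDr !mulNmx mulmxN !mulmxA mulVmx // mul1mx.
  by rewrite opprD !opprK; mxlin.
pose C := Psi *m ginv.
have skC i m : C m i = - C i m.
  have E : C^T = - C.
    rewrite /C PsiE mulNmx linearN /= !trmx_mul /ginv metric_inv_sym // skP.
    by rewrite mulNmx mulmxN !mulmxA.
  by move/matrixP: E => /(_ i m); rewrite mxE [RHS]mxE.
exists (ric_trace (fun i j => Psi *m K i j)).
  apply/matrixP => k j; rewrite !mxE.
  have E a b : \sum_i (Psi *m K i a) i b = \sum_i \sum_m C i m * r i a m b.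
    apply: eq_bigr => i _; rewrite -[K i a](mulKmx gu) -/ginv.
    by rewrite [Psi *m _]mulmxA -/C mxE.
  rewrite !E -sumrN exchange_big /=; apply: eq_bigr => i _.
  rewrite -sumrN; apply: eq_bigr => m _.
  by rewrite skC r_pair mulNr.
apply/matrixP => j k; rewrite !mxE -sumrB.
transitivity (\sum_i (K i j *m Psi) i k).
  under eq_bigr do rewrite mxE mulr_suml.
  rewrite exchange_big /=; apply: eq_bigr => i _.
  by rewrite [RHS]mxE.
by apply: eq_bigr => i _; rewrite step !mxE.
Qed.

(** The value of - (R_ij^T psi + psi R_ij) for a star-Killing form psi,
    where B = nabla alpha. *)
Definition wedge_gap (B : 'M[R]_4) i j : 'M[R]_4 :=
  wedge (row i B) (row j g) - wedge (row j B) (row i g).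

Lemma contract_wedge B :
  ric_trace (fun i j => ginv *m wedge_gap B i j) = \tr (ginv *m B^T) *: g + B *+ 2.
Proof.
have colg i : ginv *m (row i g)^T = delta_mx i 0 by rewrite tr_row g_sym colE mulKmx.
have E i j : ginv *m wedge_gap B i j = ginv *m (row i B)^T *m row j g - delta_mx j 0 *m row i B
    - ginv *m (row j B)^T *m row i g + delta_mx i 0 *m row j B.
  by rewrite /wedge_gap /wedge !mulmxBr !mulmxA !colg opprB; mxlin.
apply/matrixP => j k; rewrite !mxE.
under eq_bigr do rewrite E !mxE !big_ord1 !mxE !eqxx !andbT.
rewrite !big_split /= !sumrN.
have -> : \sum_(i < 4) (i == j)%:R * B i k = B j k.
  rewrite (bigD1 j) //= eqxx mul1r big1 ?addr0 // => i /negbTE ->.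
  by rewrite mul0r.
have -> : \sum_(i < 4) (\sum_(l < 4) ginv i l * (row j B)^T l 0) * g i k = B j k.
  transitivity ((g *m (ginv *m (row j B)^T)) k 0).
    rewrite [RHS]mxE; apply: eq_bigr => i _.
    by have /matrixP /(_ i k) := g_sym; rewrite mxE => ->; rewrite [RHS]mulrC mxE.
  by rewrite mulKVmx // !mxE.
have -> : \sum_(i < 4) (\sum_(l < 4) ginv i l * (row i B)^T l 0) * g j k = \tr (ginv *m
  B^T) * g j k.
  rewrite -mulr_suml; congr (_ * _); apply: eq_bigr => i _; rewrite mxE.
  by apply: eq_bigr => l _; rewrite !mxE.
under [X in _ + X]eq_bigr do rewrite mul1r.
rewrite sumr_const card_ord; ring.
Qed.

(** Listing the twelve nonzero terms keeps contract_dual_skew small. *)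
Lemma contract_dual (F : 'I_4 -> 'M[R]_4) (S : 'M[R]_4) k : \sum_i (dual (F i) *m S) i k =
  F i0 i2 i3 * S i1 k + F i0 i3 i1 * S i2 k + F i0 i1 i2 * S i3 k
  - F i1 i2 i3 * S i0 k + F i1 i0 i3 * S i2 k + F i1 i2 i0 * S i3 k
  - F i2 i3 i1 * S i0 k - F i2 i0 i3 * S i1 k + F i2 i0 i1 * S i3 k
  - F i3 i1 i2 * S i0 k - F i3 i2 i0 * S i1 k - F i3 i0 i1 * S i2 k.
Proof.
have E P i : (dual P *m S) i k = \sum_l dual P i l * S l k by rewrite mxE.
rewrite sum4 !E !sum4 /dual !skew4E; ring.
Qed.

(** The contraction is a sum over the Levi-Civita symbol of B times S, in which
    the symmetry of S and the antisymmetry of the symbol leave a form that is skew in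
    the remaining indices. *)
Lemma contract_dual_skew (S B : 'M[R]_4) : S^T = S ->
  let Q := ric_trace (fun i j => dual (wedge (row i B) (row j S) - wedge (row j B) (row i S)) *m
    S) in
  Q^T = - Q.
Proof.
move=> S_sym Q.
have SE i j : S j i = S i j by have /matrixP /(_ i j) := S_sym; rewrite mxE.
have wE (u v : 'rV[R]_4) a b : wedge u v a b = u 0 a * v 0 b - v 0 a * u 0 b.
  by rewrite /wedge !mxE !big_ord1 !mxE.
have E i j' a b : (wedge (row i B) (row j' S) - wedge (row j' B) (row i S)) a b =
  B i a * S j' b - S j' a * B i b - (B j' a * S i b - S i a * B j' b).
  by rewrite mxE [X in _ + X]mxE !wE !mxE.
have QE j k := contract_dual (fun i =>
  wedge (row i B) (row j S) - wedge (row j B) (row i S)) S k.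
have {}QE j k := etrans (mxE _ _ j k : Q j k = _) (QE j k).
have opp_tr (X : 'M[R]_4) j k : X^T j k = X k j by rewrite mxE.
apply/matrixP => j k; rewrite [RHS]mxE opp_tr !QE !E.
rewrite [S i1 i0]SE [S i2 i0]SE [S i3 i0]SE [S i2 i1]SE [S i3 i1]SE [S i3 i2]SE.
elim/ord4_ind: j; elim/ord4_ind: k.
all: rewrite ?[S i1 i0]SE ?[S i2 i0]SE ?[S i3 i0]SE ?[S i2 i1]SE ?[S i3 i1]SE ?[S i3 i2]SE.
all: ring.
Qed.

Lemma contract_star_wedge B :
  let Q := ric_trace (fun i j => ginv *m hstar g (wedge_gap B i j)) in Q^T = - Q.
Proof.
move=> Q; have := contract_dual_skew B g_sym; set Q' := ric_trace _ => skQ'.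
suff -> : Q = (Num.sqrt (\det g))^-1 *: Q' by rewrite linearZ /= skQ' scalerN.
apply/matrixP => j k; rewrite [RHS]mxE ![ric_trace _ _ _]mxE mulr_sumr.
apply: eq_bigr => i _; rewrite hstarE -scalemxAr -mulmxA mulKmx //.
by rewrite [LHS]mxE.
Qed.

Lemma wedge_skew (a b : 'rV[R]_4) : (wedge a b)^T = - wedge a b.
Proof. by rewrite /wedge linearB /= !trmx_mul !trmxK opprB. Qed.

(** The symmetric part of g Ric P and the commutator of Ric with P determine each
    other. The contraction for the dual form is skew, so Ric
    commutes with it, and then with P because their product is an invertible scalar.
    The contraction for P itself is then skew, which leaves for B only a trace part,
    and that part vanishes by taking the trace. *)
Lemma ricci_commutes P B h : P^T = - P ->
  (forall i j, (K i j)^T *m P + P *m K i j = - wedge_gap B i j) ->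
  gendo g P *m gendo g (hstar g P) = h%:M -> h != 0 ->
  [/\ (ginv *m ricm) *m gendo g (hstar g P) = gendo g (hstar g P) *m (ginv *m ricm),
      (ginv *m ricm) *m gendo g P = gendo g P *m (ginv *m ricm) & B + B^T = 0].
Proof.
move=> skP HP hE h0.
have skS := star_skew g_sym P.
have HS i j : (K i j)^T *m hstar g P + hstar g P *m K i j = - hstar g (wedge_gap B i j).
  by rewrite star_rot // HP starN.
have [Q1 skQ1 E1] := contract_derivation skP HP.
have [Q2 skQ2 E2] := contract_derivation skS HS.
rewrite contract_wedge in E1.
have skQ := contract_star_wedge B; simpl in skQ.
pose Ric := ginv *m ricm.
have RicE : ricm = g *m Ric by rewrite /Ric mulKVmx.
have comm X : X^T = - X -> ricm *m gendo g X + (ricm *m gendo g X)^T = g *m (Ric *m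
  gendo g X - gendo g X *m Ric).
  move=> skX; rewrite trmx_mul ric_sym {2}RicE mulmxA.
  have -> : (gendo g X)^T *m g = - (g *m gendo g X) by rewrite endoK // endoT // skX opprK.
  by rewrite RicE mulNmx mulmxBr !mulmxA.
have gI (X Y : 'M[R]_4) : g *m X = g *m Y -> X = Y.
  by move=> E; rewrite -[X](mulKmx gu) E mulKmx.
have C2 : Ric *m gendo g (hstar g P) = gendo g (hstar g P) *m Ric.
  apply/eqP; rewrite -subr_eq0; apply/eqP/gI; rewrite -comm // E2 mulmx0.
  by rewrite linearB /= skQ skQ2; mxlin.
have hE' : gendo g (hstar g P) *m gendo g P = h%:M.
  have [A1 A2] := endo_star g_sym g_gt0 skP; rewrite A2 -A1 hE //.
have cancel (X : 'M[R]_4) : X *m gendo g (hstar g P) = gendo g (hstar g P) *m X ->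
    X *m gendo g P = gendo g P *m X.
  move=> CX.
  have L : gendo g P *m (X *m gendo g (hstar g P)) *m gendo g P = h *: (gendo g P *m X).
    by rewrite -!mulmxA hE' mul_mx_scalar scalemxAr.
  have : gendo g P *m (gendo g (hstar g P) *m X) *m gendo g P = h *: (X *m gendo g P).
    by rewrite !mulmxA hE -mulmxA mul_scalar_mx.
  by rewrite -CX L => /(scalerI h0).
have C1 := cancel _ C2.
split => //.
have := comm _ skP; rewrite C1 subrr mulmx0 E1.
have E' t : Q1 - (t *: g + B *+ 2) + (Q1 - (t *: g + B *+ 2))^T = 0 -> B + B^T = - t *: g.
  move=> /matrixP E; apply/matrixP => i j; move: (E i j); rewrite !mxE.
  have /matrixP /(_ i j) := g_sym; have /matrixP /(_ i j) := skQ1; rewrite !mxE => -> ->.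
  by move: (Q1 i j) (B i j) (B j i) (g i j) => q b b' c h1; lra.
move=> /E' {}E'.
have T : \tr (ginv *m B) = \tr (ginv *m B^T).
  by rewrite -mxtrace_tr trmx_mul /ginv metric_inv_sym // mxtrace_mulC.
have : \tr (ginv *m (B + B^T)) = - \tr (ginv *m B^T) * 4.
  by rewrite E' -scalemxAr mulVmx // linearZ /= mxtrace1.
rewrite mulmxDr linearD /= T => T0.
have t0 : \tr (ginv *m B^T) = 0 by lra.
by rewrite E' t0 oppr0 scale0r.
Qed.

End Contract.

(** * Star-Killing forms in a chart *)

Lemma wedge_rot (R : realType) (u v : 'rV[R]_4) (A : 'M[R]_4) :
  A^T *m wedge u v + wedge u v *m A = wedge (u *m A) v + wedge u (v *m A).
Proof.
rewrite /wedge !trmx_mul !(mulmxDl, mulmxDr, mulmxN, mulNmx) !mulmxA.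
mxlin.
Qed.

Lemma wedgeDr (R : realType) (u v w : 'rV[R]_4) : wedge u (v + w) = wedge u v + wedge u w.
Proof. by apply/matrixP => i j; rewrite !mxE !big_ord1 !mxE; ring. Qed.

Lemma wedgeBl (R : realType) (u v w : 'rV[R]_4) : wedge (u - v) w = wedge u w - wedge v w.
Proof. by apply/matrixP => i j; rewrite !mxE !big_ord1 !mxE; ring. Qed.

Lemma isd_wedge (R : realType) (V : normedModType R) (u v : V -> 'rV[R]_4) x w du dv :
  is_derive x w u du -> is_derive x w v dv ->
  is_derive x w (fun y => wedge (u y) (v y)) (wedge du (v x) + wedge (u x) dv).
Proof.
move=> hu hv.
have := isdD (isd_mulmx (isd_tr hu) hv) (isdN (isd_mulmx (isd_tr hv) hu)).
by congr (is_derive _ _ _ _); rewrite /wedge; mxlin.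
Qed.

Lemma isd_row (R : realType) (V : normedModType R) m n (F : V -> 'M[R]_(m, n)) i x w dF :
  is_derive x w F dF -> is_derive x w (fun y => row i (F y)) (row i dF).
Proof.
move=> /isd_mxP hF; apply/isd_mxP => k j; rewrite mxE.
rewrite (_ : (fun y => _) = (fun y => F y i j)); first exact: hF.
by apply/funext => y; rewrite mxE.
Qed.

Lemma local_curv_anti (R : realType) (G : 'cV[R]_4 -> 'M[R]_4) i j x :
  local_curv G j i x = - local_curv G i j x.
Proof.
have alg (A B C D : 'M[R]_4) : B - A + D - C = - (A - B + C - D) by mxlin.
exact: alg.
Qed.

Lemma sym_arith (R : realFieldType) (d1 d2 q1 q1' q2 q3 w1 w2 a1 a2 g g' z : R) :
  d1 = q1 + q2 + w1 -> d2 = q1' + q3 + w2 -> 2 * d1 = 2 * d2 -> q1 = q1' ->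
  w1 = - 2^-1 * a1 * a2 - g * z -> w2 = - 2^-1 * a2 * a1 - g' * z -> g' = g -> q2 = q3.
Proof.
move=> -> -> + q1E w1E w2E gE; rewrite -q1E w1E w2E gE.
have -> : - 2^-1 * a2 * a1 = - 2^-1 * a1 * a2 by ring.
by move: (- 2^-1 * a1 * a2 - g * z) => w h; lra.
Qed.

Section StarKilling.
Variables (R : realType) (O : set 'cV[R]_4) (G P : 'cV[R]_4 -> 'M[R]_4) (a : 'cV[R]_4 -> 'rV[R]_4).
Hypotheses (oO : open O) (sG : smooth_on O G) (sP : smooth_on O P) (sa : smooth_on O a).
Hypotheses (G_sym : forall x, O x -> (G x)^T = G x) (G_gt0 : forall x, O x -> 0 < \det (G x)).
Hypothesis P_skew : forall x, O x -> (P x)^T = - P x.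
Local Notation vec := 'cV[R]_4.
Local Notation e k := (delta_mx k 0 : vec).
Local Notation gam := (local_gam G).
Hypothesis SK : forall x k, O x ->
  'D_(e k) P x = (gam k x)^T *m P x + P x *m gam k x + wedge (a x) (row k (G x)).

Definition nabla_alpha x : 'M[R]_4 := \matrix_(i, j) ('D_(e i) a x - a x *m gam i x) 0 j.

Lemma row_nabla_alpha x i : row i (nabla_alpha x) = 'D_(e i) a x - a x *m gam i x.
Proof. by apply/matrixP => p j; rewrite ord1 !mxE. Qed.

Lemma wedge_commute_alg (g A A' : 'M[R]_4) (u d d' gi gj q : 'rV[R]_4) :
  wedge d gj + wedge u (q + gj *m A) - A^T *m wedge u gj - wedge u gj *m A
  - (wedge d' gi + wedge u (q + gi *m A') - A'^T *m wedge u gi - wedge u gi *m A')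
  = wedge (d - u *m A) gj - wedge (d' - u *m A') gi.
Proof.
have step B x g' : wedge x g' + wedge u (q + g' *m B) - B^T *m wedge u g' - wedge u g' *m B =
    wedge (x - u *m B) g' + wedge u q.
  have -> M N : M - B^T *m wedge u g' - N = M - (B^T *m wedge u g' +
    N) :> 'M[R]_4 by rewrite opprD addrA.
  rewrite wedge_rot wedgeDr wedgeBl.
  move: (wedge x g') (wedge u q) (wedge u (g' *m B)) (wedge (u *m B) g') => w1 w2 w3 w4.
  by mxlin.
by rewrite !step opprD addrACA subrr addr0.
Qed.

(** The Ricci identity for psi, whose covariant derivatives are the forms
    alpha /\ g_k: the terms with alpha undifferentiated cancel by torsion-freeness. *)
Lemma curv_wedge x i j : O x ->
  (local_curv G i j x)^T *m P x + P x *m local_curv G i j x = - wedge_gap (G x) (nabla_alpha x) i j.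
Proof.
move=> Ox; pose N (k : 'I_4) (y : vec) : 'M[R]_4 := wedge (a y) (row k (G y)).
pose dN (k l : 'I_4) : 'M[R]_4 := wedge ('D_(e k) a x) (row l (G x)) +
  wedge (a x) (row l ((gam k x)^T *m G x + G x *m gam k x)).
have hN k l : is_derive x (e k) (N l) (dN k l).
  by apply: isd_wedge; [exact: sm_isd | apply: isd_row; exact: (isd_metric oO sG G_sym G_gt0 k Ox)].
rewrite (@ricci_commute R O G oO sG G_gt0 P N dN x i j Ox sP (fun k y Oy => SK k Oy) hN).
congr (- _); rewrite /wedge_gap !row_nabla_alpha /dN /N.
have rowE (k l : 'I_4) : row l ((gam k x)^T *m G x + G x *m gam k x) = row l ((gam k x)^T *m
  G x) + row l (G x) *m gam k x.
  by rewrite linearD /= -row_mul.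
have sym : row j ((gam i x)^T *m G x) = row i ((gam j x)^T *m G x).
  have tE (A B : 'M[R]_4) k p q : row k (A^T *m B) p q = \sum_l A l k * B l q.
    by rewrite !mxE; apply: eq_bigr => l _; rewrite mxE.
  apply/matrixP => p q; rewrite !tE; apply: eq_bigr => l _.
  by rewrite (gam_torsion oO sG G_sym i j l Ox).
rewrite !rowE sym; exact: (wedge_commute_alg (G x)).
Qed.

Local Notation Psi x := (gendo (G x) (P x)).
Local Notation Phi x := (gendo (G x) (hstar (G x) (P x))).
Local Notation Ricci x := (invmx (G x) *m (local_ric G x)^T).

Lemma local_ric_sym x : O x -> (local_ric G x)^T = local_ric G x.
Proof.
move=> Ox; apply: (@ric_sym R (G x) (fun i j => local_curv G i j x)); [exact: G_sym|exact:
  G_gt0| | |].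
- by move=> i j; exact: (curv_skew oO sG G_sym G_gt0 i j Ox).
- by move=> i j; exact: local_curv_anti.
- by move=> i j k m; exact: (bianchi oO sG G_sym G_gt0 i j k m Ox).
Qed.

Lemma local_ricci_commutes x h : O x -> Psi x *m Phi x = h%:M -> h != 0 ->
  [/\ Ricci x *m Phi x = Phi x *m Ricci x, Ricci x *m Psi x = Psi x *m Ricci x
    & nabla_alpha x + (nabla_alpha x)^T = 0].
Proof.
move=> Ox hE h0; rewrite local_ric_sym //.
apply: (@ricci_commutes R (G x) (fun i j => local_curv G i j x)) hE h0; [exact: G_sym|exact:
  G_gt0| | | | |].
- by move=> i j; exact: (curv_skew oO sG G_sym G_gt0 i j Ox).
- by move=> i j; exact: local_curv_anti.
- by move=> i j k m; exact: (bianchi oO sG G_sym G_gt0 i j k m Ox).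
- exact: P_skew.
- by move=> i j; exact: curv_wedge.
Qed.

(** The vector field K = -1/2 alpha^#. *)
Definition killing_vec x : vec := - 2^-1 *: (invmx (G x) *m (a x)^T).
Definition killing_jac x : 'M[R]_4 := \matrix_(k, j) 'D_(e j) killing_vec x k 0.

(** The matrix of X |-> nabla_X K, by torsion-freeness of the connection. *)
Definition cov_killing x : 'M[R]_4 := killing_jac x + \sum_k killing_vec x k 0 *: gam k x.

Lemma sm_killing_vec : smooth_on O killing_vec.
Proof.
apply: smZ => //; first exact: (@sm_cst _ _ _ oO R^o).
apply: sm_mulmx => //; last exact: sm_tr.
by apply: sm_invmx => // x Ox; apply: metric_unit; exact: G_gt0.
Qed.

Lemma metric_killing_vec x : O x -> G x *m killing_vec x = - 2^-1 *: (a x)^T.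
Proof. by move=> Ox; rewrite /killing_vec -scalemxAr mulKVmx // metric_unit // G_gt0. Qed.

Lemma killing_vec_metric x : O x -> (killing_vec x)^T *m G x = - 2^-1 *: a x.
Proof. by move=> Ox; rewrite -{1}(G_sym Ox) -trmx_mul metric_killing_vec // linearZ /= trmxK. Qed.

Lemma alpha_killing_vec x : O x -> a x = - 2 *: ((killing_vec x)^T *m G x).
Proof. by move=> Ox; rewrite killing_vec_metric // scalerA mulrNN mulfV ?scale1r // pnatr_eq0. Qed.

Lemma mul_col_basis (A : 'M[R]_4) i : A *m e i = col i A.
Proof. by rewrite colE. Qed.

Lemma cov_killing_basis x i : O x -> cov_killing x *m e i = 'D_(e i) killing_vec x +
  gam i x *m killing_vec x.
Proof.
move=> Ox; rewrite mulmxDl; congr (_ + _).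
  by apply/matrixP => k p; rewrite mul_col_basis ord1 !mxE.
rewrite mulmx_suml; apply/matrixP => l p; rewrite ord1 summxE mxE.
by apply: eq_bigr => k _; rewrite -scalemxAl mul_col_basis mxE [X in _ * X =
  _]mxE (gam_torsion oO sG G_sym k i l Ox) mulrC.
Qed.

Lemma metric_cov_killing x : O x -> G x *m cov_killing x = - 2^-1 *: (nabla_alpha x)^T.
Proof.
move=> Ox.
have main i : G x *m cov_killing x *m e i = (- 2^-1 *: (nabla_alpha x)^T) *m e i.
  rewrite -mulmxA cov_killing_basis //.
  have dk := sm_isd (e i) sm_killing_vec Ox.
  have da := sm_isd (e i) sa Ox.
  have [_ E1] := isd_mulmx (isd_metric oO sG G_sym G_gt0 i Ox) dk.
  have [_ E2] := isd_near oO Ox (fun y Oy => esym (metric_killing_vec Oy)) (isdZ (isd_cst (-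
    2^-1 : R^o) x (e i)) (isd_tr da)).
  rewrite E1 scale0r add0r mulmxDl -!mulmxA metric_killing_vec // -scalemxAr -trmx_mul in E2.
  have E3 : (- 2^-1 *: (nabla_alpha x)^T) *m e i = - 2^-1 *:
    (('D_(e i) a x)^T - (a x *m gam i x)^T).
    by rewrite -scalemxAl mul_col_basis -tr_row row_nabla_alpha linearB.
  rewrite E3 scalerBr -E2 mulmxDr.
  have alg (A B C : vec) : A + B = C + B + A - C by mxlin.
  exact: alg.
apply/matrixP => p q; have := main q; rewrite !mul_col_basis.
by move/matrixP => /(_ p 0); rewrite mxE [RHS]mxE.
Qed.

Definition lie (T : vec -> 'M[R]_4) x : 'M[R]_4 :=
  \sum_k killing_vec x k 0 *: 'D_(e k) T x + (killing_jac x)^T *m T x + T x *m killing_jac x.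

Lemma lie_cov (T : vec -> 'M[R]_4) (N : 'I_4 -> 'M[R]_4) x :
  (forall k, 'D_(e k) T x = (gam k x)^T *m T x + T x *m gam k x + N k) ->
  lie T x = \sum_k killing_vec x k 0 *: N k + ((cov_killing x)^T *m T x + T x *m cov_killing x).
Proof.
move=> dT; rewrite /lie /cov_killing; under eq_bigr do rewrite dT !scalerDr.
rewrite !big_split /= linearD /= mulmxDl mulmxDr.
rewrite linear_sum /= mulmx_suml mulmx_sumr.
under [X in _ = _ + (_ + X + _)]eq_bigr do rewrite linearZ /= -scalemxAl.
under [X in _ = _ + (_ + (_ + X))]eq_bigr do rewrite -scalemxAr.
move: (\sum_k _) (\sum_k _) (\sum_k _) => A B C.
by mxlin.
Qed.

(** Killing's equation: with lowered index, nabla K is -1/2 nabla alpha. *)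
Lemma lie_metric0 x : O x -> nabla_alpha x + (nabla_alpha x)^T = 0 -> lie G x = 0.
Proof.
move=> Ox skew; rewrite (@lie_cov _ (fun _ => 0)); last first.
  by move=> k; rewrite addr0; exact: (gam_compat oO sG G_sym G_gt0 k Ox).
rewrite big1 ?add0r => [|k _]; last by rewrite scaler0.
rewrite -{1}(G_sym Ox) -trmx_mul metric_cov_killing // linearZ /= trmxK -scalerDr skew scaler0 //.
Qed.

(** The form (psi + c *psi) / 2, self-dual for c = 1 and anti-self-dual for
    c = -1. *)
Definition dual_part c x : 'M[R]_4 := 2^-1 *: (P x + c *: hstar (G x) (P x)).

(** The function f_+^2 for c = 1, f_-^2 for c = -1. *)
Definition fsq c x : R := - 4^-1 * \tr (gendo (G x) (dual_part c x) *m gendo (G x) (dual_part c x)).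

Lemma hstar_skew x : O x -> (hstar (G x) (P x))^T = - hstar (G x) (P x).
Proof. by move=> Ox; exact: star_skew (G_sym Ox) _. Qed.

Lemma dual_part_skew c x : O x -> (dual_part c x)^T = - dual_part c x.
Proof. by move=> Ox; rewrite /dual_part linearZ linearD linearZ /= hstar_skew // P_skew //
  scalerN -opprD scalerN. Qed.

Lemma star_dual_part c x : c * c = 1 -> O x -> hstar (G x) (dual_part c x) = c *: dual_part c x.
Proof.
move=> c1 Ox; rewrite starZ starD starZ (starK (G_sym Ox) (G_gt0 Ox) (P_skew Ox)).
rewrite scalerA mulrC -scalerA; congr (_ *: _).
by rewrite scalerDr scalerA c1 scale1r addrC.
Qed.

Lemma dual_part_sum x : dual_part 1 x + dual_part (-1) x = P x.
Proof. by apply/matrixP => i j; rewrite !mxE; field. Qed.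

Lemma dual_part_diff x : dual_part 1 x - dual_part (-1) x = hstar (G x) (P x).
Proof. by apply/matrixP => i j; rewrite !mxE; field. Qed.

Lemma sm_dual_part c : smooth_on O (dual_part c).
Proof.
apply: smZ => //; first exact: (@sm_cst _ _ _ oO R^o).
apply: smD => //; apply: smZ => //; first exact: (@sm_cst _ _ _ oO R^o).
exact: sm_hstar.
Qed.

Lemma sm_fsq c : smooth_on O (fsq c).
Proof.
apply: smM => //; first exact: (@sm_cst _ _ _ oO R^o).
by apply: sm_mxtrace => //; apply: sm_mulmx => //; apply: sm_gendo => //; exact: sm_dual_part.
Qed.

(** The Clifford relation of dual_part with itself. *)
Lemma gendo_dual_part_sq c x : c * c = 1 -> O x ->
  gendo (G x) (dual_part c x) *m gendo (G x) (dual_part c x) = (- fsq c x)%:M.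
Proof.
move=> c1 Ox; have skP := dual_part_skew c Ox.
have [r E] := anticomm (G_sym Ox) (G_gt0 Ox) c1 skP skP (star_dual_part c1 Ox) (star_dual_part
  c1 Ox).
move: E => /half_scalar E.
by rewrite /fsq E mxtrace_scalar -[_ *+ 4]mulr_natl; congr (_%:M); field.
Qed.

(** In Psi Phi = (Psi_+ + Psi_-)(Psi_+ - Psi_-) the mixed terms cancel, as the
    two factors commute. *)
Lemma endo_form_star x : O x -> Psi x *m Phi x = (fsq (-1) x - fsq 1 x)%:M.
Proof.
move=> Ox; rewrite -dual_part_diff -{1}dual_part_sum !endoD endoN mulmxDl !mulmxBr.
have comm : gendo (G x) (dual_part 1 x) *m gendo (G x) (dual_part (-1) x) =
  gendo (G x) (dual_part (-1) x) *m gendo (G x) (dual_part 1 x).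
  apply: (sd_asd_comm (G_sym Ox) (G_gt0 Ox) (dual_part_skew 1 Ox) (dual_part_skew (-1) Ox)).
    by rewrite star_dual_part ?mulr1 ?scale1r.
  by rewrite star_dual_part ?mulrNN ?mulr1 ?scaleN1r.
have alg (A B Z : 'M[R]_4) : A - Z + (Z - B) = A - B by mxlin.
rewrite -comm alg !gendo_dual_part_sq ?mulrNN ?mulr1 //.
by rewrite -rmorphB /= opprK addrC.
Qed.

Lemma mxtrace_wedge (g Q : 'M[R]_4) (X : vec) k : g^T = g -> 0 < \det g -> Q^T = - Q ->
  \tr (gendo g Q *m gendo g (wedge (- 2 *: (X^T *m g)) (row k g))) = - 4 * (Q *m X) k 0.
Proof.
move=> g_sym g_gt0 skQ; have g_unit := metric_unit g_gt0.
have ek : invmx g *m (row k g)^T = e k by rewrite tr_row g_sym colE mulKmx.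
have uE : invmx g *m (- 2 *: (X^T *m g))^T = - 2 *: X.
  by rewrite linearZ /= trmx_mul trmxK g_sym -scalemxAr mulKmx.
have WE : gendo g (wedge (- 2 *: (X^T *m g)) (row k g)) = 2 *: (X *m row k g) - 2 *:
  (e k *m (X^T *m g)).
  rewrite gendoE wedge_skew /wedge opprB mulmxBr !mulmxA ek uE.
  by rewrite -scalemxAr -scalemxAl; mxlin.
have gP : g *m gendo g Q = - Q by rewrite endoT // skQ.
have t1 : \tr (gendo g Q *m (X *m row k g)) = - (Q *m X) k 0.
  rewrite mulmxA mxtrace_mulC /mxtrace big_ord1.
  have -> : row k g *m (gendo g Q *m X) = row k (- (Q *m X))
    by rewrite -mulNmx -gP -mulmxA row_mul.
  by rewrite !mxE.
have t2 : \tr (gendo g Q *m (e k *m (X^T *m g))) = (Q *m X) k 0.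
  rewrite [gendo g Q *m _]mulmxA mxtrace_mulC /mxtrace big_ord1.
  have -> : X^T *m g *m (gendo g Q *m e k) = (row k (Q *m X))^T.
    by rewrite -mulmxA [g *m _]mulmxA gP -skQ tr_row trmx_mul colE mulmxA.
  by rewrite !mxE.
rewrite WE mulmxBr linearB /= -!scalemxAr !linearZ /= t1 t2.
by move: ((Q *m X) k 0) => q; rewrite -[2 *: _]/(2 * _); ring.
Qed.

(** A form of one duality type is orthogonal to those of the other type. *)
Lemma mxtrace_self_dual (g Q W : 'M[R]_4) c : g^T = g -> 0 < \det g -> c * c = 1 ->
  Q^T = - Q -> W^T = - W -> hstar g Q = c *: Q ->
  \tr (gendo g Q *m gendo g (2^-1 *: (W + c *: hstar g W))) = \tr (gendo g Q *m gendo g W).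
Proof.
move=> g_sym g_gt0 c1 skQ skW dQ.
rewrite endoZ endoD endoZ -scalemxAr linearZ /= mulmxDr linearD /= -scalemxAr linearZ /=.
rewrite (mxtrace_endo_star g_sym g_gt0 skQ skW) dQ endoZ -scalemxAl linearZ /= mulrA c1 mul1r.
by move: (\tr _) => t; field.
Qed.

(** The connection terms drop out of the trace, and the covariant derivative of
    psi_c may be replaced by alpha /\ X by orthogonality of the duality types. *)
Lemma isd_fsq c x k : c * c = 1 -> O x ->
  is_derive x (e k) (fsq c) (2 * (dual_part c x *m killing_vec x) k 0).
Proof.
move=> c1 Ox; pose W := wedge (a x) (row k (G x)).
have dG := isd_metric oO sG G_sym G_gt0 k Ox.
have dP : is_derive x (e k) P ((gam k x)^T *m P x + P x *m gam k x + W).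
  by rewrite -SK //; exact: sm_isd.
have skW : W^T = - W by exact: wedge_skew.
have dS := isd_hstar G_sym G_gt0 P_skew Ox skW dG dP.
have dPe : is_derive x (e k) (dual_part c) ((gam k x)^T *m dual_part c x + dual_part c x *m
  gam k x + 2^-1 *: (W + c *: hstar (G x) W)).
  have := isdZ (isd_cst (2^-1 : R^o) x (e k)) (isdD dP (isdZ (isd_cst (c : R^o) x (e k)) dS)).
  congr (is_derive _ _ _ _); rewrite !scale0r !add0r /dual_part -!scalemxAr -!scalemxAl.
  rewrite !(mulmxDr, mulmxDl) -!scalemxAr -!scalemxAl; mxlin.
have dPs := isd_gendo oO sG G_gt0 (fun y Oy => dual_part_skew c Oy) Ox dG dPe.
have := isdM (isd_cst (- 4^-1 : R^o) x (e k)) (isd_mxtrace (isd_mulmx dPs dPs)).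
congr (is_derive _ _ _ _); rewrite mul0r add0r linearD /=.
set D := _ - _ + _.
have C0 (S A N : 'M[R]_4) : \tr (S *m (S *m A - A *m S + N)) = \tr (S *m N).
  have E1 : \tr (S *m (S *m A)) = \tr (S *m (A *m S)).
    by rewrite mulmxA mxtrace_mulC [RHS]mxtrace_mulC mulmxA.
  by rewrite mulmxDr mulmxBr linearD linearB /= E1 subrr add0r.
have T1 : \tr (gendo (G x) (dual_part c x) *m D) = \tr (gendo (G x) (dual_part c x) *m
  gendo (G x) W).
  by rewrite /D C0 (mxtrace_self_dual (G_sym Ox) (G_gt0 Ox) c1 (dual_part_skew c Ox) skW
    (star_dual_part c1 Ox)).
have T2 : \tr (D *m gendo (G x) (dual_part c x)) = \tr (gendo (G x) (dual_part c x) *m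
  D) by rewrite mxtrace_mulC.
rewrite T2 T1 /W alpha_killing_vec // (mxtrace_wedge _ _ (G_sym Ox) (G_gt0 Ox) (dual_part_skew c
  Ox)).
by field.
Qed.

Lemma wedgeE (u v : 'rV[R]_4) i j : wedge u v i j = u 0 i * v 0 j - v 0 i * u 0 j.
Proof. by rewrite /wedge !mxE !big_ord1 !mxE. Qed.

Lemma wedge_killing_vec x j k : O x -> (wedge (a x) (row j (G x)) *m killing_vec x) k 0 =
  - 2^-1 * a x 0 j * a x 0 k - G x j k * (a x *m killing_vec x) 0 0.
Proof.
move=> Ox; rewrite mxE [X in _ - _ * X]mxE.
have E1 : \sum_l G x j l * killing_vec x l 0 = - 2^-1 * a x 0 j.
  by have /matrixP /(_ j 0) := metric_killing_vec Ox; rewrite mxE [RHS]mxE [(a x)^T _ _]mxE.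
transitivity (a x 0 k * (\sum_l G x j l * killing_vec x l 0) - G x j k * (\sum_l a x 0 l *
  killing_vec x l 0)).
  rewrite !mulr_sumr -sumrB; apply: eq_bigr => l _.
  by rewrite wedgeE [row j _ _ l]mxE [row j _ _ k]mxE; ring.
by rewrite E1; move: (\sum_l _) => z; ring.
Qed.

(** The derivative of u = f_+^2 + f_-^2 is 2 psi K. Symmetry of the second
    derivatives of u therefore makes the derivative of psi K symmetric, and the
    terms in nabla psi are symmetric by themselves. *)
Lemma form_cov_killing x : O x -> (cov_killing x)^T *m P x + P x *m cov_killing x = 0.
Proof.
move=> Ox; pose u y := fsq 1 y + fsq (-1) y.
have du y k : O y -> is_derive y (e k) u (2 * (P y *m killing_vec y) k 0).
  move=> Oy; have := isdD (isd_fsq k (mulr1 1) Oy) (isd_fsq k (etrans (mulrNN 1 1) (mulr1 1)) Oy).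
  congr (is_derive _ _ _ _); rewrite -mulrDr; congr (_ * _).
  by rewrite -(dual_part_sum y) mulmxDl [RHS]mxE.
have su : smooth_on O u by apply: smD => //; exact: sm_fsq.
have ddu j k : 'D_(e j) ('D_(e k) u) x = 2 * ('D_(e j) P x *m killing_vec x + P x *m
  'D_(e j) killing_vec x) k 0.
  have h := isd_mulmx (sm_isd (e j) sP Ox) (sm_isd (e j) sm_killing_vec Ox).
  have /isd_mxP /(_ k 0) hk := h.
  have := isdM (isd_cst (2 : R^o) x (e j)) hk; rewrite mul0r add0r => -[_ <-].
  apply: near_eq_derive; apply: (near_open oO Ox) => y Oy.
  by have [_ ->] := du y k Oy.
have key j k : ('D_(e j) P x *m killing_vec x + P x *m 'D_(e j) killing_vec x) k 0 =
   ((gam j x)^T *m (P x *m killing_vec x)) k 0 + (P x *m cov_killing x) k j +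
     (wedge (a x) (row j (G x)) *m killing_vec x) k 0.
  have -> : (P x *m cov_killing x) k j = (P x *m (cov_killing x *m e j)) k 0.
    by rewrite mulmxA mul_col_basis [RHS]mxE.
  rewrite cov_killing_basis // SK // !mulmxDl mulmxDr !mulmxA.
  have alg (A B C D : vec) : (A + B + C + D) k 0 = A k 0 + (D + B) k 0 + C k 0 by rewrite !mxE;
    ring.
  exact: alg.
have gsym j k : ((gam j x)^T *m (P x *m killing_vec x)) k 0 = ((gam k x)^T *m (P x *m
  killing_vec x)) j 0.
  rewrite mxE [RHS]mxE; apply: eq_bigr => l _; rewrite [_^T k l]mxE [_^T j l]mxE.
  by rewrite (gam_torsion oO sG G_sym j k l Ox).
have sym j k : (P x *m cov_killing x) k j = (P x *m cov_killing x) j k.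
  have S := @schwarz R vec O u x (e j) (e k) oO (su 2) Ox.
  have gs : G x k j = G x j k by have /matrixP /(_ j k) := G_sym Ox; rewrite mxE.
  exact: (sym_arith (key j k) (key k j) (etrans (esym (ddu j k)) (etrans S (ddu k j))) (gsym j k)
     (wedge_killing_vec j k Ox) (wedge_killing_vec k j Ox) gs).
have E : (P x *m cov_killing x)^T = P x *m cov_killing x by apply/matrixP => j k; rewrite mxE sym.
by rewrite -E trmx_mul P_skew // mulmxN subrr.
Qed.

(** Here nabla_K psi = alpha /\ K^b vanishes because K is a multiple of alpha^#. *)
Lemma lie_form0 x : O x -> lie P x = 0.
Proof.
move=> Ox; rewrite (@lie_cov _ (fun k => wedge (a x) (row k (G x)))); last by move=> k; exact: SK.
rewrite form_cov_killing // addr0; apply/matrixP => i j; rewrite summxE [RHS]mxE.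
have kG l : \sum_k killing_vec x k 0 * G x k l = - 2^-1 * a x 0 l.
  transitivity (((killing_vec x)^T *m G x) 0 l); last by rewrite killing_vec_metric // mxE.
  by rewrite [RHS]mxE; apply: eq_bigr => k _; rewrite [(killing_vec x)^T _ _]mxE.
transitivity (a x 0 i * (\sum_k killing_vec x k 0 * G x k j) - a x 0 j * (\sum_k killing_vec x k
  0 * G x k i)).
  rewrite !mulr_sumr -sumrB; apply: eq_bigr => k _.
  by rewrite mxE wedgeE [row k _ _ _]mxE [X in _ - X * _]mxE; ring.
by rewrite !kG; ring.
Qed.

(** The Hodge star depends on the metric only, so that L_K g = 0 lets L_K pass
    through it; isd_hstar applies with A the opposite of the
    Jacobian matrix of K. *)
Lemma lie_star0 x : O x -> lie G x = 0 -> lie (fun y => hstar (G y) (P y)) x = 0.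
Proof.
move=> Ox LG; have LP := lie_form0 Ox.
have from (T : vec -> 'M[R]_4) : smooth_on O T -> lie T x = 0 ->
    is_derive x (killing_vec x) T ((- killing_jac x)^T *m T x + T x *m - killing_jac x).
  move=> sT LT; have := dir_deriv (killing_vec x) oO sT Ox.
  congr (is_derive _ _ _ _); rewrite linearN /= mulNmx mulmxN.
  by apply/eqP; rewrite -subr_eq0 opprD !opprK addrA; apply/eqP.
have dG := from _ sG LG.
have dP : is_derive x (killing_vec x) P ((- killing_jac x)^T *m P x + P x *m - killing_jac x + 0).
  by rewrite addr0; exact: from.
have sk0 : (0 : 'M[R]_4)^T = - 0 by rewrite trmx0 oppr0.
have [_ E1] := isd_hstar G_sym G_gt0 P_skew Ox sk0 dG dP.
have [_ E2] := dir_deriv (killing_vec x) oO (sm_hstar oO sG sP G_gt0) Ox.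
rewrite /lie -E2 E1 linearN /= mulNmx mulmxN.
have -> : hstar (G x) 0 = 0 by have := starZ (G x) 0 0; rewrite !scale0r.
have alg (A B : 'M[R]_4) : - A - B + 0 + A + B = 0 by mxlin.
exact: alg.
Qed.

Lemma lie_dual_part0 c x : O x -> lie G x = 0 -> lie (dual_part c) x = 0.
Proof.
move=> Ox LG; have LP := lie_form0 Ox; have LS := lie_star0 Ox LG.
have dPe k : 'D_(e k) (dual_part c) x = 2^-1 *: ('D_(e k) P x + c *:
  'D_(e k) (fun y => hstar (G y) (P y)) x).
  have dP := sm_isd (e k) sP Ox; have dS := sm_isd (e k) (sm_hstar oO sG sP G_gt0) Ox.
  have [_ ->] := isdZ (isd_cst (2^-1 : R^o) x (e k)) (isdD dP (isdZ (isd_cst (c :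
    R^o) x (e k)) dS)).
  by rewrite !scale0r !add0r.
have -> : lie (dual_part c) x = 2^-1 *: (lie P x + c *: lie (fun y => hstar (G y) (P y)) x).
  rewrite /lie; under eq_bigr do rewrite dPe scalerA [_ * 2^-1]mulrC -scalerA scalerDr
    [killing_vec x _ _ *: (c *: _)]scalerA mulrC -scalerA.
  rewrite -scaler_sumr big_split /= -scaler_sumr /dual_part -!scalemxAr -!scalemxAl !(mulmxDl,
    mulmxDr) -!scalemxAr -!scalemxAl.
  move: (\sum_k _) (\sum_k _) => S1 S2.
  by mxlin.
by rewrite LP LS scaler0 addr0 scaler0.
Qed.

End StarKilling.

(** * Determinant of a positive definite matrix *)

Section Posdef.
Variables (R : rcfType) (n : nat).
Implicit Types A : 'M[R]_n.

Definition posdef A := forall v : 'cV[R]_n, v != 0 -> 0 < (v^T *m A *m v) 0 0.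

Lemma posdef_det_neq0 A : posdef A -> \det A != 0.
Proof.
move=> pA; apply/negP => /det0P[v v0 vA].
have := pA v^T; rewrite trmxK vA mul0mx mxE ltxx => H.
by suff: false by []; apply: H; rewrite -(inj_eq (@trmx_inj _ _ _)) trmxK trmx0.
Qed.

Lemma posdef1 : posdef 1%:M.
Proof.
move=> v v0; rewrite mulmx1 mxE lt_def sumr_ge0 ?andbT; last first.
  by move=> i _; rewrite mxE -expr2 sqr_ge0.
apply: contra v0; rewrite psumr_eq0 => [|i _]; last by rewrite mxE -expr2 sqr_ge0.
move=> /allP h; apply/eqP/matrixP => i j; rewrite ord1 [RHS]mxE.
have := h i (mem_index_enum _); rewrite mxE -expr2 sqrf_eq0 => /eqP; exact.
Qed.

Lemma posdef_segment A t : 0 <= t <= 1 -> posdef A -> posdef ((1 - t) *: A + t *: 1%:M).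
Proof.
move=> /andP[t0 t1] pA v v0; have := pA v v0; have := posdef1 v0.
rewrite mulmxDr mulmxDl mulmx1 -!scalemxAr -!scalemxAl mulmx1 [X in _ -> _ ->
  _ < X]mxE [X in _ -> _ -> _ < X + _]mxE [X in _ -> _ -> _ < _ + X]mxE.
move: ((v^T *m v) 0 0) ((v^T *m A *m v) 0 0) => p q p0 q0.
have [->|tn0] := eqVneq t 0; first by rewrite subr0 mul1r mul0r addr0.
apply: ltr_wpDl; last by rewrite mulr_gt0 // lt_def tn0.
by rewrite mulr_ge0 ?subr_ge0 // ltW.
Qed.

(** Along the segment to the identity matrix the forms stay positive definite,
    so the determinant, a polynomial in the parameter, has no zero there. *)
Lemma posdef_det_gt0 A : posdef A -> 0 < \det A.
Proof.
move=> pA; pose M : 'M[{poly R}]_n := map_mx polyC A + 'X *: map_mx polyC (1%:M - A).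
pose p := \det M.
have pE t : p.[t] = \det ((1 - t) *: A + t *: 1%:M).
  rewrite /p -horner_evalE -det_map_mx; congr (\det _); apply/matrixP => i j.
  by rewrite !mxE /= !horner_evalE !hornerE; ring.
have p_neq0 t : 0 <= t <= 1 -> p.[t] != 0.
  by move=> ht; rewrite pE posdef_det_neq0 //; exact: posdef_segment.
have p0 : p.[0] = \det A by rewrite pE subr0 scale1r scale0r addr0.
have p1 : p.[1] = 1 by rewrite pE subrr scale0r add0r scale1r det1.
rewrite -p0 ltNge; apply/negP => h.
have [||t ht] := @poly_ivt _ p 0 1; rewrite ?ler01 // ?p1 ?h ?ler01 //.
rewrite rootE; apply/negP; apply: p_neq0; move: ht; rewrite ?in_itv //=.
Qed.

End Posdef.

(** * Change of coordinates for the Ricci tensor *)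

Section ChainMx.
Variables (R : realType) (V : normedModType R).
Local Notation vec := 'cV[R]_4.

Lemma chain_mx m n (U : set vec) (F : vec -> 'M[R]_(m, n)) (phi : V -> vec) x v dphi :
  open U -> smooth_on U F -> U (phi x) -> is_derive x v phi dphi ->
  is_derive x v (fun y => F (phi y)) (\sum_k dphi k 0 *: 'D_(delta_mx k 0) F (phi x)).
Proof.
move=> oU sF Ux [dp <-]; apply/isd_mxP => i j; rewrite summxE.
have := @chain_rule R 4 V U (fun y => F y i j) phi x v oU (sm_entry oU i j sF 1) Ux dp.
congr (is_derive _ _ _ _); apply: eq_bigr => k _.
have d : derivable F (phi x) (delta_mx k 0) by exact: sm_derivable sF Ux.
by rewrite [RHS]mxE (derive_mx d) [in RHS]mxE.
Qed.
End ChainMx.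

Section JacobianBasics.
Variables (R : realType) (O : set 'cV[R]_4) (phi : 'cV[R]_4 -> 'cV[R]_4).
Hypotheses (oO : open O) (sphi : smooth_on O phi).
Local Notation vec := 'cV[R]_4.
Local Notation e k := (delta_mx k 0 : vec).

Lemma jacE x i j : O x -> jac phi x i j = ('D_(e j) phi x) i 0.
Proof. by move=> Ox; rewrite mxE derive_mx ?mxE //; exact: sm_derivable sphi Ox. Qed.

Lemma sm_jac : smooth_on O (jac phi).
Proof.
apply/sm_mxP => // i j.
apply: (@sm_ext _ _ _ oO _ (fun x => ('D_(e j) phi x) i 0)); first by move=> x Ox; rewrite jacE.
by apply: sm_entry => //; exact: sm_derive.
Qed.

Lemma djac_sym x k l j : O x -> ('D_(e k) (jac phi) x) l j = ('D_(e j) (jac phi) x) l k.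
Proof.
move=> Ox.
have E a b : ('D_(e a) (jac phi) x) l b = ('D_(e a) ('D_(e b) phi) x) l 0.
  have /isd_mxP /(_ l b) [_ <-] := sm_isd (e a) sm_jac Ox.
  have /isd_mxP /(_ l 0) [_ <-] := sm_isd (e a) (sm_derive (e b) sphi) Ox.
  by apply: near_eq_derive; apply: (near_open oO Ox) => y Oy; exact: jacE.
apply: etrans (E k j) _; apply: etrans _ (esym (E j k)).
exact: (congr1 (fun A : vec => A l 0) (schwarz_mx (e k) (e j) oO sphi Ox)).
Qed.

Lemma isd_phi x k : O x -> is_derive x (e k) phi (col k (jac phi x)).
Proof.
move=> Ox; have [dp dE] := sm_isd (e k) sphi Ox; apply: DeriveDef => //.
by apply/matrixP => i p; rewrite ord1 [RHS]mxE jacE.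
Qed.

End JacobianBasics.

(** A change of frame J relates the curvatures of two connections that it
    relates: the second derivatives of J cancel by their symmetry S. *)
Lemma gauge_alg (R : realType) (J Ji Jj gi gj hi hj dgij dgji dhij dhji S : 'M[R]_4) :
  Ji = J *m gi - hi *m J -> Jj = J *m gj - hj *m J ->
  Ji *m gj + J *m dgij = S + (dhij *m J + hj *m Ji) ->
  Jj *m gi + J *m dgji = S + (dhji *m J + hi *m Jj) ->
  J *m (dgij - dgji + gi *m gj - gj *m gi) = (dhij - dhji + hi *m hj - hj *m hi) *m J.
Proof.
move=> Ei Ej E1 E2; apply/eqP; rewrite -subr_eq0; apply/eqP.
transitivity (Ji *m gj + J *m dgij - (S + (dhij *m J + hj *m Ji)) - (Jj *m gi + J *m
  dgji - (S + (dhji *m J + hi *m Jj)))); last first.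
  by rewrite E1 E2 !subrr.
rewrite Ei Ej !(mulmxDl, mulmxDr, mulmxN, mulNmx) !mulmxA; mxlin.
Qed.

(** The curvature of a pulled-back connection is the pull-back of the curvature. *)
Lemma gauge_curv_sum (R : realType) (J : 'M[R]_4) (g : 'I_4 -> 'M[R]_4)
    (dg : 'I_4 -> 'I_4 -> 'M[R]_4) (dJ : 'I_4 -> 'M[R]_4) i j :
  (forall k l j, dJ k l j = dJ j l k) ->
  \sum_n (dJ i n j *: g n + J n j *: \sum_m J m i *: dg m n)
  - \sum_n (dJ j n i *: g n + J n i *: \sum_m J m j *: dg m n)
  + (\sum_n J n i *: g n) *m (\sum_n J n j *: g n)
  - (\sum_n J n j *: g n) *m (\sum_n J n i *: g n)
  = \sum_m \sum_n (J m i * J n j) *: (dg m n - dg n m + g m *m g n - g n *m g m).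
Proof.
move=> sym.
have S1 : \sum_n dJ i n j *: g n = \sum_n dJ j n i *: g n.
  by apply: eq_bigr => n _; rewrite sym.
have S2 k l : \sum_n J n l *: \sum_m J m k *: dg m n = \sum_m \sum_n (J m k * J n l) *: dg m n.
  rewrite exchange_big; apply: eq_bigr => n _; rewrite scaler_sumr; apply: eq_bigr => m _.
  by rewrite scalerA mulrC.
have S3 k l : (\sum_n J n k *: g n) *m (\sum_n J n l *: g n) =
    \sum_m \sum_n (J m k * J n l) *: (g m *m g n).
  rewrite mulmx_suml; apply: eq_bigr => m _; rewrite mulmx_sumr; apply: eq_bigr => n _.
  by rewrite -scalemxAl -scalemxAr scalerA.
have swap (F : 'I_4 -> 'I_4 -> 'M[R]_4) : \sum_m \sum_n (J m j * J n i) *: F m n =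
   \sum_m \sum_n (J m i * J n j) *: F n m.
  by rewrite exchange_big; apply: eq_bigr => m _; apply: eq_bigr => n _; rewrite mulrC.
rewrite !big_split /= S1 !S2 !S3 !swap opprD addrACA subrr add0r -!sumrB -!big_split /=.
rewrite -sumrB; apply: eq_bigr => m _; rewrite -sumrB -big_split -sumrB /=.
by apply: eq_bigr => n _; rewrite !scalerBr scalerDr scalerBr.
Qed.

Lemma ric_contract (R : realType) (J : 'M[R]_4) (K : 'I_4 -> 'I_4 -> 'M[R]_4) j k :
  J \in unitmx ->
  \sum_i (invmx J *m ((\sum_m \sum_n (J m i * J n j) *: K m n) *m J)) i k =
  (J^T *m ric_trace K *m J) j k.
Proof.
move=> Ju.
have E i : (invmx J *m ((\sum_m \sum_n (J m i * J n j) *: K m n) *m J)) i k =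
   \sum_m J m i * (invmx J *m (\sum_n J n j *: K m n) *m J) i k.
  rewrite mulmx_suml mulmx_sumr summxE; apply: eq_bigr => m _.
  have -> : \sum_n (J m i * J n j) *: K m n = J m i *: \sum_n J n j *: K m n.
    by rewrite scaler_sumr; apply: eq_bigr => n _; rewrite scalerA.
  by rewrite -scalemxAl -scalemxAr mxE mulmxA.
under eq_bigr do rewrite E.
rewrite exchange_big /=.
transitivity (\sum_m ((\sum_n J n j *: K m n) *m J) m k).
  apply: eq_bigr => m _.
  transitivity ((J *m (invmx J *m ((\sum_n J n j *: K m n) *m J))) m k).
    by rewrite [RHS]mxE mulmxA.
  by rewrite mulKVmx.
rewrite -mulmxA [RHS]mxE.
transitivity (\sum_m \sum_n J n j * (K m n *m J) m k).
  apply: eq_bigr => m _; rewrite mulmx_suml summxE; apply: eq_bigr => n _.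
  by rewrite -scalemxAl mxE.
rewrite exchange_big; apply: eq_bigr => n _ /=; rewrite [J^T _ _]mxE -mulr_sumr; congr (_ * _).
rewrite [RHS]mxE; under [RHS]eq_bigr do rewrite [ric_trace _ _ _]mxE mulr_suml.
rewrite exchange_big; apply: eq_bigr => m _ /=.
by rewrite mxE.
Qed.

Section RicciTensor.
Variables (R : realType) (O1 O2 : set 'cV[R]_4) (phi : 'cV[R]_4 -> 'cV[R]_4).
Variables (G1 G2 : 'cV[R]_4 -> 'M[R]_4).
Hypotheses (oO1 : open O1) (oO2 : open O2) (sphi : smooth_on O1 phi)
  (phiO : forall x, O1 x -> O2 (phi x)).
Hypotheses (sG1 : smooth_on O1 G1) (G1_sym : forall x, O1 x -> (G1 x)^T = G1 x)
  (G1_gt0 : forall x, O1 x -> 0 < \det (G1 x)).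
Hypotheses (sG2 : smooth_on O2 G2) (G2_sym : forall x, O2 x -> (G2 x)^T = G2 x)
  (G2_gt0 : forall x, O2 x -> 0 < \det (G2 x)).
Local Notation vec := 'cV[R]_4.
Local Notation e k := (delta_mx k 0 : vec).
Local Notation J := (jac phi).
Hypothesis J_unit : forall x, O1 x -> J x \in unitmx.
Hypothesis G12 : forall x, O1 x -> G1 x = (J x)^T *m G2 (phi x) *m J x.

Let H k x : 'M[R]_4 := \sum_n J x n k *: local_gam G2 n (phi x).

Lemma isd_comp m n (F : vec -> 'M[R]_(m, n)) x k : smooth_on O2 F -> O1 x ->
  is_derive x (e k) (fun y => F (phi y)) (\sum_m J x m k *: 'D_(e m) F (phi x)).
Proof.
move=> sF Ox; have := chain_mx oO2 sF (phiO Ox) (isd_phi sphi k Ox).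
by congr (is_derive _ _ _ _); apply: eq_bigr => l _; rewrite [col _ _ _ _]mxE.
Qed.

(** The connection transported by the change of coordinates is metric and
    torsion-free, so it is the Levi-Civita connection of the pulled-back metric. *)
Lemma gauge_gam x k : O1 x -> J x *m local_gam G1 k x = 'D_(e k) J x + H k x *m J x.
Proof.
move=> Ox; have Jx := J_unit Ox.
(* The transported connection. *)
pose C k := invmx (J x) *m ('D_(e k) J x + H k x *m J x).
have CE i : J x *m C i = 'D_(e i) J x + H i x *m J x by rewrite /C mulKVmx.
suff <- : C k = local_gam G1 k x by [].
have C_def i l j : C i l j = \sum_p invmx (J x) l p * ('D_(e i) J x + H i x *m
  J x) p j by rewrite mxE.
clearbody C; have U := @gam_unique R O1 G1 G1_sym G1_gt0 x C Ox.
apply: U => {k} [k|k j l].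
- have dJ := sm_isd (e k) (sm_jac oO1 sphi) Ox.
  have dG2 := isd_comp k sG2 Ox.
  have [_ E] := isd_near oO1 Ox (fun y Oy => esym (G12 Oy)) (isd_mulmx (isd_mulmx (isd_tr dJ)
    dG2) dJ).
  rewrite E G12 //.
  have -> : (C k)^T *m ((J x)^T *m G2 (phi x) *m J x) = (J x *m C k)^T *m G2 (phi x) *m J x.
    by rewrite trmx_mul !mulmxA.
  rewrite -[(J x)^T *m G2 (phi x) *m J x *m C k]mulmxA CE.
  have -> : \sum_m J x m k *: 'D_(e m) G2 (phi x) = (H k x)^T *m G2 (phi x) + G2 (phi x) *m H k x.
    rewrite /H linear_sum /= mulmx_suml mulmx_sumr -big_split /=; apply: eq_bigr => m _.
    rewrite (gam_compat oO2 sG2 G2_sym G2_gt0 m (phiO Ox)) scalerDr.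
    by rewrite linearZ /= -scalemxAl -scalemxAr.
  move: ('D_(e k) J x) (H k x) (J x) (G2 (phi x)) => D h j g.
  have -> : (D + h *m j)^T = D^T + j^T *m h^T by rewrite linearD /= trmx_mul.
  rewrite !(mulmxDl, mulmxDr) !mulmxA; mxlin.
- rewrite !C_def; apply: eq_bigr => p _; congr (_ * _).
  have addE (A B : 'M[R]_4) a b : (A + B) a b = A a b + B a b by rewrite mxE.
  apply: etrans (addE _ _ _ _) _; apply: etrans _ (esym (addE _ _ _ _)).
  apply: (f_equal2 +%R (djac_sym oO1 sphi k p j Ox)).
  have HE a b : (H a x *m J x) p b = \sum_n \sum_i J x n a * (local_gam G2 n (phi x) p i * J x i b).
    rewrite /H mulmx_suml summxE; apply: eq_bigr => n _.
    by rewrite -scalemxAl mxE [(_ *m _) _ _]mxE mulr_sumr.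
  rewrite !HE exchange_big; apply: eq_bigr => n _ /=; apply: eq_bigr => i _.
  by rewrite (gam_torsion oO2 sG2 G2_sym i n p (phiO Ox)); ring.
Qed.

Lemma gauge_curv x i j : O1 x ->
  J x *m local_curv G1 i j x =
  (\sum_m \sum_n (J x m i * J x n j) *: local_curv G2 m n (phi x)) *m J x.
Proof.
move=> Ox.
pose dH k l : 'M[R]_4 := \sum_n ('D_(e k) J x n l *: local_gam G2 n (phi x)
  + J x n l *: \sum_m J x m k *: 'D_(e m) (local_gam G2 n) (phi x)).
have sg2 n := sm_gam oO2 sG2 G2_gt0 n.
have dJ k := sm_isd (e k) (sm_jac oO1 sphi) Ox.
have hH k l : is_derive x (e k) (H l) (dH k l).
  apply: isd_sum => n; apply: isdZ; last exact: isd_comp.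
  by move/isd_mxP: (dJ k); apply.
have main k l : 'D_(e k) J x *m local_gam G1 l x + J x *m 'D_(e k) (local_gam G1 l) x =
   'D_(e k) ('D_(e l) J) x + (dH k l *m J x + H l x *m 'D_(e k) J x).
  have dg := sm_isd (e k) (sm_gam oO1 sG1 G1_gt0 l) Ox.
  have ddJ := sm_isd (e k) (sm_derive (e l) (sm_jac oO1 sphi)) Ox.
  have [_ E1] := isd_mulmx (dJ k) dg.
  have [_ E2] := isd_near oO1 Ox (fun y Oy => esym (gauge_gam l Oy)) (isdD ddJ (isd_mulmx (hH k
    l) (dJ k))).
  by rewrite -E1 -E2.
have JE k : 'D_(e k) J x = J x *m local_gam G1 k x - H k x *m J x by rewrite gauge_gam // addrK.
have m2 := main j i; rewrite (schwarz_mx (e j) (e i) oO1 (sm_jac oO1 sphi) Ox) in m2.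
rewrite /local_curv (gauge_alg (JE i) (JE j) (main i j) m2); congr (_ *m _).
exact: (@gauge_curv_sum R (J x) (fun n => local_gam G2 n (phi x))
  (fun m n => 'D_(e m) (local_gam G2 n) (phi x)) (fun k => 'D_(e k) J x) i j
  (fun k l j => djac_sym oO1 sphi k l j Ox)).
Qed.

Lemma ric_tensor x : O1 x -> local_ric G1 x = (J x)^T *m local_ric G2 (phi x) *m J x.
Proof.
move=> Ox; have Jx := J_unit Ox; apply/matrixP => j k.
have curvE i : local_curv G1 i j x = invmx (J x) *m ((\sum_m \sum_n (J x m i * J x n j) *:
  local_curv G2 m n (phi x)) *m J x).
  by rewrite -gauge_curv // mulKmx.
rewrite [LHS]mxE; under eq_bigr do rewrite curvE.
exact: (ric_contract (fun m n => local_curv G2 m n (phi x)) j k Jx).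
Qed.

End RicciTensor.

(** * Flows *)

Section Partial.
Variables (R : realType) (V W : normedModType R).

Lemma is_derive_fst (f : R^o * V -> W) (t : R^o) (x : V) df :
  is_derive (t, x) (1 : R^o, 0 : V) f df <-> is_derive t (1 : R^o) (fun s : R^o => f (s, x)) df.
Proof.
have E : (fun h : R => h^-1 *: ((f \o shift (t, x)) (h *: (1 : R^o, 0 : V)) - f (t, x)))
   = (fun h : R => h^-1 *: (((fun s : R^o => f (s, x)) \o shift t) (h *: (1 : R^o)) - f (t, x))).
  apply/funext => h /=; congr (_ *: (f _ - _)).
  by rewrite /GRing.scale /= /scale_pair /= scaler0 /GRing.add /= /add_pair /= add0r.
split=> -[d <-]; apply: DeriveDef; rewrite /derivable /derive /= in d *.
- by rewrite -E.
- by rewrite -E.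
- by rewrite E.
- by rewrite E.
Qed.

Lemma is_derive_snd (f : R^o * V -> W) (t : R^o) (x v : V) df :
  is_derive (t, x) (0 : R^o, v) f df <-> is_derive x v (fun y => f (t, y)) df.
Proof.
have E : (fun h : R => h^-1 *: ((f \o shift (t, x)) (h *: (0 : R^o, v)) - f (t, x)))
   = (fun h : R => h^-1 *: (((fun y => f (t, y)) \o shift x) (h *: v) - f (t, x))).
  apply/funext => h /=; congr (_ *: (f _ - _)).
  by rewrite /GRing.scale /= /scale_pair /= scaler0 /GRing.add /= /add_pair /= add0r.
split=> -[d <-]; apply: DeriveDef; rewrite /derivable /derive /= in d *.
- by rewrite -E.
- by rewrite -E.
- by rewrite E.
- by rewrite E.
Qed.

End Partial.

Section Charts.
Variables (R : realType) (M : oriented_manifold4 R).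
Implicit Types (c d : chart M) (p : M) (A S : set M).
Local Notation vec := 'cV[R]_4.
Local Notation e k := (delta_mx k 0 : vec).

Definition img c A : set vec := coord c @` (chart_dom c `&` A).

Lemma img_coordV c A x : img c A x -> chart_dom c (coordV c x) /\ A (coordV c x).
Proof. by move=> [p [dp Ap] <-]; rewrite coordK. Qed.

Lemma coordVK c A x : img c A x -> coord c (coordV c x) = x.
Proof. by move=> [p [dp Ap] <-]; rewrite coordK. Qed.

Lemma img_mem c A p : chart_dom c p -> A p -> img c A (coord c p).
Proof. by move=> dp Ap; exists p. Qed.

Lemma img_sub c A B : A `<=` B -> img c A `<=` img c B.
Proof. by move=> AB x [p [dp Ap] <-]; exists p => //; split => //; exact: AB. Qed.

Lemma img_open c A : open A -> open (img c A).
Proof.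
move=> oA; rewrite openE => x [p [dp Ap] <-]; rewrite /interior.
have Ox : (coord c @` chart_dom c) (coord c p) by exists p.
have N1 : \forall y \near coord c p, (coord c @` chart_dom c) y.
  by apply: open_nbhs_nbhs; split => //; exact: coord_img_open.
have N2 : \forall y \near coord c p, A (coordV c y).
  apply: (coordV_cont Ox); apply: open_nbhs_nbhs; split => //; by rewrite coordK.
apply: filterS2 N1 N2 => y [q dq <-]; rewrite coordK // => Aq.
by exists q.
Qed.

Lemma sm_transition c d : smooth_on (img c (chart_dom d)) (coord d \o coordV c).
Proof. exact: transition_smooth. Qed.

Lemma transition_unit c d p : chart_dom c p -> chart_dom d p -> transition_jac c d p \in unitmx.
Proof.
by move=> cp dp; rewrite unitmxE unitfE gt_eqF // /transition_jac transition_oriented.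
Qed.

End Charts.

Section Flow.
Variables (R : realType) (M : oriented_manifold4 R) (S : set M) (X : vfield M) (T : matfield M).
Local Notation vec := 'cV[R]_4.
Local Notation e k := (delta_mx k 0 : vec).
Hypothesis oS : forall d : chart M, open (img d S).
Hypothesis sX : smooth_comp S X.
Hypothesis sT : smooth_comp S T.
Hypothesis T_law : tensor02_law T.
Hypothesis lieT : forall (d : chart M) y, img d S y ->
  \sum_k (X d (coordV d y)) k 0 *: 'D_(e k) (T d \o coordV d) y
  + (jac (X d \o coordV d) y)^T *m T d (coordV d y)
  + T d (coordV d y) *m jac (X d \o coordV d) y = 0.

Variables (U : set M) (a b : R) (Phi : R -> M -> M).
Hypothesis F : local_flow S X U a b Phi.
Variables (p : M) (c : chart M).
Hypotheses (Up : U p) (cp : chart_dom c p).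
Let x0 := coord c p.

(** The domain of the flow read in the charts c and d. *)
Definition flow_dom_c d : set (R^o * vec) :=
    [set z : R^o * vec | [/\ a < (z.1 : R) < b,
       (coord c @` (chart_dom c `&` U)) z.2
       & chart_dom d (Phi z.1 (coordV c z.2))]].

Let G d (z : R^o * vec) : vec := coord d (Phi z.1 (coordV c z.2)).

Lemma flow_dom_open d : open (flow_dom_c d).
Proof.
rewrite openE => -[t x] [/= tab Ux dx]; rewrite /interior.
have [Ux1 Ux2] := img_coordV Ux.
have FF : Filter (nbhs ((t, x) : R^o * vec)) by exact: nbhs_filter.
have N1 : \forall z \near (t, x), a < (z.1 : R) < b.
  have h : \forall s \near t, a < (s : R) < b.
    have := near_in_itvoo (x := t) (a := a) (b := b); rewrite in_itv /= => /(_ tab).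
    by apply: filterS => s; rewrite in_itv.
  exact: (@cvg_fst _ _ (nbhs t) (nbhs x) _ _ h).
have N2 : \forall z \near (t, x), img c U z.2.
  have h : \forall y \near x, img c U y.
    by apply: open_nbhs_nbhs; split => //; apply: img_open; exact: flow_open F.
  exact: (@cvg_snd _ _ (nbhs t) (nbhs x) _ _ h).
have N3 : \forall z \near (t, x), chart_dom d (Phi z.1 (coordV c z.2)).
  have cV : {for x, continuous (coordV c)} by apply: coordV_cont; have [q [cq _] <-] := Ux;
    exists q.
  have cF := flow_cont F tab Ux2.
  have N : \forall w \near (t, coordV c x), chart_dom d (Phi w.1 w.2).
    by apply: cF; apply: open_nbhs_nbhs; split => //; exact: chart_dom_open.
  have [[A B] [/= hA hB] AB] := N.
  have hB' : \forall y \near x, B (coordV c y) by exact: cV hB.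
  have NA : \forall z \near ((t, x) : R^o * vec), A z.1 by exact:
    (@cvg_fst _ _ (nbhs t) (nbhs x) _ A hA).
  have NB : \forall z \near ((t, x) : R^o * vec), B (coordV c z.2).
    exact: (@cvg_snd _ _ (nbhs t) (nbhs x) _ _ hB').
  apply: (@filterS2 _ _ FF _ _ _ _ NA NB) => z zA zB; exact: (AB (z.1, coordV c z.2)).
apply: (@filterS3 _ _ FF _ _ _ _ _ N1 N2 N3) => z z1 z2 z3; by split.
Qed.

Lemma sm_flow d : smooth_on (flow_dom_c d) (G d).
Proof. exact: (flow_smooth F c d). Qed.

Lemma flow_dom_x0 d t : a < t < b -> chart_dom d (Phi t p) -> flow_dom_c d (t, x0).
Proof.
by move=> tab dp; split => //=; [exact: img_mem | rewrite /x0 coordK].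
Qed.

Lemma flow_img d z : flow_dom_c d z -> img d S (G d z).
Proof.
case: z => t x [/= tab Ux dx]; apply: img_mem => //; apply: (flow_in F tab).
by have [] := img_coordV Ux.
Qed.

Let Y d y := X d (coordV d y).

Lemma flow_time d z : flow_dom_c d z -> is_derive z (1 : R^o, 0 : vec) (G d) (Y d (G d z)).
Proof.
case: z => t x [/= tab Ux dx]; apply/is_derive_fst.
have [cx Ux2] := img_coordV Ux.
by have := flow_integral F tab Ux2 dx; rewrite /Y /G /= coordK.
Qed.

Lemma diff_mxE d t j i : flow_dom_c d (t, x0) ->
  diff_mx (Phi t) c d p i j = ('D_(0 : R^o, e j) (G d) (t, x0)) i 0.
Proof.
move=> W; rewrite mxE.
have h := sm_isd (0 : R^o, e j) (sm_flow d) W.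
by move/is_derive_snd: h => /isd_mxP /(_ i 0) [_ <-].
Qed.

(** The variational equation of the flow, from exchanging the derivative in time
    with those in space. *)
Lemma isd_diff_mx d t : flow_dom_c d (t, x0) ->
  is_derive t (1 : R^o) (fun s : R^o => diff_mx (Phi s) c d p) (jac (X d \o coordV d) (G d (t,
    x0)) *m diff_mx (Phi t) c d p).
Proof.
move=> W; apply/isd_mxP => i j.
have oW : open (flow_dom_c d) by exact: flow_dom_open.
have sG : smooth_on (flow_dom_c d) (G d) by exact: sm_flow.
have sY : smooth_on (img d S) (Y d) by exact: sX.
have oSd : open (img d S) by exact: oS.
have h1 : is_derive (t, x0) (1 : R^o, 0 : vec) ('D_(0 : R^o, e j) (G d)) ('D_(1 : R^o, 0 :
  vec) ('D_(0 : R^o, e j) (G d)) (t, x0)).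
  exact: (sm_isd _ (sm_derive (0 : R^o, e j) sG) W).
have E : 'D_(1 : R^o, 0 : vec) ('D_(0 : R^o, e j) (G d)) (t, x0) =
    \sum_k ('D_(0 : R^o, e j) (G d) (t, x0)) k 0 *: 'D_(e k) (Y d) (G d (t, x0)).
  rewrite (schwarz_mx _ _ oW sG W).
  have dG := sm_isd (0 : R^o, e j) sG W.
  have := chain_mx oSd sY (flow_img W) dG => h2.
  have [_ <-] := h2.
  apply: near_eq_derive; apply: (near_open oW W) => z Wz.
  by have [_ ->] := flow_time Wz.
rewrite E in h1; move/is_derive_fst: h1 => /isd_mxP /(_ i 0) h1.
have -> : (jac (X d \o coordV d) (G d (t, x0)) *m diff_mx (Phi t) c d p) i j =
   (\sum_k ('D_(0 : R^o, e j) (G d) (t, x0)) k 0 *: 'D_(e k) (Y d) (G d (t, x0))) i 0.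
  rewrite mxE summxE; apply: eq_bigr => k _; rewrite [RHS]mxE mulrC (diff_mxE _ _ W).
  by rewrite (jacE sY _ _ (flow_img W)).
apply: (near_eq_is_derive _ h1).
have N : \forall s \near (t : R^o), flow_dom_c d (s, x0).
  have : \forall z \near (t, x0), flow_dom_c d z by exact: open_nbhs_nbhs.
  move=> [[A B] [/= hA hB] AB].
  by apply: filterS hA => s As; apply: (AB (s, x0)); split => //=; exact: nbhs_singleton hB.
by apply: filterS N => s Ws; rewrite -(diff_mxE _ _ Ws).
Qed.

Lemma near_flow_dom d (t : R^o) : flow_dom_c d (t, x0) -> \forall s \near (t :
  R^o), flow_dom_c d (s, x0).
Proof.
move=> W; have oW : open (flow_dom_c d) by exact: flow_dom_open.
have : \forall z \near (t, x0), flow_dom_c d z by exact: open_nbhs_nbhs.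
move=> [[A B] [/= hA hB] AB].
by apply: filterS hA => s As; apply: (AB (s, x0)); split => //=; exact: nbhs_singleton hB.
Qed.

Lemma flow_dom_p d t : flow_dom_c d (t, x0) ->
  [/\ a < t < b, chart_dom d (Phi t p) & G d (t, x0) = coord d (Phi t p)].
Proof. by move=> [/= tab _]; rewrite /G /= /x0 coordK. Qed.

(** The tensor T at the point reached at time t, pulled back to the initial
    point. *)
Definition pullback d t : 'M[R]_4 :=
  (diff_mx (Phi t) c d p)^T *m T d (Phi t p) *m diff_mx (Phi t) c d p.

(** By the variational equation, the derivative of the pull-back is the
    pull-back of the Lie derivative. *)
Lemma isd_pullback d (t : R^o) : flow_dom_c d (t, x0) -> is_derive t (1 : R^o) (pullback d :
  R^o -> 'M[R]_4) 0.
Proof.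
move=> W; have dD := isd_diff_mx W.
have [tab dp Gp] := flow_dom_p W.
have oSd : open (img d S) by exact: oS.
have sTd : smooth_on (img d S) (T d \o coordV d) by exact: sT.
have yS : img d S (coord d (Phi t p)) by rewrite -Gp; exact: flow_img W.
have dy := flow_integral F tab Up dp.
have dT := chain_mx oSd sTd yS dy.
have {}dT : is_derive t (1 : R^o) (fun s : R^o => T d (Phi s p))
   (\sum_k (X d (Phi t p)) k 0 *: 'D_(e k) (T d \o coordV d) (coord d (Phi t p))).
  apply: (near_eq_is_derive _ dT); apply: filterS (near_flow_dom W) => s Ws /=.
  by have [_ ds _] := flow_dom_p Ws; rewrite coordK.
have := isd_mulmx (isd_mulmx (isd_tr dD) dT) dD.
congr (is_derive _ _ _ _).
have := lieT yS; rewrite coordK // Gp.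
move: (\sum_k _) (jac _ _) (diff_mx _ _ _ _) (T _ _) => L K D B E.
transitivity (D^T *m (L + K^T *m B + B *m K) *m D); last by rewrite E mulmx0 mul0mx.
rewrite trmx_mul !(mulmxDr, mulmxDl) !mulmxA; mxlin.
Qed.

Lemma diff_mx_change d d' t : flow_dom_c d (t, x0) -> chart_dom d' (Phi t p) ->
  diff_mx (Phi t) c d' p = transition_jac d d' (Phi t p) *m diff_mx (Phi t) c d p.
Proof.
move=> W dp'; have [tab dp Gp] := flow_dom_p W.
have W' : flow_dom_c d' (t, x0) by exact: flow_dom_x0.
have od' : open (img d (chart_dom d')) by apply: img_open; exact: chart_dom_open.
have sd' := sm_transition d d'.
apply/matrixP => i j.
have yS : img d (chart_dom d') (G d (t, x0)) by rewrite Gp; exact: img_mem.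
have sG : smooth_on (flow_dom_c d) (G d) by exact: sm_flow.
have h1 := chain_mx od' sd' yS (sm_isd (0 : R^o, e j) sG W).
have oW : open (flow_dom_c d) by exact: flow_dom_open.
have oW' : open (flow_dom_c d') by exact: flow_dom_open.
have E : 'D_(0 : R^o, e j) (G d') (t, x0) = \sum_k ('D_(0 : R^o, e j) (G d) (t, x0)) k 0 *:
  'D_(e k) (coord d' \o coordV d) (G d (t, x0)).
  have [_ <-] := h1; apply: near_eq_derive; apply: (near_open oW W) => -[s y] [/= sab Uy dy].
  by rewrite /G /= coordK.
rewrite (diff_mxE _ _ W') E summxE mxE; apply: eq_bigr => k _.
rewrite [LHS]mxE mulrC (diff_mxE _ _ W) /transition_jac -Gp.
by rewrite (jacE sd' _ _ yS).
Qed.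

Lemma pullback_change d d' t : a < t < b -> chart_dom d (Phi t p) -> chart_dom d' (Phi t p) ->
  pullback d t = pullback d' t.
Proof.
move=> tab dp dp'; have W := flow_dom_x0 tab dp.
rewrite /pullback (diff_mx_change W dp') trmx_mul (T_law dp dp') !mulmxA.
by [].
Qed.

(** An integral curve may leave a chart: the pull-back is constant in time
    because it does not depend on the chart in which it is computed. *)
Lemma pullback_flow d t : a < t < b -> chart_dom d (Phi t p) -> pullback d t = T c p.
Proof.
move=> tab dp; have [a0 b0] := flow_times F.
have t0 : a < 0 < b by rewrite a0.
(* Globally defined in time, with a chart that varies along the curve. *)
pose Q s := pullback (chart_at (Phi s p)) s.
have dQ (s : R^o) : a < s < b -> is_derive s (1 : R^o) (Q : R^o -> 'M[R]_4) 0.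
  move=> sab; have W := flow_dom_x0 sab (chart_at_dom (Phi s p)).
  apply: (near_eq_is_derive _ (isd_pullback W)).
  apply: filterS (near_flow_dom W) => u Wu; have [uab du _] := flow_dom_p Wu.
  by apply: pullback_change => //; exact: chart_at_dom.
have QE : Q t = Q 0.
  apply/matrixP => i j; apply: (@const_of_deriv0 R (fun s => Q s i j) a b) => // s sab.
  by have /isd_mxP /(_ i j) := dQ s sab; rewrite mxE.
have p0 : Phi 0 p = p by exact: flow0 F _ Up.
have c0 : chart_dom c (Phi 0 p) by rewrite p0.
rewrite (pullback_change tab dp (chart_at_dom _)) -/(Q t) QE /Q.
rewrite (pullback_change t0 (chart_at_dom _) c0) /pullback.
have -> : diff_mx (Phi 0) c c p = 1%:M.
  have W : flow_dom_c c (0, x0) by exact: flow_dom_x0.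
  apply/matrixP => i j; rewrite mxE.
  have oU : open (img c U) by apply: img_open; exact: flow_open F.
  have Ux : img c U (coord c p) by exact: img_mem.
  have h : is_derive (coord c p) (e j) (fun y : vec => y i 0) ((e j) i 0).
    by have /isd_mxP /(_ i 0) := @is_derive_id R vec (coord c p) (e j).
  have idE y : img c U y -> y i 0 = (coord c \o Phi 0 \o coordV c) y i 0.
    move=> Uy /=; have [cy Uy'] := img_coordV Uy.
    by rewrite (flow0 F Uy') (coordVK Uy).
  have h' := @isd_near R vec R^o (img c U) (fun y => y i 0) (fun y => (coord c \o Phi 0 \o
    coordV c) y i 0) (coord c p) (e j) _ oU Ux idE h.
  have [_ ->] := h'.
  by rewrite !mxE eqxx andbT.
by rewrite trmx1 mul1mx mulmx1 p0.
Qed.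

End Flow.

(** The hypothesis is the vanishing of the Lie derivative of T along X. *)
Lemma flow_preserves_lie (R : realType) (M : oriented_manifold4 R) (S : set M) (X :
  vfield M) (T : matfield M) :
  (forall d : chart M, open (img d S)) -> smooth_comp S X -> smooth_comp S T -> tensor02_law T ->
  (forall (d : chart M) y, img d S y ->
    \sum_k (X d (coordV d y)) k 0 *: 'D_(delta_mx k 0) (T d \o coordV d) y
    + (jac (X d \o coordV d) y)^T *m T d (coordV d y)
    + T d (coordV d y) *m jac (X d \o coordV d) y = 0) ->
  flow_preserves02 S X T.
Proof.
move=> oS sX sT TL lT U a b Phi F t p c d tab Up cp dp.
exact: (pullback_flow oS sX sT TL lT F Up cp tab dp).
Qed.

(** * Fields on the manifold read in a chart *)

Lemma sm_sub (R : realType) (V W : normedModType R) (U U' : set V) (f : V -> W) :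
  U' `<=` U -> smooth_on U f -> smooth_on U' f.
Proof.
move=> UU sf k; have := sf k; elim: k f {sf} => [|k IH] f [cf df].
  by split=> // x /UU; exact: cf.
split=> [x /UU|v]; first exact: cf.
have [dv Cv] := df v; split=> [x /UU|]; [exact: dv | exact: IH].
Qed.

Lemma gendo_congr (R : rcfType) (g P J : 'M[R]_4) : g \in unitmx -> J \in unitmx ->
  gendo (J^T *m g *m J) (J^T *m P *m J) = invmx J *m gendo g P *m J.
Proof.
move=> gu Ju; rewrite !gendoE.
have Jtu : J^T \in unitmx by rewrite unitmx_tr.
have gJu : J^T *m g *m J \in unitmx by rewrite !unitmx_mul Jtu gu Ju.
rewrite -[RHS](mulKmx gJu); congr (_ *m _).
by rewrite !trmx_mul trmxK !mulmxA mulmxK // mulmxK.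
Qed.

Lemma mxtrace_conj (R : realType) (J A : 'M[R]_4) : J \in unitmx -> \tr (invmx J *m A *m J) = \tr A.
Proof. by move=> Ju; rewrite mxtrace_mulC mulmxA mulmxV // mul1mx. Qed.

Section ChartFields.
Variables (R : realType) (M : oriented_manifold4 R) (g : metric M) (psi : two_form M) (alpha :
  one_form M).
Hypothesis SK : star_killing_with g psi alpha.
Implicit Types (c d : chart M) (p : M).
Local Notation vec := 'cV[R]_4.
Local Notation e k := (delta_mx k 0 : vec).
Local Notation O c := (img c setT).
Local Notation G c := (g c \o coordV c).
Local Notation P c := (psi c \o coordV c).
Local Notation A c := (alpha c \o coordV c).

Lemma img_open_setT c : open (O c).
Proof. by apply: img_open; exact: openT. Qed.

Lemma img_chart_dom c x : O c x -> chart_dom c (coordV c x).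
Proof. by move=> /img_coordV []. Qed.

Lemma coord_img c p : chart_dom c p -> O c (coord c p).
Proof. by move=> cp; exact: img_mem. Qed.

Lemma metric_det_gt0 c p : chart_dom c p -> 0 < \det (g c p).
Proof. by move=> cp; apply: posdef_det_gt0 => v v0; exact: metric_pos. Qed.

Lemma sm_metric_chart c : smooth_on (O c) (G c). Proof. exact: metric_smooth. Qed.
Lemma sm_form_chart c : smooth_on (O c) (P c). Proof. exact: two_form_smooth. Qed.
Lemma sm_alpha_chart c : smooth_on (O c) (A c). Proof. exact: one_form_smooth. Qed.
Lemma metric_chart_sym c x : O c x -> (G c x)^T = G c x.
Proof. by move=> /img_chart_dom; exact: metric_sym. Qed.
Lemma metric_chart_gt0 c x : O c x -> 0 < \det (G c x).
Proof. by move=> /img_chart_dom; exact: metric_det_gt0. Qed.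
Lemma form_chart_skew c x : O c x -> (P c x)^T = - P c x.
Proof. by move=> /img_chart_dom; exact: two_form_skew. Qed.

Lemma pd_mx m n c k (F : chart M -> M -> 'M[R]_(m, n)) i j S x :
  smooth_on (img c S) (F c \o coordV c) -> img c S x ->
  pd c k (fun q => F c q i j) (coordV c x) = ('D_(e k) (F c \o coordV c) x) i j.
Proof.
move=> sF Ox; rewrite /pd (coordVK Ox) /=.
by have /isd_mxP /(_ i j) [_ ->] := sm_isd (e k) sF Ox.
Qed.

Lemma christoffelE c x k l j : O c x ->
  christoffel g c (coordV c x) l k j = local_gam (G c) k x l j.
Proof.
move=> Ox; rewrite /christoffel local_gamE mxE mulr_sumr; apply: eq_bigr => m _.
rewrite !(pd_mx _ _ _ (@sm_metric_chart c) Ox) [koszul _ _ _ _]mxE mulrCA; congr (_ * _).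
Qed.

Lemma nablaE c x k (T : matfield M) : smooth_on (O c) (T c \o coordV c) -> O c x ->
  nabla02 g T c (coordV c x) (e k) = 'D_(e k) (T c \o coordV c) x
   - ((local_gam (G c) k x)^T *m T c (coordV c x) + T c (coordV c x) *m local_gam (G c) k x).
Proof.
move=> sT Ox; apply/matrixP => i j; rewrite mxE.
have eE (k' : 'I_4) : (e k) k' 0 = (k' == k)%:R by rewrite mxE eqxx andbT.
rewrite (bigD1 k) //= eE eqxx mul1r [X in _ + X]big1 ?addr0 => [|k' ne]; last first.
  by rewrite eE (negbTE ne) mul0r.
rewrite (pd_mx _ _ _ sT Ox) [RHS]mxE; congr (_ + _).
rewrite [RHS]mxE; congr (- _); rewrite big_split /= [RHS]mxE [(_ *m _) i j]mxE [X in _ = _ + X]mxE.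
congr (_ + _); apply: eq_bigr => l _; rewrite christoffelE //; first by rewrite [_^T _ _]mxE.
by rewrite mulrC.
Qed.

Lemma SK_local c x k : O c x ->
  'D_(e k) (P c) x = (local_gam (G c) k x)^T *m P c x + P c x *m local_gam (G c) k x
     + wedge (A c x) (row k (G c x)).
Proof.
move=> Ox; have := SK (e k) (img_chart_dom Ox); rewrite (nablaE _ (@sm_form_chart c) Ox) => /eqP.
rewrite subr_eq => /eqP ->; rewrite addrC; congr (_ + wedge _ _).
by rewrite /flat trmx_delta -rowE.
Qed.

Lemma curvatureE c x l k i j : O c x ->
  curvature g c (coordV c x) l k i j = local_curv (G c) i j x l k.
Proof.
move=> Ox; have oO := @img_open_setT c.
have dch a b : pd c a (fun q => christoffel g c q l b k) (coordV c x) =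
  ('D_(e a) (local_gam (G c) b) x) l k.
  rewrite /pd (coordVK Ox).
  have sg := sm_gam oO (@sm_metric_chart c) (@metric_chart_gt0 c) b.
  have /isd_mxP /(_ l k) [_ <-] := sm_isd (e a) sg Ox.
  by apply: near_eq_derive; apply: (near_open oO Ox) => y Oy /=; exact: christoffelE.
have alg (A B C D : 'M[R]_4) : (A - B + C - D) l k = A l k - B l k +
  (C l k - D l k) by rewrite !mxE; ring.
apply: etrans _ (esym (alg _ _ _ _)).
rewrite /curvature !dch; congr (_ + _); rewrite sumrB.
by rewrite [(_ *m _) l k]mxE [X in _ = _ - X]mxE; congr (_ - _); apply: eq_bigr => m _;
  rewrite !christoffelE.
Qed.

Lemma ricci_tensorE c p : chart_dom c p -> ricci_tensor g c p = local_ric (G c) (coord c p).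
Proof.
move=> cp; apply/matrixP => j k; rewrite mxE [RHS]mxE; apply: eq_bigr => i _.
by rewrite -curvatureE ?coordK //; exact: coord_img.
Qed.

Lemma hodgeE c p : chart_dom c p -> hodge g psi c p = hstar (g c p) (psi c p).
Proof.
move=> cp; apply: hodge_star; [exact: metric_sym|exact: metric_det_gt0|exact: two_form_skew].
Qed.

Lemma psi_pmE r c p : chart_dom c p -> psi_pm g psi r c p = dual_part (G c) (P c) r (coord c p).
Proof. by move=> cp; rewrite /psi_pm /dual_part /= coordK // hodgeE. Qed.

Lemma Psi_pmE r c p : chart_dom c p -> Psi_pm g psi r c p = gendo (g c p) (psi_pm g psi r c p).
Proof. by move=> cp; rewrite gendoE. Qed.

(** The Hodge dual is a tensor because all changes of charts preserve the
    orientation. *)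
Lemma psi_pm_law r : tensor02_law (psi_pm g psi r).
Proof.
move=> c d p cp dp; rewrite /psi_pm !hodgeE // (metric_tensor g cp dp) (two_form_tensor psi cp dp).
rewrite star_congr ?transition_oriented //; last exact: two_form_skew.
rewrite -scalemxAr -scalemxAl; congr (_ *: _).
by rewrite mulmxDr mulmxDl -!scalemxAr -!scalemxAl.
Qed.

Lemma metric_unitmx c p : chart_dom c p -> g c p \in unitmx.
Proof. by move=> cp; apply: metric_unit; exact: metric_det_gt0. Qed.

Lemma Psi_pm_law r c d p : chart_dom c p -> chart_dom d p ->
  Psi_pm g psi r c p = invmx (transition_jac c d p) *m Psi_pm g psi r d p *m transition_jac c d p.
Proof.
move=> cp dp; rewrite !Psi_pmE // (psi_pm_law r cp dp) (metric_tensor g cp dp).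
by rewrite gendo_congr ?transition_unit ?metric_unitmx.
Qed.

Lemma endo_norm_conj (J B : 'M[R]_4) : J \in unitmx -> endo_norm (invmx J *m B *m J) = endo_norm B.
Proof.
move=> Ju; rewrite /endo_norm; congr (Num.sqrt (_ * _)).
have -> : invmx J *m B *m J *m (invmx J *m B *m J) = invmx J *m (B *m B) *m J.
  by rewrite !mulmxA mulmxK.
exact: mxtrace_conj.
Qed.

Lemma f_pm_chart r c p : chart_dom c p -> f_pm g psi r p =
  endo_norm (Psi_pm g psi r c p) / Num.sqrt 2.
Proof.
move=> cp; rewrite /f_pm (Psi_pm_law r (chart_at_dom p) cp) endo_norm_conj //.
by apply: transition_unit => //; exact: chart_at_dom.
Qed.

Definition fsq_chart c r := fsq (G c) (P c) r.

(** The factors 1/2 and sqrt 2 in the norm turn - tr (Psi_r^2) / 4 into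
    f_r^2. *)
Lemma f_pmE r c p : chart_dom c p -> f_pm g psi r p = Num.sqrt (fsq_chart c r (coord c p)).
Proof.
move=> cp; rewrite (f_pm_chart _ cp) /endo_norm /fsq_chart /fsq Psi_pmE // psi_pmE // /= coordK //.
move: (\tr _) => t; have -> : - 2^-1 * t = 2 * (- 4^-1 * t) by field.
by rewrite sqrtrM // mulrAC divff ?mul1r // gt_eqF // sqrtr_gt0.
Qed.

Lemma sm_fsq_chart c r : smooth_on (O c) (fsq_chart c r).
Proof. exact: (sm_fsq (@img_open_setT c) (@sm_metric_chart c) (@sm_form_chart c)
  (@metric_chart_gt0 c) r). Qed.

Lemma mem_M1 c p : chart_dom c p -> M_1 g psi p <->
  [/\ 0 < fsq_chart c 1 (coord c p), 0 < fsq_chart c (-1) (coord c p) & fsq_chart c 1 (coord c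
    p) - fsq_chart c (-1) (coord c p) != 0].
Proof.
move=> cp; rewrite /M_1 /M_0 /M_S /setI /= !(f_pmE _ cp) !sqrtr_gt0.
split=> [[[f1 f2] ne]|[f1 f2 ne]].
  by split => //; apply: contra ne; rewrite subr_eq0 => /eqP ->.
split => //; apply: contra ne; rewrite eqr_sqrt ?ltW // => /eqP ->; by rewrite subrr.
Qed.

Lemma M1_open c : open (img c (M_1 g psi)).
Proof.
rewrite openE => x Mx; rewrite /interior; have [cx Mp] := img_coordV Mx.
have Ox : O c x by apply: img_sub Mx.
have := Mp; rewrite (mem_M1 cx) (coordVK Ox) => -[f1 f2 ne].
have oO := @img_open_setT c.
have c1 := sm_cont (@sm_fsq_chart c 1) Ox; have c2 := sm_cont (@sm_fsq_chart c (-1)) Ox.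
have N0 : \forall y \near x, O c y by apply: open_nbhs_nbhs.
have N1 : \forall y \near x, 0 < fsq_chart c 1 y by exact: (cvgr_gt _ c1).
have N2 : \forall y \near x, 0 < fsq_chart c (-1) y by exact: (cvgr_gt _ c2).
have N3 : \forall y \near x, fsq_chart c 1 y - fsq_chart c (-1) y != 0 by exact:
  (cvgr_neq0 _ (cvgB c1 c2)).
near=> y.
have Oy : O c y by near: y.
exists (coordV c y); last exact: coordVK Oy.
split; first exact: img_chart_dom.
apply/(mem_M1 (img_chart_dom Oy)); rewrite (coordVK Oy); split; near: y; [exact: N1|exact:
  N2|exact: N3].
Unshelve. all: by end_near. Qed.

End ChartFields.

(** * The ambikahler structure and its Killing field *)

Section Geometry.
Variables (R : realType) (M : oriented_manifold4 R) (g : metric M) (psi : two_form M) (alpha :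
  one_form M).
Hypothesis SK : star_killing_with g psi alpha.
Implicit Types (c d : chart M) (p : M).
Local Notation vec := 'cV[R]_4.
Local Notation e k := (delta_mx k 0 : vec).
Local Notation O c := (img c setT).
Local Notation G c := (g c \o coordV c).
Local Notation P c := (psi c \o coordV c).
Local Notation A c := (alpha c \o coordV c).

Local Notation M1 := (M_1 g psi).
Local Notation K1 := (fun c p => J_pm g psi 1 c p *m grad g (f_pm g psi 1) c p).
Local Notation K c := (killing_vec (G c) (A c)).

Lemma M1_chart c x : img c M1 x ->
  [/\ O c x, 0 < fsq_chart g psi c 1 x, 0 < fsq_chart g psi c (-1) x & fsq_chart g psi c (-1) x
    - fsq_chart g psi c 1 x != 0].
Proof.
move=> Mx; have [cx Mp] := img_coordV Mx.
have := Mp; rewrite (mem_M1 g psi cx) (coordVK Mx) => -[f1 f2 ne].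
by split; [exact: img_sub Mx | exact: f1 | exact: f2 | rewrite -opprB oppr_eq0].
Qed.

Lemma chart_commutes c x : img c M1 x ->
  let Ric := invmx (G c x) *m (local_ric (G c) x)^T in
  let Phi := gendo (G c x) (hstar (G c x) (P c x)) in
  let Psi := gendo (G c x) (P c x) in
  [/\ Ric *m Phi = Phi *m Ric, Ric *m Psi = Psi *m Ric & nabla_alpha (G c) (A c) x +
    (nabla_alpha (G c) (A c) x)^T = 0].
Proof.
move=> Mx; have [Ox _ _ h0] := M1_chart Mx.
exact: (local_ricci_commutes (@img_open_setT _ _ c) (@sm_metric_chart _ _ g c) (@sm_form_chart _
  _ psi c) (@sm_alpha_chart _ _ alpha c) (@metric_chart_sym _ _ g c)
  (@metric_chart_gt0 _ _ g c) (@form_chart_skew _ _ psi c) (fun x k Ox => SK_local SK k Ox) Ox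
  (endo_form_star (@metric_chart_sym _ _ g c) (@metric_chart_gt0 _ _ g c) (@form_chart_skew _ _
    psi c) Ox) h0).
Qed.

Lemma pd_f r c x k : r * r = 1 -> O c x -> 0 < fsq_chart g psi c r x ->
  pd c k (f_pm g psi r) (coordV c x) = (Num.sqrt (fsq_chart g psi c r x))^-1 * (dual_part (G c)
    (P c) r x *m K c x) k 0.
Proof.
move=> r1 Ox f0; have oO := @img_open_setT _ _ c.
have [df dE] := isd_fsq oO (@sm_metric_chart _ _ g c) (@sm_form_chart _ _ psi c)
  (@metric_chart_sym _ _ g c) (@metric_chart_gt0 _ _ g c)
  (@form_chart_skew _ _ psi c) (fun x k Ox => SK_local SK k Ox) k r1 Ox.
have [_ sE] := is_derive_sqrt f0 df.
rewrite /pd (coordVK Ox).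
have -> : 'D_(e k) (f_pm g psi r \o coordV c) x =
  'D_(e k) (fun y => Num.sqrt (fsq_chart g psi c r y)) x.
  apply: near_eq_derive; apply: (near_open oO Ox) => y Oy /=.
  by rewrite (f_pmE _ _ _ (img_chart_dom Oy)) (coordVK Oy).
rewrite sE dE; move: (Num.sqrt _) (_ k 0) => s q.
by rewrite invfM mulrACA mulVf ?mul1r // pnatr_eq0.
Qed.

Lemma J_pmE r c x : O c x ->
  J_pm g psi r c (coordV c x) = (Num.sqrt (fsq_chart g psi c r x))^-1 *:
    gendo (G c x) (dual_part (G c) (P c) r x).
Proof.
move=> Ox; have cx := img_chart_dom Ox.
rewrite /J_pm (f_pmE _ _ _ cx) (Psi_pmE _ _ _ cx) (psi_pmE _ _ _ cx).
exact: (congr1 (fun y => (Num.sqrt (fsq_chart g psi c r y))^-1 *: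
  gendo (G c x) (dual_part (G c) (P c) r y)) (coordVK Ox)).
Qed.

Lemma J_grad_alg (h Q : 'M[R]_4) (X : vec) (s : R) : Q^T = - Q -> 0 < s ->
  gendo h Q *m gendo h Q = (- s)%:M ->
  ((Num.sqrt s)^-1 *: gendo h Q) *m (invmx h *m ((Num.sqrt s)^-1 *: (Q *m X))) = X.
Proof.
move=> skQ s0 Q2; have sE := sqr_sqrtr (ltW s0).
have n0 : Num.sqrt s != 0 by rewrite gt_eqF // sqrtr_gt0.
rewrite -scalemxAr mulmxA.
have -> : invmx h *m Q = - gendo h Q by rewrite endoE // opprK.
rewrite mulNmx scalerN mulmxN -scalemxAl -!scalemxAr mulmxA Q2 mul_scalar_mx !scalerA -scaleNr.
have -> : - ((Num.sqrt s)^-1 * ((Num.sqrt s)^-1 * - s)) = 1 by rewrite -{3}sE; field.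
by rewrite scale1r.
Qed.

(** The gradient of f_r is - Psi_r K / f_r, and Psi_r^2 = - f_r^2. *)
Lemma J_grad r c x : r * r = 1 -> O c x -> 0 < fsq_chart g psi c r x ->
  J_pm g psi r c (coordV c x) *m grad g (f_pm g psi r) c (coordV c x) = K c x.
Proof.
move=> r1 Ox f0; rewrite J_pmE // /grad /sharp.
have -> : (\row_(j < 4) pd c j (f_pm g psi r) (coordV c x))^T =
    (Num.sqrt (fsq_chart g psi c r x))^-1 *: (dual_part (G c) (P c) r x *m K c x).
  by apply/matrixP => i j; rewrite ord1 mxE [LHS]mxE pd_f // [RHS]mxE.
apply: J_grad_alg f0 _; first exact: (dual_part_skew (@metric_chart_sym _ _ g c)
  (@form_chart_skew _ _ psi c) r Ox).
exact: (gendo_dual_part_sq (@metric_chart_sym _ _ g c) (@metric_chart_gt0 _ _ g c)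
  (@form_chart_skew _ _ psi c) r1 Ox).
Qed.

Lemma K1E c x : img c M1 x -> K1 c (coordV c x) = K c x.
Proof. by move=> Mx; have [Ox f1 _ _] := M1_chart Mx; rewrite J_grad // mulr1. Qed.

Lemma K1_sharp c p : M1 p -> chart_dom c p -> K1 c p = - 2^-1 *: sharp g alpha c p.
Proof. by move=> Mp cp; have := K1E (img_mem cp Mp); rewrite coordK // /killing_vec /= coordK. Qed.

Lemma sm_K1 c : smooth_on (img c M1) (K1 c \o coordV c).
Proof.
apply: (@sm_ext _ _ _ (@M1_open _ _ g psi c) _ (K c)); first by move=> x Mx /=; rewrite K1E.
apply: (@sm_sub _ _ _ (O c)); first exact: img_sub.
exact: (sm_killing_vec (@img_open_setT _ _ c) (@sm_metric_chart _ _ g c) (@sm_alpha_chart _ _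
  alpha c) (@metric_chart_gt0 _ _ g c)).
Qed.

Lemma K1_field : vector_field_on M1 K1.
Proof.
split=> [c|c d p Mp cp dp]; first exact: sm_K1.
apply: etrans (K1_sharp Mp dp) _; apply: etrans _ (esym (congr1 (mulmx _) (K1_sharp Mp cp))).
rewrite /sharp (metric_tensor g cp dp) (one_form_law alpha cp dp).
have := transition_unit cp dp; have := metric_unitmx g dp.
move: (transition_jac c d p) (g d p) (alpha d p) => J h a hu Ju.
have Jtu : J^T \in unitmx by rewrite unitmx_tr.
have JhJ : J^T *m h *m J \in unitmx by rewrite !unitmx_mul Jtu hu Ju.
rewrite -scalemxAr; congr (_ *: _).
have -> : invmx (J^T *m h *m J) *m (a *m J)^T = invmx J *m (invmx h *m a^T).
  by rewrite -[RHS](mulKmx JhJ) trmx_mul !mulmxA mulmxK // mulmxK.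
by rewrite mulKVmx.
Qed.

Lemma jac_K1 c x : img c M1 x -> jac (K1 c \o coordV c) x = killing_jac (G c) (A c) x.
Proof.
move=> Mx; apply/matrixP => i j; rewrite (jacE (@sm_K1 c)) // [RHS]mxE; congr (fun_of_matrix _ i 0).
by apply: near_eq_derive; apply: (near_open (@M1_open _ _ g psi c) Mx) => y My /=; exact: K1E.
Qed.

Lemma lie_chart c x (T : matfield M) (T' : vec -> 'M[R]_4) : img c M1 x ->
  (forall y, O c y -> T c (coordV c y) = T' y) ->
  \sum_k (K1 c (coordV c x)) k 0 *: 'D_(e k) (T c \o coordV c) x
  + (jac (K1 c \o coordV c) x)^T *m T c (coordV c x)
  + T c (coordV c x) *m jac (K1 c \o coordV c) x = lie (G c) (A c) T' x.
Proof.
move=> Mx TE; have [Ox _ _ _] := M1_chart Mx.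
have dE k : 'D_(e k) (T c \o coordV c) x = 'D_(e k) T' x.
  by apply: near_eq_derive; apply: (near_open (@img_open_setT _ _ c) Ox) => y Oy; exact: TE.
have sE : \sum_k (K1 c (coordV c x)) k 0 *: 'D_(e k) (T c \o coordV c) x = \sum_k K c x k 0 *:
  'D_(e k) T' x.
  by apply: eq_bigr => k _; exact: (congr2 (fun (v : vec) (B : 'M[R]_4) => v k 0 *:
    B) (K1E Mx) (dE k)).
exact: (congr2 +%R (congr2 +%R sE (congr2 (fun B C : 'M[R]_4 => B^T *m C) (jac_K1 Mx) (TE x Ox)))
  (congr2 (fun B C : 'M[R]_4 => B *m C) (TE x Ox) (jac_K1 Mx))).
Qed.

Lemma lie_G0 c x : img c M1 x -> lie (G c) (A c) (G c) x = 0.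
Proof.
move=> Mx; have [Ox _ _ _] := M1_chart Mx; have [_ _ sk] := chart_commutes Mx.
exact: (lie_metric0 (@img_open_setT _ _ c) (@sm_metric_chart _ _ g c) (@sm_alpha_chart _ _ alpha
  c) (@metric_chart_sym _ _ g c) (@metric_chart_gt0 _ _ g c) Ox sk).
Qed.

Lemma K1_killing : killing_on g M1 K1.
Proof.
split=> [|c p Mp cp]; first exact: K1_field.
have Mx := img_mem cp Mp; have [Ox _ _ _] := M1_chart Mx.
have := lie_chart Mx (fun y _ => erefl (G c y)); rewrite (lie_G0 Mx) coordK // => L0.
rewrite -L0; apply/matrixP => i j; rewrite mxE !big_split /=.
have gd k a b := @pd_mx R M 4 4 c k g a b setT _ (@sm_metric_chart _ _ g c) Ox.
have Kd k a := @pd_mx R M 4 1 c k K1 a 0 M1 _ (@sm_K1 c) Mx.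
rewrite coordK // in gd Kd.
have jE a b : jac (K1 c \o coordV c) (coord c p) a b =
  ('D_(e b) (K1 c \o coordV c) (coord c p)) a 0.
  exact: (jacE (@sm_K1 c)).
rewrite [RHS]mxE; congr (_ + _).
  rewrite [RHS]mxE; congr (_ + _).
    by rewrite summxE; apply: eq_bigr => k _; rewrite [RHS]mxE -gd.
  by rewrite [RHS]mxE; apply: eq_bigr => k _; rewrite [_^T _ _]mxE jE -Kd mulrC.
by rewrite [RHS]mxE; apply: eq_bigr => k _; rewrite jE -Kd.
Qed.

Lemma flow_g : flow_preserves02 M1 K1 g.
Proof.
apply: flow_preserves_lie; [exact: M1_open|exact: sm_K1| |exact: metric_tensor|].
  by move=> c; apply: sm_sub (@sm_metric_chart _ _ g c); exact: img_sub.
by move=> d y My; rewrite (lie_chart My (fun y _ => erefl (G d y))) lie_G0.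
Qed.

Lemma flow_psi r : flow_preserves02 M1 K1 (psi_pm g psi r).
Proof.
have PeE c y : O c y -> psi_pm g psi r c (coordV c y) = dual_part (G c) (P c) r y.
  by move=> Oy; rewrite psi_pmE ?(coordVK Oy) //; exact: img_chart_dom Oy.
apply: flow_preserves_lie; [exact: M1_open|exact: sm_K1| |exact: psi_pm_law|].
  move=> c; apply: (@sm_sub _ _ _ (O c)); first exact: img_sub.
  apply: (@sm_ext _ _ _ (@img_open_setT _ _ c) _ (dual_part (G c) (P c) r));
    first by move=> y Oy /=; rewrite PeE.
  exact: (sm_dual_part (@img_open_setT _ _ c) (@sm_metric_chart _ _ g c) (@sm_form_chart _ _ psi
    c) (@metric_chart_gt0 _ _ g c)).
move=> d y My; have [Oy _ _ _] := M1_chart My; rewrite (lie_chart My (PeE d)).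
exact: (lie_dual_part0 (@img_open_setT _ _ d) (@sm_metric_chart _ _ g d) (@sm_form_chart _ _ psi
  d) (@sm_alpha_chart _ _ alpha d) (@metric_chart_sym _ _ g d) (@metric_chart_gt0 _ _ g d)
  (@form_chart_skew _ _ psi d) (fun x k Ox => SK_local SK k Ox) r Oy (lie_G0 My)).
Qed.

Lemma conj_scale (D B C : 'M[R]_4) (s t : R) : D \in unitmx -> B = invmx D *m C *m D -> s = t ->
  (t^-1 *: C) *m D = D *m (s^-1 *: B).
Proof. by move=> Du -> ->; rewrite -scalemxAl -scalemxAr !mulmxA mulmxV // mul1mx. Qed.

Lemma conj_form (D J J' h h' : 'M[R]_4) : J' *m D = D *m J -> D^T *m h' *m D = h ->
  D^T *m (J'^T *m h') *m D = J^T *m h.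
Proof. by move=> JE <-; rewrite !mulmxA; congr (_ *m _ *m _); rewrite -!trmx_mul JE. Qed.

(** The flow intertwines g and psi_r at both ends, hence Psi_r up to
    conjugation, hence the function f_r, which is a trace. *)
Lemma flow_ambikahler r U a b F t p c d : local_flow M1 K1 U a b F -> a < t < b -> U p ->
  chart_dom c p -> chart_dom d (F t p) ->
  let D := diff_mx (F t) c d p in
  [/\ D^T *m g_pm g psi r d (F t p) *m D = g_pm g psi r c p,
      J_pm g psi r d (F t p) *m D = D *m J_pm g psi r c p
    & D^T *m omega_pm g psi r d (F t p) *m D = omega_pm g psi r c p].
Proof.
move=> lf tab Up cp dp D.
have gE : D^T *m g d (F t p) *m D = g c p by exact: (flow_g lf).
have pE : D^T *m psi_pm g psi r d (F t p) *m D = psi_pm g psi r c p by exact: (flow_psi r lf).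
have Du : D \in unitmx.
  by have := metric_unitmx g cp; rewrite -gE !unitmx_mul => /andP[].
have PE : Psi_pm g psi r c p = invmx D *m Psi_pm g psi r d (F t p) *m D.
  by rewrite !Psi_pmE // -gE -pE gendo_congr // metric_unitmx.
have fE : f_pm g psi r p = f_pm g psi r (F t p).
  by rewrite (f_pm_chart _ _ _ cp) (f_pm_chart _ _ _ dp) PE endo_norm_conj.
have gpE : D^T *m g_pm g psi r d (F t p) *m D = g_pm g psi r c p.
  by rewrite /g_pm -scalemxAr -scalemxAl gE fE.
have JE : J_pm g psi r d (F t p) *m D = D *m J_pm g psi r c p.
  exact: (conj_scale Du PE fE).
split; [exact: gpE | exact: JE | exact: (conj_form JE gpE)].
Qed.

Lemma ricci_tensor_law : tensor02_law (ricci_tensor g).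
Proof.
move=> c d p cp dp; rewrite !ricci_tensorE //.
have h := @ric_tensor R (img c (chart_dom d)) (O d) (coord d \o coordV c) (G c) (G d).
have Ox : img c (chart_dom d) (coord c p) by exact: img_mem.
have inO x : img c (chart_dom d) x -> O c x by exact: img_sub.
have E : local_ric (G c) (coord c p) = (transition_jac c d p)^T *m
    local_ric (G d) ((coord d \o coordV c) (coord c p)) *m transition_jac c d p; last first.
  apply: etrans E _.
  exact: (congr1 (fun q => (transition_jac c d p)^T *m local_ric (G d) (coord d q) *m
    transition_jac c d p) (coordK cp)).
apply: h Ox.
- by apply: img_open; exact: chart_dom_open.
- exact: img_open_setT.
- exact: sm_transition.
- by move=> x /img_coordV [_ dx]; exact: coord_img.
- by apply: sm_sub (@sm_metric_chart _ _ g c) => x /inO.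
- by move=> x /inO; exact: metric_chart_sym.
- by move=> x /inO; exact: metric_chart_gt0.
- exact: sm_metric_chart.
- exact: metric_chart_sym.
- exact: metric_chart_gt0.
- move=> x Mx; have [cx dx] := img_coordV Mx.
  by have := transition_unit cx dx; rewrite /transition_jac (coordVK Mx).
- move=> x Mx; have [cx dx] := img_coordV Mx.
  by rewrite /= coordK // (metric_tensor g cx dx) /transition_jac (coordVK Mx).
Qed.

Lemma ricci_endo_law c d p : chart_dom c p -> chart_dom d p ->
  ricci_endo g c p = invmx (transition_jac c d p) *m ricci_endo g d p *m transition_jac c d p.
Proof.
move=> cp dp; rewrite /ricci_endo /endo_of -!gendoE (ricci_tensor_law cp dp) (metric_tensor g cp
  dp).
by rewrite gendo_congr ?transition_unit ?metric_unitmx.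
Qed.

Lemma J_pm_law r c d p : chart_dom c p -> chart_dom d p ->
  J_pm g psi r c p = invmx (transition_jac c d p) *m J_pm g psi r d p *m transition_jac c d p.
Proof. by move=> cp dp; rewrite /J_pm (Psi_pm_law g psi r cp dp) -scalemxAr -scalemxAl. Qed.

Definition Ric_J c p := ricci_endo g c p *m - (J_pm g psi 1 c p *m J_pm g psi (-1) c p).

Lemma tr_ricci_chart c d p : chart_dom c p -> chart_dom d p ->
  \tr (ricci_endo g c p) = \tr (ricci_endo g d p).
Proof. by move=> cp dp; rewrite (ricci_endo_law cp dp) mxtrace_conj // transition_unit. Qed.

Lemma tr_Ric_J_chart c d p : chart_dom c p -> chart_dom d p -> \tr (Ric_J c p) = \tr (Ric_J d p).
Proof.
move=> cp dp; rewrite /Ric_J (ricci_endo_law cp dp) (J_pm_law 1 cp dp) (J_pm_law (-1) cp dp).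
have Ju := transition_unit cp dp; move: (transition_jac c d p) Ju => J Ju.
have -> (X Y Z : 'M[R]_4) : invmx J *m X *m J *m - (invmx J *m Y *m J *m (invmx J *m Z *m J)) =
   invmx J *m (X *m - (Y *m Z)) *m J.
  by rewrite !mulmxN mulNmx !mulmxA !mulmxK.
by rewrite mxtrace_conj.
Qed.

Lemma ricci_endoE c x : O c x -> ricci_endo g c (coordV c x) = invmx (G c x) *m
  (local_ric (G c) x)^T.
Proof. by move=> Ox; rewrite /ricci_endo /endo_of ricci_tensorE ?(coordVK Ox) //; exact:
  img_chart_dom Ox. Qed.

Lemma ricci_J_commute c x r : img c M1 x ->
  ricci_endo g c (coordV c x) *m gendo (G c x) (dual_part (G c) (P c) r x) =
    gendo (G c x) (dual_part (G c) (P c) r x) *m ricci_endo g c (coordV c x).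
Proof.
move=> Mx; have [Ox _ _ _] := M1_chart Mx; have [E1 E2 _] := chart_commutes Mx.
rewrite ricci_endoE //; move: E1 E2; move: (invmx _ *m _^T) => Ri E1 E2.
have -> : gendo (G c x) (dual_part (G c) (P c) r x) = 2^-1 *: (gendo (G c x) (P c x) + r *:
  gendo (G c x) (hstar (G c x) (P c x))).
  by rewrite /dual_part endoZ endoD endoZ.
by rewrite -scalemxAr -scalemxAl mulmxDr mulmxDl -scalemxAr -scalemxAl E1 E2.
Qed.

Lemma scaled_square (s : R) (Q : 'M[R]_4) : 0 < s -> Q *m Q = (- s)%:M ->
  ((Num.sqrt s)^-1 *: Q) *m ((Num.sqrt s)^-1 *: Q) = - 1%:M.
Proof.
move=> s0 Q2; have sE := sqr_sqrtr (ltW s0).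
have n0 : Num.sqrt s != 0 by rewrite gt_eqF // sqrtr_gt0.
rewrite -scalemxAl -scalemxAr Q2 scalerA -[(- s)%:M]scalemx1 scalerA.
have -> : (Num.sqrt s)^-1 * (Num.sqrt s)^-1 * - s = -1 by rewrite -{3}sE; field.
by rewrite scaleN1r.
Qed.

(** The two rescaled endomorphisms are complex structures of opposite duality
    types. *)
Lemma ricci_split c x : img c M1 x -> let p := coordV c x in
  let tau := - (J_pm g psi 1 c p *m J_pm g psi (-1) c p) in
  ricci_endo g c p = (4^-1 * \tr (ricci_endo g c p)) *:
    1%:M + (4^-1 * \tr (ricci_endo g c p *m tau)) *: tau.
Proof.
move=> Mx p; have [Ox f1 f2 _] := M1_chart Mx.
have n1 : (1 : R) * 1 = 1 by rewrite mulr1.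
have n2 : (-1 : R) * -1 = 1 by rewrite mulrNN mulr1.
have skP r := dual_part_skew (@metric_chart_sym _ _ g c) (@form_chart_skew _ _ psi c) r Ox.
have dP r (r1 : r * r = 1) := star_dual_part (@metric_chart_sym _ _ g c) (@metric_chart_gt0 _ _
  g c) (@form_chart_skew _ _ psi c) r1 Ox.
have qP r (r1 : r * r = 1) := gendo_dual_part_sq (@metric_chart_sym _ _ g c) (@metric_chart_gt0
  _ _ g c) (@form_chart_skew _ _ psi c) r1 Ox.
have cP r := ricci_J_commute r Mx.
have skS s r : (s *: dual_part (G c) (P c) r x)^T = - (s *:
  dual_part (G c) (P c) r x) by rewrite linearZ /= skP scalerN.
have J1 := J_pmE 1 Ox; have J2 := J_pmE (-1) Ox; rewrite /p J1 J2 -!endoZ.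
apply: commuting_sym (skS _ _) (skS _ _) _ _ _ _ _ _ _; [exact: (metric_chart_sym g Ox)|exact:
  (metric_chart_gt0 g Ox)| | | | | | |].
- by rewrite starZ dP // scale1r.
- by rewrite starZ dP // scaleN1r scalerN.
- by rewrite endoZ; apply: scaled_square => //; exact: qP.
- by rewrite endoZ; apply: scaled_square => //; exact: qP.
- rewrite ricci_endoE // mulKVmx ?trmxK; last exact: (metric_unitmx g (img_chart_dom Ox)).
  by rewrite (local_ric_sym (@img_open_setT _ _ c) (@sm_metric_chart _ _ g c) (@metric_chart_sym
    _ _ g c) (@metric_chart_gt0 _ _ g c) Ox).
- by rewrite endoZ -scalemxAr -scalemxAl cP.
- by rewrite endoZ -scalemxAr -scalemxAl cP.
Qed.

Lemma sm_ricci_endo c : smooth_on (img c M1) (ricci_endo g c \o coordV c).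
Proof.
have oM := @M1_open _ _ g psi c; have sub : img c M1 `<=` O c by exact: img_sub.
apply: (@sm_ext _ _ _ oM _ (fun x => invmx (G c x) *m (local_ric (G c) x)^T)).
  by move=> x /sub Ox /=; rewrite ricci_endoE.
apply: (sm_sub sub); apply: sm_mulmx; first exact: img_open_setT.
  apply: sm_invmx; [exact: img_open_setT | | exact: sm_metric_chart].
  by move=> x Ox; exact: (metric_unitmx g (img_chart_dom Ox)).
apply: sm_tr; first exact: img_open_setT.
exact: (sm_ric (@img_open_setT _ _ c) (@sm_metric_chart _ _ g c) (@metric_chart_gt0 _ _ g c)).
Qed.

Lemma sm_J_pm c r : (r = 1 \/ r = -1) -> smooth_on (img c M1) (J_pm g psi r c \o coordV c).
Proof.
move=> r1; have oM := @M1_open _ _ g psi c; have sub : img c M1 `<=` O c by exact: img_sub.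
have f0 x : img c M1 x -> 0 < fsq_chart g psi c r x by move=> /M1_chart [_ f1 f2 _]; case: r1 => ->.
apply: (@sm_ext _ _ _ oM _ (fun x => (Num.sqrt (fsq_chart g psi c r x))^-1 *:
  gendo (G c x) (dual_part (G c) (P c) r x))).
  by move=> x /sub Ox /=; rewrite J_pmE.
apply: smZ => //.
  apply: smV => //; first by move=> x /f0 h; rewrite gt_eqF // sqrtr_gt0.
  by apply: sm_sqrt => //; apply: sm_sub sub _; exact: sm_fsq_chart.
apply: sm_sub sub _; apply: sm_gendo; [exact: img_open_setT|exact: sm_metric_chart| |exact:
  metric_chart_gt0].
exact: (sm_dual_part (@img_open_setT _ _ c) (@sm_metric_chart _ _ g c) (@sm_form_chart _ _ psi
  c) (@metric_chart_gt0 _ _ g c)).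
Qed.

End Geometry.

Theorem proposition2p4 (R : realType) (M : oriented_manifold4 R)
    (M_connected : connected [set: M]) (g : metric M)
    (psi : two_form M) (alpha : one_form M)
    (psi_star_killing : star_killing_with g psi alpha)
    (psi_nonparallel : ~ parallel g psi) :
  let fp := f_pm g psi 1 in
  let fm := f_pm g psi (-1) in
  let Jp := J_pm g psi 1 in
  let Jm := J_pm g psi (-1) in
  let tau : matfield M := fun c p => - (Jp c p *m Jm c p) in
  let Ric := ricci_endo g in
  let K1 : vfield M := fun c p => Jp c p *m grad g fp c p in
  [/\ forall c p, M_1 g psi p -> chart_dom c p ->
        Ric c p *m Jp c p = Jp c p *m Ric c p /\
        Ric c p *m Jm c p = Jm c p *m Ric c p,
      exists a b : M -> R,
        [/\ smooth_fun (M_1 g psi) a, smooth_fun (M_1 g psi) b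
          & forall c p, M_1 g psi p -> chart_dom c p ->
            Ric c p = a p *: 1%:M + b p *: tau c p],
      forall c p, M_1 g psi p -> chart_dom c p ->
        K1 c p = Jm c p *m grad g fm c p /\
        K1 c p = - 2^-1 *: sharp g alpha c p,
      killing_on g (M_1 g psi) K1
    & [/\ flow_preserves02 (M_1 g psi) K1 (g_pm g psi 1),
          flow_preserves02 (M_1 g psi) K1 (g_pm g psi (-1)),
          flow_preserves11 (M_1 g psi) K1 Jp
        & [/\ flow_preserves11 (M_1 g psi) K1 Jm,
          flow_preserves02 (M_1 g psi) K1 (omega_pm g psi 1)
        & flow_preserves02 (M_1 g psi) K1 (omega_pm g psi (-1))]]].
Proof.
have SK := psi_star_killing.
have n1 : (1 : R) * 1 = 1 by rewrite mulr1.
have n2 : (-1 : R) * -1 = 1 by rewrite mulrNN mulr1.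
move=> fp fm Jp Jm tau Ric K1; split.
- move=> c p Mp cp; have Mx := img_mem cp Mp; have [Ox _ _ _] := M1_chart Mx.
  have C r : Ric c p *m J_pm g psi r c p = J_pm g psi r c p *m Ric c p.
    have E := ricci_J_commute SK r Mx; have JE := J_pmE g psi r Ox; rewrite (coordK cp) in E JE.
    by rewrite JE -scalemxAr -scalemxAl; congr (_ *: _).
  by split; exact: C.
- exists (fun p => 4^-1 * \tr (Ric (chart_at p) p)).
  exists (fun p => 4^-1 * \tr (Ric_J g psi (chart_at p) p)).
  have oM c := @M1_open _ _ g psi c.
  split.
  + move=> c; apply: (@sm_ext _ _ _ (oM c) _ (fun x => 4^-1 * \tr (Ric c (coordV c x)))).
      by move=> x /img_coordV [cx _]; exact: (congr1 ( *%R 4^-1) (tr_ricci_chart g cx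
        (chart_at_dom _))).
    apply: (smM (oM c)); first exact: (@sm_cst _ _ _ (oM c) R^o).
    by apply: (sm_mxtrace (oM c)); exact: sm_ricci_endo.
  + move=> c; apply: (@sm_ext _ _ _ (oM c) _ (fun x => 4^-1 * \tr (Ric_J g psi c (coordV c x)))).
      by move=> x /img_coordV [cx _]; exact: (congr1 ( *%R 4^-1) (tr_Ric_J_chart g psi cx
        (chart_at_dom _))).
    apply: (smM (oM c)); first exact: (@sm_cst _ _ _ (oM c) R^o).
    apply: (sm_mxtrace (oM c)).
    apply: (sm_mulmx (oM c)); first exact: sm_ricci_endo.
    apply: (@sm_ext _ _ _ (oM c) _ (fun x => (-1 : R^o) *:
      (Jp c (coordV c x) *m Jm c (coordV c x)))).
      by move=> x _; rewrite scaleN1r.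
    apply: (smZ (oM c)); first exact: (@sm_cst _ _ _ (oM c) R^o).
    by apply: (sm_mulmx (oM c)); apply: sm_J_pm; [left|right].
  + move=> c p Mp cp; have Mx := img_mem cp Mp.
    have E := ricci_split SK Mx; rewrite (coordK cp) in E; apply: etrans E _.
    exact: (congr2 (fun s t => (4^-1 * s) *: (1%:M : 'M[R]_4) + (4^-1 * t) *: tau c p)
      (tr_ricci_chart g cp (chart_at_dom p)) (tr_Ric_J_chart g psi cp (chart_at_dom p))).
- move=> c p Mp cp; split; last exact: (K1_sharp SK Mp cp).
  have [Ox f1 f2 _] := M1_chart (img_mem cp Mp).
  have E1 := J_grad SK n1 Ox f1; have E2 := J_grad SK n2 Ox f2.
  by rewrite (coordK cp) in E1 E2; apply: etrans E1 (esym E2).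
- exact: K1_killing SK.
- have A r U a b F (lf : local_flow (M_1 g psi) K1 U a b F) t p c d tab Up cp dp :=
    @flow_ambikahler R M g psi alpha SK r U a b F t p c d lf tab Up cp dp.
  split=> [U a b F lf t p c d tab Up cp dp|U a b F lf t p c d tab Up cp dp|U a b F lf t p c d
    tab Up cp dp|].
  + by have [] := A 1 U a b F lf t p c d tab Up cp dp.
  + by have [] := A (-1) U a b F lf t p c d tab Up cp dp.
  + by have [] := A 1 U a b F lf t p c d tab Up cp dp.
  split=> U a b F lf t p c d tab Up cp dp.
  + by have [] := A (-1) U a b F lf t p c d tab Up cp dp.
  + by have [] := A 1 U a b F lf t p c d tab Up cp dp.
  + by have [] := A (-1) U a b F lf t p c d tab Up cp dp.
Qed.
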